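(* Let $K$ be a field and $(E,w)$ a weighted graph. Then the following are equivalent: (i) The weighted Leavitt path algebra $L(E,w)=L_K(E,w)$ is von Neumann regular. (ii) $(E,w)$ is acyclic and well-behaved. (iii) $L(E,w)$ is locally matricial.
   Context: Rings and algebras are associative but not necessarily unital. A (directed) graph is $E=(E^0,E^1,s,r)$ with vertex set $E^0$, edge set $E^1$ and source and range maps $s,r:E^1\to E^0$. All graphs are assumed nonempty, row-finite (every vertex emits only finitely many edges) and connected (as undirected graphs). A vertex is a sink if it emits no edge and regular otherwise; $E^0_{\mathrm{reg}}$ is the set of regular vertices. A weighted graph is a pair $(E,w)$ with $E$ a graph and $w:E^1\to\{1,2,3,\dots\}$ a map. For regular $v$ put $w(v)=\max\{w(e)\mid e\in s^{-1}(v)\}$. $L(E,w)$ is the $K$-algebra presented by generators $\{v,e_i,e_i^*\mid v\in E^0,e\in E^1,1\le i\le w(e)\}$ and relations: (1) $uv=\delta_{uv}u$ ($u,v\in E^0$); (2) $s(e)e_i=e_i=e_ir(e)$, $r(e)e_i^*=e_i^*=e_i^*s(e)$ ($e\in E^1$, $1\le i\le w(e)$); (3) $\sum_{e\in s^{-1}(v)}e_ie_j^*=\delta_{ij}v$ ($v\in E^0_{\mathrm{reg}}$, $1\le i,j\le w(v)$); (4) $\sum_{1\le i\le w(v)}e_i^*f_i=\delta_{ef}r(e)$ ($v\in E^0_{\mathrm{reg}}$, $e,f\in s^{-1}(v)$); here $e_i,e_i^*$ are set to zero whenever $i>w(e)$. An edge $e$ is unweighted if $w(e)=1$ and weighted if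 $w(e)>1$; $E^1_w$ is the set of weighted edges. A path is either a vertex (trivial path) or a word $x_1\cdots x_n$ ($n\ge1$) of edges with $r(x_i)=s(x_{i+1})$. A cycle is a nontrivial path $x_1\cdots x_n$ with $r(x_n)=s(x_1)$ and $s(x_i)\ne s(x_j)$ for $i\neq j$; it is based at $s(x_1)$. Write $u\ge v$ if there is a path from $u$ to $v$; $T(u)=\{v\mid u\ge v\}$ and $T(X)=\bigcup_{u\in X}T(u)$ for $X\subseteq E^0$. Edges $e,f$ are in line if $e=f$, or $r(e)\ge s(f)$, or $r(f)\ge s(e)$. $(E,w)$ is acyclic if $E$ contains no cycle. $(E,w)$ is well-behaved if all of the following hold: (LPA1) any vertex emits at most one weighted edge; (LPA2) any vertex $v\in T(r(E^1_w))$ emits at most one edge; (LPA3) if two weighted edges $e,f$ are not in line, then $T(r(e))\cap T(r(f))=\emptyset$; (W1) no cycle is based at a vertex $v\in T(r(E^1_w))$; (W2) there are no $n\ge1$ and (nontrivial) paths $p_1,\dots,p_n,q_1,\dots,q_n$ in $E$ such that $r(p_i)=r(q_i)$ ($1\le i\le n$), $s(p_1)=s(q_n)$, $s(p_i)=s(q_{i-1})$ ($2\le i\le n$), and for every $1\le i\le n$ the first letter of $p_i$ is a weighted edge, the first letter of $q_i$ is an unweighted edge, and the last letters of $p_i$ and $q_i$ are distinct. A ring $R$ is von Neumann regular if for any $x\in R$ there is $y\in R$ with $xyx=x$. A $K$-algebra is matricial if it is isomorphic to a finite direct sum of full finite-dimensional matrix algebras over $K$, and locally matricial if it is a direct limit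 of matricial $K$-algebras (connecting homomorphisms need not be unital). *)

(* Defs.v *)
From HB Require Import structures.
From Stdlib Require Import Relation_Operators.
From mathcomp Require Import all_boot all_algebra generic_quotient finmap.
From mathcomp Require Import boolp classical_sets functions cardinality.

Set Implicit Arguments.
Unset Strict Implicit.
Unset Printing Implicit Defensive.

Import GRing.Theory.

Local Open Scope classical_set_scope.
Local Open Scope ring_scope.

Reserved Notation "x ** y" (at level 40, left associativity).

(* Associative, not necessarily unital, R-algebras. *)
HB.mixin Record Lmodule_isNUAlgebra (R : pzRingType) A of GRing.Lmodule R A := {
  numul : A -> A -> A;
  numulA : associative numul;
  numulDl : left_distributive numul +%R;
  numulDr : right_distributive numul +%R;
  numulZl : forall (a : R) (x y : A), numul (a *: x) y = a *: numul x y;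
  numulZr : forall (a : R) (x y : A), numul x (a *: y) = a *: numul x y
}.

#[short(type="nuAlgType")]
HB.structure Definition NUAlgebra (R : pzRingType) :=
  {A of Lmodule_isNUAlgebra R A & GRing.Lmodule R A}.

Notation "x ** y" := (numul x y) : ring_scope.

Definition nualg_hom (K : fieldType) (A B : nuAlgType K) (f : A -> B) : Prop :=
  linear f /\ {morph f : x y / x ** y}.

Definition nualg_isomorphic (K : fieldType) (A B : nuAlgType K) : Prop :=
  exists f : A -> B, nualg_hom f /\ bijective f.

Definition von_neumann_regular (K : fieldType) (A : nuAlgType K) : Prop :=
  forall x : A, exists y : A, x ** y ** x = x.

(* The direct sum of the full matrix algebras of sizes (n k).+1, for k < m; the
   shift makes every block nonzero, and m = 0 gives the zero algebra. *)
Definition matrix_sum (K : fieldType) (m : nat) (n : 'I_m -> nat) : Type :=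
  {dffun forall k : 'I_m, 'M[K]_((n k).+1)}.

HB.instance Definition _ (K : fieldType) (m : nat) (n : 'I_m -> nat) :=
  Choice.on (matrix_sum K n).

Definition msum_build (K : fieldType) (m : nat) (n : 'I_m -> nat)
    (F : forall k : 'I_m, 'M[K]_((n k).+1)) : matrix_sum K n :=
  [ffun k : 'I_m => (F k : 'M[K]_((n k).+1))].

Definition msum_proj (K : fieldType) (m : nat) (n : 'I_m -> nat)
    (x : matrix_sum K n) (k : 'I_m) : 'M[K]_((n k).+1) :=
  (x : {dffun forall k : 'I_m, 'M[K]_((n k).+1)}) k.

Lemma msum_buildE (K : fieldType) (m : nat) (n : 'I_m -> nat)
    (F : forall k : 'I_m, 'M[K]_((n k).+1)) (k : 'I_m) :
  msum_proj (msum_build F) k = F k.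
Proof. by rewrite /msum_proj /msum_build ffunE. Qed.

Lemma msumP (K : fieldType) (m : nat) (n : 'I_m -> nat) (x y : matrix_sum K n) :
  (forall k, msum_proj x k = msum_proj y k) -> x = y.
Proof. by move=> xy; apply/ffunP => k; exact: xy. Qed.

Definition msum_zero (K : fieldType) (m : nat) (n : 'I_m -> nat) :
  matrix_sum K n := msum_build (fun k => 0).

Definition msum_opp (K : fieldType) (m : nat) (n : 'I_m -> nat)
  (x : matrix_sum K n) : matrix_sum K n := msum_build (fun k => - msum_proj x k).

Definition msum_add (K : fieldType) (m : nat) (n : 'I_m -> nat)
    (x y : matrix_sum K n) : matrix_sum K n :=
  msum_build (fun k => msum_proj x k + msum_proj y k).

Definition msum_scale (K : fieldType) (m : nat) (n : 'I_m -> nat)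
    (a : K) (x : matrix_sum K n) : matrix_sum K n :=
  msum_build (fun k => a *: msum_proj x k).

Definition msum_mul (K : fieldType) (m : nat) (n : 'I_m -> nat)
    (x y : matrix_sum K n) : matrix_sum K n :=
  msum_build (fun k => msum_proj x k *m msum_proj y k).

Lemma msum_addA (K : fieldType) (m : nat) (n : 'I_m -> nat) :
  associative (@msum_add K m n).
Proof. by move=> x y z; apply: msumP => k; rewrite !msum_buildE addrA. Qed.

Lemma msum_addC (K : fieldType) (m : nat) (n : 'I_m -> nat) :
  commutative (@msum_add K m n).
Proof. by move=> x y; apply: msumP => k; rewrite !msum_buildE addrC. Qed.

Lemma msum_add0 (K : fieldType) (m : nat) (n : 'I_m -> nat) :
  left_id (msum_zero K n) (@msum_add K m n).
Proof. by move=> x; apply: msumP => k; rewrite !msum_buildE add0r. Qed.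

Lemma msum_addN (K : fieldType) (m : nat) (n : 'I_m -> nat) :
  left_inverse (msum_zero K n) (@msum_opp K m n) (@msum_add K m n).
Proof. by move=> x; apply: msumP => k; rewrite !msum_buildE addNr. Qed.

HB.instance Definition _ (K : fieldType) (m : nat) (n : 'I_m -> nat) :=
  GRing.isZmodule.Build (matrix_sum K n)
    (@msum_addA K m n) (@msum_addC K m n) (@msum_add0 K m n) (@msum_addN K m n).

Lemma msum_scaleA (K : fieldType) (m : nat) (n : 'I_m -> nat)
    (a b : K) (x : matrix_sum K n) :
  msum_scale a (msum_scale b x) = msum_scale (a * b) x.
Proof. by apply: msumP => k; rewrite !msum_buildE scalerA. Qed.

Lemma msum_scale1 (K : fieldType) (m : nat) (n : 'I_m -> nat) :
  left_id 1 (@msum_scale K m n).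
Proof. by move=> x; apply: msumP => k; rewrite !msum_buildE scale1r. Qed.

Lemma msum_scaleDr (K : fieldType) (m : nat) (n : 'I_m -> nat) :
  right_distributive (@msum_scale K m n) +%R.
Proof. by move=> a x y; apply: msumP => k; rewrite !msum_buildE scalerDr. Qed.

Lemma msum_scaleDl (K : fieldType) (m : nat) (n : 'I_m -> nat)
    (x : matrix_sum K n) :
  {morph (@msum_scale K m n)^~ x : a b / a + b}.
Proof. by move=> a b; apply: msumP => k; rewrite !msum_buildE scalerDl. Qed.

HB.instance Definition _ (K : fieldType) (m : nat) (n : 'I_m -> nat) :=
  GRing.Zmodule_isLmodule.Build K (matrix_sum K n)
    (@msum_scaleA K m n) (@msum_scale1 K m n)
    (@msum_scaleDr K m n) (@msum_scaleDl K m n).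

Lemma msum_mulA (K : fieldType) (m : nat) (n : 'I_m -> nat) :
  associative (@msum_mul K m n).
Proof. by move=> x y z; apply: msumP => k; rewrite !msum_buildE mulmxA. Qed.

Lemma msum_mulDl (K : fieldType) (m : nat) (n : 'I_m -> nat) :
  left_distributive (@msum_mul K m n) +%R.
Proof. by move=> x y z; apply: msumP => k; rewrite !msum_buildE mulmxDl. Qed.

Lemma msum_mulDr (K : fieldType) (m : nat) (n : 'I_m -> nat) :
  right_distributive (@msum_mul K m n) +%R.
Proof. by move=> x y z; apply: msumP => k; rewrite !msum_buildE mulmxDr. Qed.

Lemma msum_mulZl (K : fieldType) (m : nat) (n : 'I_m -> nat)
    (a : K) (x y : matrix_sum K n) :
  msum_mul (a *: x) y = a *: msum_mul x y.
Proof. by apply: msumP => k; rewrite !msum_buildE scalemxAl. Qed.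

Lemma msum_mulZr (K : fieldType) (m : nat) (n : 'I_m -> nat)
    (a : K) (x y : matrix_sum K n) :
  msum_mul x (a *: y) = a *: msum_mul x y.
Proof. by apply: msumP => k; rewrite !msum_buildE scalemxAr. Qed.

HB.instance Definition _ (K : fieldType) (m : nat) (n : 'I_m -> nat) :=
  Lmodule_isNUAlgebra.Build K (matrix_sum K n)
    (@msum_mulA K m n) (@msum_mulDl K m n) (@msum_mulDr K m n)
    (@msum_mulZl K m n) (@msum_mulZr K m n).

Definition matricial (K : fieldType) (A : nuAlgType K) : Prop :=
  exists (m : nat) (n : 'I_m -> nat), nualg_isomorphic A (matrix_sum K n).

Definition directed_set (I : Type) (le : I -> I -> Prop) : Prop :=
  [/\ inhabited I,
      forall i, le i i,
      forall i j k, le i j -> le j k -> le i k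
    & forall i j, exists k, le i k /\ le j k].

(* The composition law, taken for arbitrary proofs of the inequalities, also
   shows that phi does not depend on these proofs. *)
Definition direct_system (K : fieldType) (I : Type) (le : I -> I -> Prop)
    (A : I -> nuAlgType K) (phi : forall i j, le i j -> A i -> A j) : Prop :=
  [/\ directed_set le,
      forall i j (ij : le i j), nualg_hom (phi i j ij),
      forall i (ii : le i i) (x : A i), phi i i ii x = x
    & forall i j k (ij : le i j) (jk : le j k) (ik : le i k) (x : A i),
        phi j k jk (phi i j ij x) = phi i k ik x].

Definition cocone (K : fieldType) (I : Type) (le : I -> I -> Prop)
    (A : I -> nuAlgType K) (phi : forall i j, le i j -> A i -> A j)
    (B : nuAlgType K) (psi : forall i, A i -> B) : Prop :=
  (forall i, nualg_hom (psi i)) /\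
  (forall i j (ij : le i j) (x : A i), psi j (phi i j ij x) = psi i x).

Definition is_direct_limit (K : fieldType) (I : Type) (le : I -> I -> Prop)
    (A : I -> nuAlgType K) (phi : forall i j, le i j -> A i -> A j)
    (L : nuAlgType K) (psi : forall i, A i -> L) : Prop :=
  cocone phi psi /\
  forall (B : nuAlgType K) (chi : forall i, A i -> B), cocone phi chi ->
    exists! f : L -> B, nualg_hom f /\ forall i (x : A i), f (psi i x) = chi i x.

Definition locally_matricial (K : fieldType) (L : nuAlgType K) : Prop :=
  exists (I : Type) (le : I -> I -> Prop) (A : I -> nuAlgType K)
         (phi : forall i j, le i j -> A i -> A j) (psi : forall i, A i -> L),
    [/\ direct_system phi, forall i, matricial (A i) & is_direct_limit phi psi].

(* Classically every type carries a choiceType structure, so that these carriers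
   are arbitrary sets. *)
Record graph := Graph {
  vertex : choiceType;
  edge : choiceType;
  src : edge -> vertex;
  tgt : edge -> vertex
}.

Record wgraph := WGraph {
  wgraph_graph :> graph;
  weight : edge wgraph_graph -> nat;
  weight_gt0 : forall e, (0 < weight e)%N
}.

Definition out_edges (E : graph) (v : vertex E) : set (edge E) :=
  [set e | src e = v].

Definition row_finite (E : graph) : Prop :=
  forall v : vertex E, finite_set (out_edges v).

Definition graph_connected (E : graph) : Prop :=
  forall u v : vertex E,
    clos_refl_sym_trans (vertex E)
      (fun a b => exists e : edge E, src e = a /\ tgt e = b) u v.

Definition sink (E : graph) (v : vertex E) : Prop := out_edges v = set0.

Definition regular_vertex (E : graph) (v : vertex E) : Prop := ~ sink v.

Record npath (E : graph) := NPath {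
  first_edge : edge E;
  next_edges : seq (edge E);
  npathP : path (fun e f => tgt e == src f) first_edge next_edges
}.

Definition last_edge (E : graph) (p : npath E) : edge E :=
  last (first_edge p) (next_edges p).

Definition letters (E : graph) (p : npath E) : seq (edge E) :=
  first_edge p :: next_edges p.

Definition psrc (E : graph) (p : npath E) : vertex E := src (first_edge p).

Definition ptgt (E : graph) (p : npath E) : vertex E := tgt (last_edge p).

Definition is_cycle (E : graph) (p : npath E) : Prop :=
  ptgt p = psrc p /\ uniq [seq src e | e <- letters p].

(* The first alternative is the trivial path. *)
Definition reaches (E : graph) (u v : vertex E) : Prop :=
  u = v \/ exists p : npath E, psrc p = u /\ ptgt p = v.

Definition vtree (E : graph) (u : vertex E) : set (vertex E) :=
  [set v | reaches u v].

Definition tree (E : graph) (X : set (vertex E)) : set (vertex E) :=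
  \bigcup_(u in X) vtree u.

Definition in_line (E : graph) (e f : edge E) : Prop :=
  [\/ e = f, reaches (tgt e) (src f) | reaches (tgt f) (src e)].

Definition unweighted_edge (E : wgraph) (e : edge E) : Prop := weight e = 1%N.

Definition weighted_edge (E : wgraph) (e : edge E) : Prop := (1 < weight e)%N.

Definition weighted_targets (E : wgraph) : set (vertex E) :=
  [set tgt e | e in [set e : edge E | weighted_edge e]].

Definition acyclic (E : graph) : Prop := forall p : npath E, ~ is_cycle p.

Definition LPA1 (E : wgraph) : Prop :=
  forall e f : edge E,
    weighted_edge e -> weighted_edge f -> src e = src f -> e = f.

Definition LPA2 (E : wgraph) : Prop :=
  forall v : vertex E, tree (@weighted_targets E) v ->
    forall e f : edge E, src e = v -> src f = v -> e = f.

Definition LPA3 (E : wgraph) : Prop :=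
  forall e f : edge E, weighted_edge e -> weighted_edge f -> ~ in_line e f ->
    vtree (tgt e) `&` vtree (tgt f) = set0.

Definition W1 (E : wgraph) : Prop :=
  forall v : vertex E, tree (@weighted_targets E) v ->
    ~ exists p : npath E, is_cycle p /\ psrc p = v.

(* The n >= 1 paths are indexed by 'I_n with n = m.+1. *)
Definition W2 (E : wgraph) : Prop :=
  ~ exists (m : nat) (p q : 'I_m.+1 -> npath E),
      [/\ forall i, ptgt (p i) = ptgt (q i),
          psrc (p ord0) = psrc (q ord_max),
          forall i j : 'I_m.+1, j = i.+1 :> nat -> psrc (p j) = psrc (q i)
        & forall i, [/\ weighted_edge (first_edge (p i)),
                        unweighted_edge (first_edge (q i))
                      & last_edge (p i) <> last_edge (q i)]].

Definition well_behaved (E : wgraph) : Prop :=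
  [/\ LPA1 E, LPA2 E, LPA3 E, W1 E & W2 E].

(* Indices are shifted by one: gen_edge e i stands for e_(i+1). *)
Inductive lpa_gen (E : wgraph) : Type :=
| gen_vertex of vertex E
| gen_edge (e : edge E) of 'I_(weight e)
| gen_ghost (e : edge E) of 'I_(weight e).

(* Formal expressions over the generators; the presented algebra is their
   quotient by the least congruence containing the axioms of
   (not necessarily unital) K-algebras and the defining relations. *)
Inductive lpa_term (K : fieldType) (E : wgraph) : Type :=
| TGen of lpa_gen E
| TZero
| TOpp of lpa_term K E
| TAdd of lpa_term K E & lpa_term K E
| TScale of K & lpa_term K E
| TMul of lpa_term K E & lpa_term K E.

Arguments TZero {K E}.

HB.instance Definition _ (K : fieldType) (E : wgraph) :=
  gen_eqMixin (lpa_term K E).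
HB.instance Definition _ (K : fieldType) (E : wgraph) :=
  gen_choiceMixin (lpa_term K E).

Definition tvertex (K : fieldType) (E : wgraph) (v : vertex E) : lpa_term K E :=
  TGen K (gen_vertex v).

(* e_(i+1) and its ghost, for any i : nat, with value 0 beyond the weight of e. *)
Definition tedge (K : fieldType) (E : wgraph) (e : edge E) (i : nat) :
    lpa_term K E :=
  if insub i is Some j then TGen K (@gen_edge E e j) else TZero.

Definition tghost (K : fieldType) (E : wgraph) (e : edge E) (i : nat) :
    lpa_term K E :=
  if insub i is Some j then TGen K (@gen_ghost E e j) else TZero.

(* For row-finite graphs, an enumeration of the edges emitted by v. *)
Definition out_seq (E : graph) (v : vertex E) : seq (edge E) :=
  fset_set (out_edges v).

Definition vweight (E : wgraph) (v : vertex E) : nat :=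
  (\max_(e <- out_seq v) weight e)%N.

Inductive lpa_cong (K : fieldType) (E : wgraph) :
    lpa_term K E -> lpa_term K E -> Prop :=
| lc_refl x : lpa_cong x x
| lc_sym x y : lpa_cong x y -> lpa_cong y x
| lc_trans x y z : lpa_cong x y -> lpa_cong y z -> lpa_cong x z
| lc_opp x x' : lpa_cong x x' -> lpa_cong (TOpp x) (TOpp x')
| lc_add x x' y y' : lpa_cong x x' -> lpa_cong y y' ->
    lpa_cong (TAdd x y) (TAdd x' y')
| lc_scale a x x' : lpa_cong x x' -> lpa_cong (TScale a x) (TScale a x')
| lc_mul x x' y y' : lpa_cong x x' -> lpa_cong y y' ->
    lpa_cong (TMul x y) (TMul x' y')
| lc_addA x y z : lpa_cong (TAdd x (TAdd y z)) (TAdd (TAdd x y) z)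
| lc_addC x y : lpa_cong (TAdd x y) (TAdd y x)
| lc_add0 x : lpa_cong (TAdd TZero x) x
| lc_addN x : lpa_cong (TAdd (TOpp x) x) TZero
| lc_scaleA a b x : lpa_cong (TScale a (TScale b x)) (TScale (a * b) x)
| lc_scale1 x : lpa_cong (TScale 1 x) x
| lc_scaleDr a x y :
    lpa_cong (TScale a (TAdd x y)) (TAdd (TScale a x) (TScale a y))
| lc_scaleDl a b x :
    lpa_cong (TScale (a + b) x) (TAdd (TScale a x) (TScale b x))
| lc_mulA x y z : lpa_cong (TMul x (TMul y z)) (TMul (TMul x y) z)
| lc_mulDl x y z :
    lpa_cong (TMul (TAdd x y) z) (TAdd (TMul x z) (TMul y z))
| lc_mulDr x y z :
    lpa_cong (TMul x (TAdd y z)) (TAdd (TMul x y) (TMul x z))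
| lc_mulZl a x y : lpa_cong (TMul (TScale a x) y) (TScale a (TMul x y))
| lc_mulZr a x y : lpa_cong (TMul x (TScale a y)) (TScale a (TMul x y))
| lc_vertex (u v : vertex E) :
    lpa_cong (TMul (tvertex K u) (tvertex K v))
             (if u == v then tvertex K u else TZero)
| lc_src_edge (e : edge E) i : (i < weight e)%N ->
    lpa_cong (TMul (tvertex K (src e)) (tedge K e i)) (tedge K e i)
| lc_edge_tgt (e : edge E) i : (i < weight e)%N ->
    lpa_cong (TMul (tedge K e i) (tvertex K (tgt e))) (tedge K e i)
| lc_tgt_ghost (e : edge E) i : (i < weight e)%N ->
    lpa_cong (TMul (tvertex K (tgt e)) (tghost K e i)) (tghost K e i)
| lc_ghost_src (e : edge E) i : (i < weight e)%N ->
    lpa_cong (TMul (tghost K e i) (tvertex K (src e))) (tghost K e i)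
| lc_edge_ghost (v : vertex E) i j : regular_vertex v ->
    (i < vweight v)%N -> (j < vweight v)%N ->
    lpa_cong (\big[@TAdd K E/TZero]_(e <- out_seq v)
                TMul (tedge K e i) (tghost K e j))
             (if i == j then tvertex K v else TZero)
| lc_ghost_edge (v : vertex E) (e f : edge E) : regular_vertex v ->
    src e = v -> src f = v ->
    lpa_cong (\big[@TAdd K E/TZero]_(0 <= i < vweight v)
                TMul (tghost K e i) (tedge K f i))
             (if e == f then tvertex K (tgt e) else TZero).

Definition lpa_congb (K : fieldType) (E : wgraph) : rel (lpa_term K E) :=
  fun x y => `[< lpa_cong x y >].

Lemma lpa_congb_refl (K : fieldType) (E : wgraph) : reflexive (@lpa_congb K E).
Proof. by move=> x; apply/asboolP; exact: lc_refl. Qed.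

Lemma lpa_congb_sym (K : fieldType) (E : wgraph) : symmetric (@lpa_congb K E).
Proof. by move=> x y; apply/asboolP/asboolP; exact: lc_sym. Qed.

Lemma lpa_congb_trans (K : fieldType) (E : wgraph) : transitive (@lpa_congb K E).
Proof.
by move=> y x z /asboolP xy /asboolP yz; apply/asboolP; exact: lc_trans xy yz.
Qed.

Canonical lpa_equiv (K : fieldType) (E : wgraph) :=
  EquivRel (@lpa_congb K E) (@lpa_congb_refl K E) (@lpa_congb_sym K E)
    (@lpa_congb_trans K E).

Definition wLPA (K : fieldType) (E : wgraph) : Type :=
  {eq_quot (lpa_equiv K E)}%qT.

HB.instance Definition _ (K : fieldType) (E : wgraph) :=
  Choice.on (wLPA K E).

Definition lpa_class (K : fieldType) (E : wgraph) (x : lpa_term K E) :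
  wLPA K E := (\pi_{eq_quot (lpa_equiv K E)} x)%qT.

Definition lpa_repr (K : fieldType) (E : wgraph) (x : wLPA K E) :
  lpa_term K E := repr (x : {eq_quot (lpa_equiv K E)}%qT).

Lemma lpa_classP (K : fieldType) (E : wgraph) (x y : lpa_term K E) :
  lpa_class x = lpa_class y <-> lpa_cong x y.
Proof. by split=> [/eqmodP/asboolP|h] //; apply/eqmodP/asboolP. Qed.

Lemma lpa_reprK (K : fieldType) (E : wgraph) (x : wLPA K E) :
  lpa_class (lpa_repr x) = x.
Proof. exact: reprK. Qed.

Lemma lpa_repr_cong (K : fieldType) (E : wgraph) (x : lpa_term K E) :
  lpa_cong (lpa_repr (lpa_class x)) x.
Proof. by apply/lpa_classP; exact: lpa_reprK. Qed.

Definition lpa_zero (K : fieldType) (E : wgraph) : wLPA K E := lpa_class TZero.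

Definition lpa_opp (K : fieldType) (E : wgraph) (x : wLPA K E) : wLPA K E :=
  lpa_class (TOpp (lpa_repr x)).

Definition lpa_add (K : fieldType) (E : wgraph) (x y : wLPA K E) : wLPA K E :=
  lpa_class (TAdd (lpa_repr x) (lpa_repr y)).

Definition lpa_scale (K : fieldType) (E : wgraph) (a : K) (x : wLPA K E) :
  wLPA K E := lpa_class (TScale a (lpa_repr x)).

Definition lpa_mul (K : fieldType) (E : wgraph) (x y : wLPA K E) : wLPA K E :=
  lpa_class (TMul (lpa_repr x) (lpa_repr y)).

Lemma lpa_classN (K : fieldType) (E : wgraph) (x : lpa_term K E) :
  lpa_opp (lpa_class x) = lpa_class (TOpp x).
Proof. by apply/lpa_classP; apply: lc_opp; exact: lpa_repr_cong. Qed.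

Lemma lpa_classD (K : fieldType) (E : wgraph) (x y : lpa_term K E) :
  lpa_add (lpa_class x) (lpa_class y) = lpa_class (TAdd x y).
Proof. by apply/lpa_classP; apply: lc_add; exact: lpa_repr_cong. Qed.

Lemma lpa_classZ (K : fieldType) (E : wgraph) (a : K) (x : lpa_term K E) :
  lpa_scale a (lpa_class x) = lpa_class (TScale a x).
Proof. by apply/lpa_classP; apply: lc_scale; exact: lpa_repr_cong. Qed.

Lemma lpa_classM (K : fieldType) (E : wgraph) (x y : lpa_term K E) :
  lpa_mul (lpa_class x) (lpa_class y) = lpa_class (TMul x y).
Proof. by apply/lpa_classP; apply: lc_mul; exact: lpa_repr_cong. Qed.

Definition lpa_classE (K : fieldType) (E : wgraph) :=
  (@lpa_classN K E, @lpa_classD K E, @lpa_classZ K E, @lpa_classM K E).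

Lemma lpa_addA (K : fieldType) (E : wgraph) : associative (@lpa_add K E).
Proof.
move=> x y z; rewrite -(lpa_reprK x) -(lpa_reprK y) -(lpa_reprK z) !lpa_classE.
by apply/lpa_classP; exact: lc_addA.
Qed.

Lemma lpa_addC (K : fieldType) (E : wgraph) : commutative (@lpa_add K E).
Proof.
move=> x y; rewrite -(lpa_reprK x) -(lpa_reprK y) !lpa_classE.
by apply/lpa_classP; exact: lc_addC.
Qed.

Lemma lpa_add0 (K : fieldType) (E : wgraph) :
  left_id (lpa_zero K E) (@lpa_add K E).
Proof.
move=> x; rewrite -(lpa_reprK x) /lpa_zero !lpa_classE.
by apply/lpa_classP; exact: lc_add0.
Qed.

Lemma lpa_addN (K : fieldType) (E : wgraph) :
  left_inverse (lpa_zero K E) (@lpa_opp K E) (@lpa_add K E).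
Proof.
move=> x; rewrite -(lpa_reprK x) !lpa_classE.
by apply/lpa_classP; exact: lc_addN.
Qed.

HB.instance Definition _ (K : fieldType) (E : wgraph) :=
  GRing.isZmodule.Build (wLPA K E)
    (@lpa_addA K E) (@lpa_addC K E) (@lpa_add0 K E) (@lpa_addN K E).

Lemma lpa_scaleA (K : fieldType) (E : wgraph) (a b : K) (x : wLPA K E) :
  lpa_scale a (lpa_scale b x) = lpa_scale (a * b) x.
Proof.
rewrite -(lpa_reprK x) !lpa_classE.
by apply/lpa_classP; exact: lc_scaleA.
Qed.

Lemma lpa_scale1 (K : fieldType) (E : wgraph) : left_id 1 (@lpa_scale K E).
Proof.
move=> x; rewrite -(lpa_reprK x) !lpa_classE.
by apply/lpa_classP; exact: lc_scale1.
Qed.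

Lemma lpa_scaleDr (K : fieldType) (E : wgraph) :
  right_distributive (@lpa_scale K E) +%R.
Proof.
move=> a x y; rewrite /GRing.add /= -(lpa_reprK x) -(lpa_reprK y) !lpa_classE.
by apply/lpa_classP; exact: lc_scaleDr.
Qed.

Lemma lpa_scaleDl (K : fieldType) (E : wgraph) (x : wLPA K E) :
  {morph (@lpa_scale K E)^~ x : a b / a + b}.
Proof.
move=> a b; rewrite [in RHS]/GRing.add /= -(lpa_reprK x) !lpa_classE.
by apply/lpa_classP; exact: lc_scaleDl.
Qed.

HB.instance Definition _ (K : fieldType) (E : wgraph) :=
  GRing.Zmodule_isLmodule.Build K (wLPA K E)
    (@lpa_scaleA K E) (@lpa_scale1 K E) (@lpa_scaleDr K E) (@lpa_scaleDl K E).

Lemma lpa_mulA (K : fieldType) (E : wgraph) : associative (@lpa_mul K E).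
Proof.
move=> x y z; rewrite -(lpa_reprK x) -(lpa_reprK y) -(lpa_reprK z) !lpa_classE.
by apply/lpa_classP; exact: lc_mulA.
Qed.

Lemma lpa_mulDl (K : fieldType) (E : wgraph) :
  left_distributive (@lpa_mul K E) +%R.
Proof.
move=> x y z; rewrite /GRing.add /= -(lpa_reprK x) -(lpa_reprK y) -(lpa_reprK z).
by rewrite !lpa_classE; apply/lpa_classP; exact: lc_mulDl.
Qed.

Lemma lpa_mulDr (K : fieldType) (E : wgraph) :
  right_distributive (@lpa_mul K E) +%R.
Proof.
move=> x y z; rewrite /GRing.add /= -(lpa_reprK x) -(lpa_reprK y) -(lpa_reprK z).
by rewrite !lpa_classE; apply/lpa_classP; exact: lc_mulDr.
Qed.

Lemma lpa_mulZl (K : fieldType) (E : wgraph) (a : K) (x y : wLPA K E) :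
  lpa_mul (a *: x) y = a *: lpa_mul x y.
Proof.
rewrite /GRing.scale /= -(lpa_reprK x) -(lpa_reprK y) !lpa_classE.
by apply/lpa_classP; exact: lc_mulZl.
Qed.

Lemma lpa_mulZr (K : fieldType) (E : wgraph) (a : K) (x y : wLPA K E) :
  lpa_mul x (a *: y) = a *: lpa_mul x y.
Proof.
rewrite /GRing.scale /= -(lpa_reprK x) -(lpa_reprK y) !lpa_classE.
by apply/lpa_classP; exact: lc_mulZr.
Qed.

HB.instance Definition _ (K : fieldType) (E : wgraph) :=
  Lmodule_isNUAlgebra.Build K (wLPA K E)
    (@lpa_mulA K E) (@lpa_mulDl K E) (@lpa_mulDr K E)
    (@lpa_mulZl K E) (@lpa_mulZr K E).

(* Main.v *)
Require Import Defs.
From HB Require Import structures.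
From Stdlib Require Import Relation_Operators Operators_Properties.
From mathcomp Require Import all_boot all_algebra finmap.
From mathcomp Require Import boolp classical_sets functions cardinality.

(* (ii) => (iii).  Let T be the set of vertices reachable from the range of a
   weighted edge.  Each t in T is the range of a unique edge g that is weighted
   or starts in T, and sum_i g_i^* g_i = t decomposes t backwards along g; a
   vertex outside T is decomposed forwards by sum_e e_1 e_1^* = v.  Condition
   (W2) and acyclicity say exactly that iterating these decompositions never
   loops.  Hence finitely many decompositions produce partial isometries s, t
   with orthogonal ranges, and the products s t^* are matrix units whose span
   contains any prescribed finite set of generators.

   (i) => (ii).  Bijections between countable bases, one for each regular
   vertex, give modules on which all generators act by partial injections of a
   basis; any finite partial injection extends to such a bijection.  Deform one
   of them by an elementary automorphism over the dual numbers K[eps].  If x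
   maps some vector f into the multiples of eps, and every value of a functional
   phi on the image of x is a multiple of eps, then phi (x y x f) is a multiple
   of eps^2 = 0, so that x = x y x forces phi (x f) = 0.  For a cycle, or when
   (LPA3) or (W2) fails, some closed word p fixes a basis vector, the deformation
   rescales it by 1 + eps, and x = v - p is not regular.  When (LPA1) or (LPA2)
   fails at two edges g, h with the same source, x = h_i^* z g_i for a suitable
   idempotent z is zero before the deformation, but not after it. *)

Set Implicit Arguments.
Unset Strict Implicit.
Unset Printing Implicit Defensive.

Import GRing.Theory.

(** The step (iii) => (i): every element of a direct limit comes from a matricial stage, where
    matrices have generalized inverses. In (ii) => (iii) the obstacle is the first component of a
    weighted edge e whose source v lies outside T. For i > 1, (LPA1) gives e_i e_i^* = v, but e_1
    e_1^* is only one summand of v, beside those of the unweighted edges. It becomes a node of its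
    own that is never decomposed; it is a part both of v, decomposed forwards, and of r(e),
    decomposed backwards. Products of strands give all the generators only if nodes with a common
    part decompose that part in the same way, so one coherent choice is made for finitely many
    nodes. In (i) => (ii) the bases are infinite so that the bijections exist whatever the weights
    and out-degrees. Before the deformation x = v - p merely kills f, which detects nothing; the
    deformation makes x f a nonzero multiple of eps. The functional phi is what supplies the second
    factor eps: the condition on f alone makes x y x f a multiple of eps only, which is no
    contradiction. *)

Lemma clos_t_rt (V : Type) (R : V -> V -> Prop) x y z :
  clos_trans V R x y -> clos_refl_trans V R y z -> clos_trans V R x z.
Proof.
move=> xy yz; elim: {z yz}(clos_rt_rtn1 _ _ _ _ yz) => [//|z w zw _ xz].
exact: t_trans xz (t_step _ _ _ _ zw).
Qed.

(** * Walks in graphs *)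

Section Walks.
Variable E : graph.
Implicit Types (u v w : vertex E) (e f : edge E) (s t : seq (edge E)).

(** Unlike [npath], this includes the trivial path and carries both ends, so that walks concatenate
    without side conditions. *)
Fixpoint walk u s v : Prop :=
  if s is e :: s' then src e = u /\ walk (tgt e) s' v else u = v.

Lemma walk_cat u s v t w : walk u s v -> walk v t w -> walk u (s ++ t) w.
Proof.
by elim: s u => [u -> //|e s IH u /= [-> sv] tw]; split=> //; exact: IH.
Qed.

Lemma walk_catP u s t w : walk u (s ++ t) w -> exists v, walk u s v /\ walk v t w.
Proof.
elim: s u => [u tw|e s IH u /= [<- /IH[v [sv tw]]]]; first by exists u.
by exists v.
Qed.

Lemma walk_rcons u s e : walk u s (src e) -> walk u (rcons s e) (tgt e).
Proof. by move=> us; rewrite -cats1; exact: walk_cat us _. Qed.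

Lemma walk_path u e s v : walk u (e :: s) v <->
  [/\ src e = u, path (fun e f => tgt e == src f) e s & tgt (last e s) = v].
Proof.
elim: s e u => [|f s IH] e u /=; first by split=> [[]|[]].
split=> [[eu fs]|[eu /andP[/eqP ef fs] lv]].
  by have [<- -> ->] := (IH _ _).1 fs; rewrite eqxx.
by split=> //; apply/IH; rewrite ef.
Qed.

Lemma npath_walk (p : npath E) : walk (psrc p) (letters p) (ptgt p).
Proof. by apply/walk_path; split=> //; exact: npathP. Qed.

Lemma walk_npath u e s v : walk u (e :: s) v ->
  exists p : npath E,
    [/\ first_edge p = e, next_edges p = s, psrc p = u & ptgt p = v].
Proof. by move=> /walk_path[? es ?]; exists (NPath es). Qed.

Lemma reachesP u v : reaches u v <-> exists s, walk u s v.
Proof.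
split=> [[->|[p [<- <-]]]|[[|e s]]]; [by exists [::]| |by left|].
  by exists (letters p); exact: npath_walk.
by move=> /walk_npath[p [_ _ ? ?]]; right; exists p.
Qed.

(** A cycle visits no source twice. A closed walk that repeats a source contains a shorter closed
    walk, the segment between two edges with that source, so induction on the length applies. *)
Lemma acyclic_walk u s : acyclic E -> walk u s u -> s = [::].
Proof.
move=> Eac; have [n] := ubnP (size s); elim: n s u => [//|n IH] s u.
case: s => [//|e s] /=; rewrite ltnS => sn ues.
have [us|nus] := boolP (uniq [seq src f | f <- e :: s]).
  have /walk_npath[p [pe ps pu pu']] := ues.
  by case: (Eac p); split; rewrite ?pu ?pu' // /letters pe ps.
have [s1 [f [s2 [g [s3 [E1 fg]]]]]] : exists s1 f s2 g s3,
    e :: s = s1 ++ f :: s2 ++ g :: s3 /\ src f = src g.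
  elim: (e :: s) nus => [//|a l IHl] /=; rewrite negb_and => /orP[|/IHl].
    rewrite negbK => /mapP[g /splitPr[l1 l2] ag].
    by exists [::], a, l1, g, l2.
  by move=> [s1 [f [s2 [g [s3 [-> fg]]]]]]; exists (a :: s1), f, s2, g, s3.
have {}ues : walk u (s1 ++ f :: s2 ++ g :: s3) u by rewrite -E1.
have [v [_ /=[fv]]] := walk_catP ues.
move=> /walk_catP[w [fw /=[gw _]]].
have closed : walk w (f :: s2) w by split; rewrite // fg gw.
have : f :: s2 = [::]; last by [].
apply: (IH _ w) => //=; apply: leq_trans sn.
have : size (e :: s) = size (s1 ++ f :: s2 ++ g :: s3) by rewrite E1.
rewrite /= size_cat /= size_cat /= => -[->].
by rewrite !addnS !ltnS addnCA leq_addr.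
Qed.

End Walks.

(** * Edges followed backwards, and why the decompositions terminate *)

Section WellBehaved.
Variable E : wgraph.
Implicit Types (u v w x y : vertex E) (e f g : edge E) (s t : seq (edge E)).

Local Notation T := (tree (@weighted_targets E)).

Lemma weightedPn e : ~ weighted_edge e -> unweighted_edge e.
Proof.
rewrite /weighted_edge /unweighted_edge => we; apply/eqP.
by rewrite eqn_leq weight_gt0 andbT leqNgt; apply/negP.
Qed.

Lemma unweighted_not_weighted e : unweighted_edge e -> ~ weighted_edge e.
Proof. by rewrite /weighted_edge => ->. Qed.

Lemma treeP v : T v <-> exists f s, weighted_edge f /\ walk (tgt f) s v.
Proof.
split=> [[_ [f wf <-] /reachesP[s fs]]|[f [s [wf fs]]]]; first by exists f, s.
by exists (tgt f); [exists f|apply/reachesP; exists s].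
Qed.

Lemma tree_tgt e : T (src e) -> T (tgt e).
Proof.
move=> /treeP[f [s [wf fs]]]; apply/treeP; exists f, (rcons s e).
by split=> //; exact: walk_rcons.
Qed.

Lemma weighted_tgt e : weighted_edge e -> T (tgt e).
Proof. by move=> we; apply/treeP; exists e, [::]. Qed.

(** In other words, the last letters of walks whose first edge is weighted. *)
Definition rev_edge e : Prop := weighted_edge e \/ T (src e).

Lemma rev_tgt e : rev_edge e -> T (tgt e).
Proof. by case; [exact: weighted_tgt|exact: tree_tgt]. Qed.

Lemma tree_rev v : T v -> exists2 g, rev_edge g & tgt g = v.
Proof.
move=> /treeP[f [s [wf]]]; case/lastP: s => [|s e] /=.
  by move=> <-; exists f => //; left.
rewrite -cats1 => /walk_catP[w [fw /=[ew ev]]]; exists e => //.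
by right; apply/treeP; exists f, s; rewrite ew.
Qed.

Lemma rev_edge_walk e : rev_edge e -> exists f s,
  [/\ weighted_edge f, last f s = e & walk (tgt f) s (tgt e)].
Proof.
move=> [we|/treeP[f [s [wf fs]]]]; first by exists e, [::].
by exists f, (rcons s e); rewrite last_rcons; split=> //; exact: walk_rcons.
Qed.

Hypothesis Eac : acyclic E.

(** Inside T there is no choice of the next edge, so one walk is a prefix of the other, and
    acyclicity rules out a proper prefix. *)
Lemma walk_det u v s t : LPA2 E -> T u -> walk u s v -> walk u t v -> s = t.
Proof.
move=> L2; elim: s t u => [|e s IH] [|f t] u Tu //=.
- by move=> <- fu; have := acyclic_walk Eac (s := f :: t) fu.
- by move=> eu uv; have := acyclic_walk Eac (s := e :: s) (u := u); rewrite uv in eu *;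
    move=> /(_ eu).
move=> [eu es] [fu ft]; have ef : e = f by apply: (L2 u).
by rewrite ef (IH t (tgt e)) // ?ef //; apply: tree_tgt; rewrite ?fu.
Qed.

(** Both edges end walks that start with weighted edges a and b and meet at the common target, so
    (LPA3) puts a and b in line. If a comes first, the walk of b extends to one from [tgt a], which
    by [walk_det] is the walk of a itself. *)
Lemma rev_edge_inj e f : LPA2 E -> LPA3 E ->
  rev_edge e -> rev_edge f -> tgt e = tgt f -> e = f.
Proof.
move=> L2 L3 /rev_edge_walk[a [s [wa <- as_]]] /rev_edge_walk[b [t [wb <- bt]]].
move=> abt; set v := tgt (last a s) in abt *.
have key (c : edge E) r d q : weighted_edge c -> walk (tgt c) r (tgt (last c r)) ->
    walk (tgt d) q (tgt (last d q)) ->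
    tgt (last c r) = tgt (last d q) -> reaches (tgt c) (src d) ->
    last c r = last d q.
  move=> wc cr dq crdq /reachesP[z cd].
  have cd' : walk (tgt c) (z ++ d :: q) (tgt (last d q)).
    by apply: walk_cat cd _.
  rewrite -crdq in cd'; rewrite (walk_det L2 (weighted_tgt wc) cr cd').
  by rewrite last_cat.
have [ab|nab] := pselect (in_line a b); last first.
  have : set0 v by rewrite -(L3 _ _ wa wb nab); split; apply/reachesP;
    [exists s|exists t; rewrite abt].
  by [].
case: ab => [ab|ab|ba].
- move: bt; rewrite -abt -ab => as'.
  by rewrite (walk_det L2 (weighted_tgt wa) as_ as').
- exact: key.
- by apply/esym/key => //; rewrite -abt.
Qed.

(* [w2_step v u] is one link of the chains excluded by (W2). *)
Definition w2_step v u : Prop := exists f p e q (z : vertex E),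
  [/\ walk v (f :: p) z, walk u (e :: q) z, weighted_edge f,
      unweighted_edge e & last f p <> last e q].

Lemma clos_trans_chain (V : Type) (R : V -> V -> Prop) (x y : V) :
  clos_trans V R x y -> exists m (a : nat -> V),
    [/\ a 0 = x, a m.+1 = y & forall i, i <= m -> R (a i) (a i.+1)].
Proof.
move=> xy; elim: {x y xy}(clos_trans_t1n _ _ _ _ xy) => [x y xy|x y z xy _].
  exists 0, (fun i => if i is 0 then x else y).
  by split=> // i; rewrite leqn0 => /eqP ->.
move=> [m [a [a0 am aR]]].
exists m.+1, (fun i => if i is j.+1 then a j else x); split=> //.
by move=> [_|i im]; [rewrite a0|exact: aR].
Qed.

Lemma W2_acyclic x : W2 E -> ~ clos_trans _ w2_step x x.
Proof.
move=> W xx; have [m [a [a0 am aD]]] := clos_trans_chain xx; apply: W; exists m.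
have paths i : exists p : npath E * npath E, i <= m ->
    [/\ psrc p.1 = a i, psrc p.2 = a i.+1, ptgt p.1 = ptgt p.2,
        weighted_edge (first_edge p.1) /\ unweighted_edge (first_edge p.2)
      & last_edge p.1 <> last_edge p.2].
  case: (leqP i m) => [/aD[f [p [e [q [t [+ + wf ue ne]]]]]]|_].
    move=> /walk_npath[p' [pf pn p1 p2]] /walk_npath[q' [qf qn q1 q2]].
    exists (p', q') => /= _; rewrite p1 p2 q1 q2 pf qf.
    by rewrite /last_edge pf pn qf qn.
  (* Beyond m a dummy pair makes the family total, so that [cid] can be applied to every index. *)
  have [f [p [e [q [z [+ _ _ _ _]]]]]] := aD 0 (leq0n _).
  by move=> /walk_npath[p' _]; exists (p', p').
have {}paths i := cid (paths i).
exists (fun i => (sval (paths i)).1), (fun i => (sval (paths i)).2); split.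
- by move=> i; have [] := svalP (paths i) (leq_ord i).
- have [-> _ _ _ _] := svalP (paths (@ord0 m)) (leq0n _).
  by have [_ -> _ _ _] := svalP (paths (@ord_max m)) (leqnn _); rewrite a0 am.
- move=> i j ij; have [_ -> _ _ _] := svalP (paths i) (leq_ord i).
  by have [-> _ _ _ _] := svalP (paths j) (leq_ord j); rewrite ij.
- by move=> i; have [_ _ _ [? ?] ?] := svalP (paths i) (leq_ord i).
Qed.

(** One decomposition step between vertices. A weighted edge leaving x outside T contributes an
    undecomposed part of x and no vertex, hence only unweighted edges are followed forwards. *)
Definition flow_step x y : Prop :=
  (~ T x /\ exists e, [/\ unweighted_edge e, src e = x & tgt e = y]) \/
  (exists g, [/\ rev_edge g, tgt g = x & src g = y]).

(* A flow walk starting outside T alternates unweighted walks q entering T with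
   walks p followed backwards out of T, that is, it is a chain of [w2_step]. *)
Definition flow_invariant u y : Prop := exists v, 
  [\/ [/\ ~ T y, v = y & clos_trans _ w2_step v u],
      [/\ ~ T y, clos_refl_trans _ w2_step v u & exists e q,
        [/\ walk v (e :: q) y, unweighted_edge e & ~ rev_edge (last e q)]]
    | [/\ T y, clos_refl_trans _ w2_step v u & exists e q p (z : vertex E),
        [/\ walk v (e :: q) z, unweighted_edge e, ~ rev_edge (last e q),
            walk y p z & p = [::] \/ forall g, rev_edge (last g p)]]].

Lemma rev_tgtN x g : ~ T x -> rev_edge g -> tgt g <> x.
Proof. by move=> Tx /rev_tgt Tg gx; apply: Tx; rewrite -gx. Qed.

Lemma flow_walk u y : ~ T u -> clos_trans _ flow_step u y -> flow_invariant u y.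
Proof.
move=> Tu uy; elim: {y uy}(clos_trans_tn1 _ _ _ _ uy) => [y|y z].
  move=> [[_ [e [ue eu <-]]]|[g [rg gu _]]]; last by case: (rev_tgtN Tu rg gu).
  have re : ~ rev_edge e.
    by move=> [/(unweighted_not_weighted ue)//|]; rewrite eu.
  exists u; have [Te|Te] := pselect (T (tgt e)).
    constructor 3; split=> //; first exact: rt_refl.
    by exists e, [::], [::], (tgt e); split=> //; left.
  by constructor 2; split=> //; [exact: rt_refl|exists e, [::]].
have extend e v q : unweighted_edge e -> ~ T (src e) ->
    clos_refl_trans _ w2_step v u -> walk v q (src e) ->
    (forall f, unweighted_edge (head f (rcons q e))) ->
    flow_invariant u (tgt e).
  move=> ue Te vu vq qu; have re : ~ rev_edge e.
    by move=> [/(unweighted_not_weighted ue)|].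
  exists v.
  have [f [q' [qE uf lf]]] : exists f q', [/\ rcons q e = f :: q',
      unweighted_edge f & last f q' = e].
    case: q qu {vq} => [|f q] /= qu; first by exists e, [::].
    by exists f, (rcons q e); split=> //; [exact: (qu f)|rewrite last_rcons].
  have vf : walk v (f :: q') (tgt e) by rewrite -qE; exact: walk_rcons.
  have [Tt|Tt] := pselect (T (tgt e)).
    constructor 3; split=> //; exists f, q', [::], (tgt e).
    by split=> //; [rewrite lf|left].
  by constructor 2; split=> //; exists f, q'; rewrite lf.
move=> yz _ [v [[Ty vy vu]|[Ty vu [e [q [vq ue re]]]]|]].
- case: yz => [[_ [e [ue ey <-]]]|[g [rg gy _]]]; last by case: (rev_tgtN Ty rg gy).
  apply: (extend e v [::]) => //; rewrite ?ey //.
  exact: clos_t_clos_rt.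
- case: yz => [[_ [f [uf fy <-]]]|[g [rg gy _]]]; last by case: (rev_tgtN Ty rg gy).
  by apply: (extend f v (e :: q)) => //; rewrite fy.
- move=> [Ty vu [e [q [p [t [vq ue re yp pr]]]]]].
  case: yz => [[]//|[g [rg gy <-]]].
  have gp : walk (src g) (g :: p) t by split; rewrite ?gy.
  have lgp : rev_edge (last g p) by case: pr => [->|].
  have [Tg|Tg] := pselect (T (src g)).
    exists v; constructor 3; split=> //; exists e, q, (g :: p), t.
    by split=> //; right.
  exists (src g); constructor 1; split=> //.
  (* The walk has left T backwards through g, which must then be weighted, and a link is complete:
     the last letters differ because one is a [rev_edge] and the other is not. *)
  apply: clos_t_rt vu; apply: t_step; exists g, p, e, q, t; split=> //.
    by case: rg.
  by move=> le; apply: re; rewrite -le.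
Qed.

Lemma flow_acyclic x : W2 E -> ~ clos_trans _ flow_step x x.
Proof.
move=> W; have W2' v := W2_acyclic (x := v) W.
have outside u : ~ T u -> ~ clos_trans _ flow_step u u.
  move=> Tu /(flow_walk Tu)[v [[_ -> /W2' //]|[_ vu [e [q [vq ue _]]]]|[]//]].
  (* The unfinished unweighted walk from v back to u is put in front of the second walk of the last
     link, the one that starts at u. This closes the chain at v. *)
  have [vu'|vu'] : v = u \/ clos_trans _ w2_step v u.
    case: (clos_rt_rtn1 _ _ _ _ vu) => [|y z yz vy]; first by left.
    right; apply: clos_rt_t (clos_rtn1_rt _ _ _ _ vy) _; exact: t_step.
    by move: vq; rewrite vu' => /(acyclic_walk Eac).
  case: (clos_trans_tn1 _ _ _ _ vu') vq ue => [y vy|y z yz vy] vq ue.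
    apply: (W2' v); apply: t_step; move: vy => [f [p [e' [q' [t [vp yq wf ue' ne]]]]]].
    exists f, p, e, (q ++ e' :: q'), t; split=> //; last by rewrite last_cat.
    exact: (walk_cat vq yq).
  apply: (W2' v); apply: t_trans (clos_tn1_trans _ _ _ _ vy) _.
  apply: t_step; move: yz => [f [p [e' [q' [t [vp yq wf ue' ne]]]]]].
  exists f, p, e, (q ++ e' :: q'), t; split=> //; last by rewrite last_cat.
  exact: (walk_cat vq yq).
(* A flow walk that stays in T only follows edges backwards, so closing up would give a closed walk
   of E. Otherwise the closed flow walk is rotated to start at a vertex outside T. *)
have from_tree y : T x -> clos_trans _ flow_step x y ->
    (T y /\ exists e s, walk y (e :: s) x) \/
    (exists u, [/\ ~ T u, clos_trans _ flow_step x u &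
                   clos_refl_trans _ flow_step u y]).
  move=> Tx xy; elim: {y xy}(clos_trans_tn1 _ _ _ _ xy) => [y xy|y z yz xy IH].
    case: xy (xy) => [[]//|[g [rg gx <-]]] xy.
    have [Tg|Tg] := pselect (T (src g)); first by left; split=> //; exists g, [::].
    by right; exists (src g); split=> //; [exact: t_step|exact: rt_refl].
  case: IH => [[Ty [e [s ys]]]|[u [Tu xu uy]]]; last first.
    by right; exists u; split=> //; apply: rt_trans uy _; exact: rt_step.
  case: yz (yz) => [[]//|[g [rg gy <-]]] yz.
  have [Tg|Tg] := pselect (T (src g)).
    by left; split=> //; exists g, (e :: s); split; rewrite ?gy.
  right; exists (src g); split=> //; last exact: rt_refl.
  by apply: t_trans (clos_tn1_trans _ _ _ _ xy) _; exact: t_step.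
have [Tx|/outside//] := pselect (T x).
move=> xx; case: (from_tree _ Tx xx) => [[_ [e [s xs]]]|[u [Tu xu ux]]].
  by have := acyclic_walk Eac xs.
by apply: (outside u Tu); exact: clos_rt_t ux xu.
Qed.

End WellBehaved.

Local Open Scope ring_scope.

(** * Non-unital algebras *)

Section NUAlgebraTheory.
Variables (K : fieldType) (A : nuAlgType K).
Implicit Types x y z : A.

Lemma numul0l x : 0 ** x = 0.
Proof. by apply: (addrI (0 ** x)); rewrite -numulDl !addr0. Qed.

Lemma numul0r x : x ** 0 = 0.
Proof. by apply: (addrI (x ** 0)); rewrite -numulDr !addr0. Qed.

Lemma numul_suml I (r : seq I) (P : pred I) (F : I -> A) x :
  (\sum_(i <- r | P i) F i) ** x = \sum_(i <- r | P i) F i ** x.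
Proof.
by rewrite (big_morph (numul^~ x) (fun a b => numulDl a b x) (numul0l x)).
Qed.

Lemma numul_sumr I (r : seq I) (P : pred I) (F : I -> A) x :
  x ** (\sum_(i <- r | P i) F i) = \sum_(i <- r | P i) x ** F i.
Proof. by rewrite (big_morph (numul x) (numulDr x) (numul0r x)). Qed.

End NUAlgebraTheory.

Lemma nualg_hom_comp (K : fieldType) (A B C : nuAlgType K)
    (f : A -> B) (g : B -> C) :
  nualg_hom f -> nualg_hom g -> nualg_hom (fun x => g (f x)).
Proof.
move=> [fL fM] [gL gM]; split; first by move=> a x y; rewrite fL gL.
by move=> x y; rewrite fM gM.
Qed.

Section NUAlgebraHom.
Variables (K : fieldType) (A B : nuAlgType K) (f : A -> B).
Hypothesis fP : nualg_hom f.

Lemma nualg_homM x y : f (x ** y) = f x ** f y.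
Proof. by case: fP. Qed.

Lemma nualg_homD x y : f (x + y) = f x + f y.
Proof. by case: fP => fL _; rewrite -[x]scale1r fL !scale1r. Qed.

Lemma nualg_hom0 : f 0 = 0.
Proof. by apply: (addrI (f 0)); rewrite -nualg_homD !addr0. Qed.

Lemma nualg_homZ a x : f (a *: x) = a *: f x.
Proof. by case: fP => fL _; rewrite -[a *: x]addr0 fL nualg_hom0 addr0. Qed.

Lemma nualg_homN x : f (- x) = - f x.
Proof. by rewrite -scaleN1r nualg_homZ scaleN1r. Qed.

Lemma nualg_hom_sum I (r : seq I) (P : pred I) (F : I -> A) :
  f (\sum_(i <- r | P i) F i) = \sum_(i <- r | P i) f (F i).
Proof. exact: (big_morph f nualg_homD nualg_hom0). Qed.

Lemma nualg_hom_inj0 : (forall x, f x = 0 -> x = 0) -> injective f.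
Proof.
move=> f0 x y fxy; apply/eqP; rewrite -subr_eq0; apply/eqP/f0.
by rewrite nualg_homD nualg_homN fxy subrr.
Qed.

End NUAlgebraHom.

Lemma nualg_hom_id (K : fieldType) (A : nuAlgType K) : nualg_hom (@id A).
Proof. by []. Qed.

(** * Subalgebras *)

Record subalgebra (K : fieldType) (A : nuAlgType K) := Subalgebra {
  sub_pred : A -> Prop;
  sub_pred_lin : forall (a : K) x y, sub_pred x -> sub_pred y ->
    sub_pred (a *: x + y);
  sub_pred0 : sub_pred 0;
  sub_predM : forall x y, sub_pred x -> sub_pred y -> sub_pred (x ** y)
}.

Section SubAlgebraType.
Variables (K : fieldType) (A : nuAlgType K) (S : subalgebra A).

Definition subalg_car : Type := {x : A | `[< sub_pred S x >]}.
HB.instance Definition _ := Choice.on subalg_car.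

Implicit Types x y z : subalg_car.

Definition subalg_val x : A := val x.

Lemma subalg_valP x : sub_pred S (subalg_val x).
Proof. exact/asboolP/(valP x). Qed.

Definition subalg_mk (x : A) (Sx : sub_pred S x) : subalg_car :=
  exist _ x (introT (asboolP _) Sx).

Lemma subalg_val_inj : injective subalg_val.
Proof. exact: val_inj. Qed.

Lemma sub_predD x y : sub_pred S (subalg_val x + subalg_val y).
Proof.
by rewrite -[subalg_val x]scale1r; apply: sub_pred_lin; exact: subalg_valP.
Qed.

Lemma sub_predZ a x : sub_pred S (a *: subalg_val x).
Proof.
rewrite -[_ *: _]addr0; apply: sub_pred_lin; first exact: subalg_valP.
exact: sub_pred0.
Qed.

Lemma sub_predN x : sub_pred S (- subalg_val x).
Proof. by rewrite -scaleN1r; exact: sub_predZ. Qed.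

Definition subalg_zero : subalg_car := subalg_mk (sub_pred0 S).
Definition subalg_add x y : subalg_car := subalg_mk (sub_predD x y).
Definition subalg_opp x : subalg_car := subalg_mk (sub_predN x).
Definition subalg_scale a x : subalg_car := subalg_mk (sub_predZ a x).
Definition subalg_mul x y : subalg_car :=
  subalg_mk (sub_predM (subalg_valP x) (subalg_valP y)).

Lemma subalg_addA : associative subalg_add.
Proof. by move=> x y z; apply: subalg_val_inj; exact: addrA. Qed.
Lemma subalg_addC : commutative subalg_add.
Proof. by move=> x y; apply: subalg_val_inj; exact: addrC. Qed.
Lemma subalg_add0 : left_id subalg_zero subalg_add.
Proof. by move=> x; apply: subalg_val_inj; exact: add0r. Qed.
Lemma subalg_addN : left_inverse subalg_zero subalg_opp subalg_add.
Proof. by move=> x; apply: subalg_val_inj; exact: addNr. Qed.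

HB.instance Definition _ :=
  GRing.isZmodule.Build subalg_car subalg_addA subalg_addC subalg_add0
    subalg_addN.

Lemma subalg_scaleA a b x :
  subalg_scale a (subalg_scale b x) = subalg_scale (a * b) x.
Proof. by apply: subalg_val_inj; exact: scalerA. Qed.
Lemma subalg_scale1 : left_id 1 subalg_scale.
Proof. by move=> x; apply: subalg_val_inj; exact: scale1r. Qed.
Lemma subalg_scaleDr : right_distributive subalg_scale +%R.
Proof. by move=> a x y; apply: subalg_val_inj; exact: scalerDr. Qed.
Lemma subalg_scaleDl x : {morph subalg_scale^~ x : a b / a + b}.
Proof. by move=> a b; apply: subalg_val_inj; exact: scalerDl. Qed.

HB.instance Definition _ :=
  GRing.Zmodule_isLmodule.Build K subalg_car subalg_scaleA subalg_scale1
    subalg_scaleDr subalg_scaleDl.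

Lemma subalg_mulA : associative subalg_mul.
Proof. by move=> x y z; apply: subalg_val_inj; exact: numulA. Qed.
Lemma subalg_mulDl : left_distributive subalg_mul +%R.
Proof. by move=> x y z; apply: subalg_val_inj; exact: numulDl. Qed.
Lemma subalg_mulDr : right_distributive subalg_mul +%R.
Proof. by move=> x y z; apply: subalg_val_inj; exact: numulDr. Qed.
Lemma subalg_mulZl (a : K) x y : subalg_mul (a *: x) y = a *: subalg_mul x y.
Proof. by apply: subalg_val_inj; exact: numulZl. Qed.
Lemma subalg_mulZr (a : K) x y : subalg_mul x (a *: y) = a *: subalg_mul x y.
Proof. by apply: subalg_val_inj; exact: numulZr. Qed.

HB.instance Definition _ :=
  Lmodule_isNUAlgebra.Build K subalg_car subalg_mulA subalg_mulDl subalg_mulDr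
    subalg_mulZl subalg_mulZr.

Lemma subalg_val_hom : nualg_hom subalg_val.
Proof. by []. Qed.

End SubAlgebraType.

(** Only the universal property is available. It is applied to the subalgebra of all elements that
    come from some stage: followed by the inclusion, the map from L to this subalgebra must be the
    identity by uniqueness. *)
Lemma direct_limit_surj (K : fieldType) (I : Type) (le : I -> I -> Prop)
    (A : I -> nuAlgType K) (phi : forall i j, le i j -> A i -> A j)
    (L : nuAlgType K) (psi : forall i, A i -> L) :
  direct_system phi -> is_direct_limit phi psi ->
  forall x : L, exists i a, psi i a = x.
Proof.
move=> [[[i0] _ _ dir] phiP _ _] [[psiP psiphi] univ].
pose P (x : L) := exists i a, psi i a = x.
have P2 x y : P x -> P y -> exists i a b, psi i a = x /\ psi i b = y.
  move=> [i [a <-]] [j [b <-]]; have [k [ik jk]] := dir i j.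
  by exists k, (phi _ _ ik a), (phi _ _ jk b); rewrite !psiphi.
have Plin (a : K) x y : P x -> P y -> P (a *: x + y).
  move=> Px Py; have [i [b [c [<- <-]]]] := P2 _ _ Px Py.
  exists i, (a *: b + c).
  by rewrite (nualg_homD (psiP i)) (nualg_homZ (psiP i)).
have P0 : P 0 by exists i0, 0; rewrite (nualg_hom0 (psiP i0)).
have PM x y : P x -> P y -> P (x ** y).
  move=> Px Py; have [i [b [c [<- <-]]]] := P2 _ _ Px Py.
  by exists i, (b ** c); rewrite (nualg_homM (psiP i)).
pose S := Subalgebra Plin P0 PM.
have Ppsi i a : P (psi i a) by exists i, a.
pose chi i a : subalg_car S := @subalg_mk _ _ S _ (Ppsi i a).
have chiP : cocone phi chi.
  split=> [i|i j ij x]; last by apply: subalg_val_inj; exact: psiphi.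
  split=> [a x y|x y]; apply: subalg_val_inj => /=.
    by rewrite /subalg_val /= (nualg_homD (psiP i)) (nualg_homZ (psiP i)).
  by rewrite /subalg_val /= (nualg_homM (psiP i)).
have [f [[fP fchi] _]] := univ _ chi chiP.
have [g [_ gU]] := univ _ psi (conj psiP psiphi).
have gid : g = id by apply: gU.
have gf : g = (fun x => subalg_val (f x)).
  apply: gU; split; first exact: nualg_hom_comp fP (@subalg_val_hom _ _ S).
  by move=> i x; rewrite fchi.
move=> x; have := subalg_valP (f x).
by have -> : subalg_val (f x) = x; [rewrite -[RHS]/(id x) -gid gf|].
Qed.

Lemma matrix_sum_regular (K : fieldType) (m : nat) (n : 'I_m -> nat)
    (x : matrix_sum K n) : exists y : matrix_sum K n, x ** y ** x = x.
Proof.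
exists (msum_build (fun k => pinvmx (msum_proj x k))).
by apply: msumP => k; rewrite !msum_buildE mulmxKpV.
Qed.

Lemma locally_matricial_regular (K : fieldType) (L : nuAlgType K) :
  locally_matricial L -> von_neumann_regular L.
Proof.
move=> [I [le [A [phi [psi [sysP matP limP]]]]]] x.
have [i [a <-]] := direct_limit_surj sysP limP x.
have psiP := limP.1.1 i.
have [m [n [f [fP [g fK gK]]]]] := matP i.
have [y yP] := matrix_sum_regular (f a).
exists (psi i (g y)); rewrite -!(nualg_homM psiP); congr psi.
by apply: (can_inj fK); rewrite !(nualg_homM fP) gK.
Qed.

(** * Directed unions of matricial subalgebras *)

(** Indices in nat avoid casts between block sizes; an index out of range gives 0. *)
Definition msum_unit (K : fieldType) (m : nat) (n : 'I_m -> nat) (k : 'I_m)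
    (p q : nat) : matrix_sum K n :=
  msum_build (fun l => \matrix_(a, b) [&& l == k, a == p :> nat & b == q :> nat]%:R).

Section MatrixSum.
Variables (K : fieldType) (m : nat) (n : 'I_m -> nat).

Lemma msum_projD l : {morph (fun x : matrix_sum K n => msum_proj x l) :
  a b / a + b}.
Proof. by move=> a b; rewrite msum_buildE. Qed.

Lemma msum_proj0 l : msum_proj (0 : matrix_sum K n) l = 0.
Proof. by rewrite msum_buildE. Qed.

Lemma msum_proj_sum l I (r : seq I) (P : pred I) (F : I -> matrix_sum K n) :
  msum_proj (\sum_(i <- r | P i) F i) l = \sum_(i <- r | P i) msum_proj (F i) l.
Proof. exact: (big_morph _ (msum_projD l) (msum_proj0 l)). Qed.

Lemma msum_decomp (x : matrix_sum K n) :
  x = \sum_k \sum_p \sum_q msum_proj x k p q *: msum_unit K n k p q.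
Proof.
apply: msumP => l; apply/matrixP => a b.
rewrite msum_proj_sum summxE (bigD1 l) //= [X in _ + X]big1 => [|k kl].
  rewrite addr0 msum_proj_sum summxE (bigD1 a) //= [X in _ + X]big1 => [|p pa].
    rewrite addr0 msum_proj_sum summxE (bigD1 b) //= [X in _ + X]big1.
      by rewrite addr0 !msum_buildE !mxE !eqxx mulr1.
    by move=> q qb; rewrite !msum_buildE !mxE !eqxx /= eq_sym val_eqE (negPf qb) mulr0.
  rewrite msum_proj_sum summxE big1 // => q _.
  by rewrite !msum_buildE !mxE eqxx /= eq_sym val_eqE (negPf pa) mulr0.
rewrite msum_proj_sum summxE big1 // => p _.
rewrite msum_proj_sum summxE big1 // => q _.
by rewrite !msum_buildE !mxE eq_sym (negPf kl) mulr0.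
Qed.

End MatrixSum.

(** The stages are all embeddings of matrix sums into L, ordered by inclusion of images. A matrix
    sum is spanned by finitely many matrix units, so the hypothesis on finite lists provides upper
    bounds. Injectivity makes the connecting maps unique, hence compatible. *)
Lemma locally_matricial_of_embeddings (K : fieldType) (L : nuAlgType K) :
  (forall s : seq L, exists m (n : 'I_m -> nat) (f : matrix_sum K n -> L),
    [/\ nualg_hom f, injective f & forall x, x \in s -> exists y, f y = x]) ->
  locally_matricial L.
Proof.
move=> emb.
pose I := {m : nat & {n : 'I_m -> nat &
  {f : matrix_sum K n -> L | nualg_hom f /\ injective f}}}.
pose A (i : I) : nuAlgType K := matrix_sum K (projT1 (projT2 i)).
pose psi (i : I) : A i -> L := sval (projT2 (projT2 i)).
have psiP i : nualg_hom (psi i) by case: (svalP (projT2 (projT2 i))).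
have psi_inj i : injective (psi i) by case: (svalP (projT2 (projT2 i))).
pose le (i j : I) := forall x, exists y, psi j y = psi i x.
pose phi i j (ij : le i j) x := sval (cid (ij x)).
have phiE i j (ij : le i j) x : psi j (phi i j ij x) = psi i x.
  exact: svalP (cid (ij x)).
have embI (s : seq L) : exists i : I, forall x, x \in s -> exists y, psi i y = x.
  have [m [n [f [fP finj fs]]]] := emb s.
  by exists (existT _ m (existT _ n (exist _ f (conj fP finj)))).
have gens (i : I) : exists s : seq L, forall j : I,
    (forall x, x \in s -> exists y, psi j y = x) -> le i j.
  (* A common bound on the block sizes lists the matrix units over a non-dependent finite type; the
     surplus units are 0. *)
  pose N := (\max_(k < projT1 i) (projT1 (projT2 i) k).+1)%N.
  pose u : 'I_(projT1 i) -> nat -> nat -> A i := @msum_unit K _ _.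
  exists [seq psi i (u t.1 t.2.1 t.2.2) | t : 'I_(projT1 i) * ('I_N * 'I_N)].
  move=> j sj x.
  have uj k p q : exists y, (p < N)%N -> (q < N)%N -> psi j y = psi i (u k p q).
    case: (ltnP p N) => pN; last by exists 0.
    case: (ltnP q N) => qN; last by exists 0.
    have [|y <-] := sj (psi i (u k p q)); last by exists y.
    by apply/mapP; exists (k, (Ordinal pN, Ordinal qN)); rewrite ?mem_enum.
  pose v k p q := sval (cid (uj k p q)).
  exists (\sum_k \sum_p \sum_q msum_proj x k p q *: v k p q).
  rewrite [in RHS](msum_decomp x).
  rewrite (nualg_hom_sum (psiP j)) (nualg_hom_sum (psiP i)).
  apply: eq_bigr => k _.
  rewrite (nualg_hom_sum (psiP j)) (nualg_hom_sum (psiP i)).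
  apply: eq_bigr => p _.
  rewrite (nualg_hom_sum (psiP j)) (nualg_hom_sum (psiP i)).
  apply: eq_bigr => q _.
  rewrite (nualg_homZ (psiP j)) (nualg_homZ (psiP i)); congr (_ *: _).
  have ltN (a : 'I_(projT1 (projT2 i) k).+1) : (a < N)%N.
    apply: leq_trans (ltn_ord a) _.
    exact: (leq_bigmax (F := fun k => (projT1 (projT2 i) k).+1)).
  exact: (svalP (cid (uj k p q)) (ltN p) (ltN q)).
have dir i j : exists k, le i k /\ le j k.
  have [s sP] := gens i; have [t tP] := gens j.
  have [k kP] := embI (s ++ t); exists k; split.
    by apply: sP => x xs; apply: kP; rewrite mem_cat xs.
  by apply: tP => x xt; apply: kP; rewrite mem_cat xt orbT.
have le_refl i : le i i by move=> x; exists x.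
have le_trans i j k : le i j -> le j k -> le i k.
  by move=> ij jk x; have [y <-] := ij x; exact: jk.
have [i0 _] := embI [::].
exists I, le, A, phi, psi; split.
- split=> //.
  + move=> i j ij; split=> [a x y|x y]; apply: (psi_inj j).
      rewrite (nualg_homD (psiP j)) (nualg_homZ (psiP j)) !phiE.
      by rewrite (nualg_homD (psiP i)) (nualg_homZ (psiP i)).
    by rewrite (nualg_homM (psiP j)) !phiE (nualg_homM (psiP i)).
  + by move=> i ii x; apply: (psi_inj i); rewrite phiE.
  + by move=> i j k ij jk ik x; apply: (psi_inj k); rewrite !phiE.
- move=> i; exists (projT1 i), (projT1 (projT2 i)), id.
  by split; [exact: nualg_hom_id|exists id].
- split; first by [].
  move=> B chi [chiP chiphi].
  have cov x : exists i y, psi i y = x.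
    have [i iP] := embI [:: x]; have [|y yx] := iP x; first by rewrite inE.
    by exists i, y.
  have chi_eq i j x y : psi i x = psi j y -> chi i x = chi j y.
    move=> xy; have [k [ik jk]] := dir i j.
    rewrite -(chiphi _ _ ik) -(chiphi _ _ jk); congr chi.
    by apply: (psi_inj k); rewrite !phiE.
  pose f x := chi _ (sval (cid (svalP (cid (cov x))))).
  have fE i x : f (psi i x) = chi i x.
    by apply: chi_eq; exact: svalP (cid (svalP (cid (cov (psi i x))))).
  have cov2 x y : exists i a b, psi i a = x /\ psi i b = y.
    have [i iP] := embI [:: x; y].
    have [|a <-] := iP x; first by rewrite !inE eqxx.
    have [|b <-] := iP y; first by rewrite !inE eqxx orbT.
    by exists i, a, b.
  exists f; split.
    split=> //; split=> [a x y|x y]; have [i [b [c [<- <-]]]] := cov2 x y.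
      rewrite -(nualg_homZ (psiP i)) -(nualg_homD (psiP i)) !fE.
      by rewrite (nualg_homD (chiP i)) (nualg_homZ (chiP i)).
    by rewrite -(nualg_homM (psiP i)) !fE (nualg_homM (chiP i)).
  move=> g [_ gE]; apply/funext => x; have [i [y <-]] := cov x.
  by rewrite fE gE.
Qed.

(** * Systems of matrix units *)

Section MatrixUnits.
Variables (K : fieldType) (A : nuAlgType K) (m : nat) (n : 'I_m -> nat).
Variable u : 'I_m -> nat -> nat -> A.
Hypothesis uM : forall k l p q r s,
  (p <= n k)%N -> (q <= n k)%N -> (r <= n l)%N -> (s <= n l)%N ->
  u k p q ** u l r s = if (k == l) && (q == r) then u k p s else 0.
Hypothesis u_neq0 : forall k, u k 0 0 <> 0.

Definition munit_map (x : matrix_sum K n) : A :=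
  \sum_k \sum_p \sum_q msum_proj x k p q *: u k p q.

Lemma munit_mulr k p q (y : matrix_sum K n) :
  (p <= n k)%N -> (q <= n k)%N ->
  u k p q ** munit_map y = \sum_s msum_proj y k (inord q) s *: u k p s.
Proof.
move=> pn qn; rewrite numul_sumr (bigD1 k) //= [X in _ + X]big1 => [|l lk].
  rewrite addr0 numul_sumr (bigD1 (inord q)) //= [X in _ + X]big1 => [|r rq].
    rewrite addr0 numul_sumr; apply: eq_bigr => s _.
    by rewrite numulZr uM ?inordK ?leq_ord // !eqxx.
  rewrite numul_sumr big1 // => s _; rewrite numulZr uM ?leq_ord // eqxx /=.
  case: eqP => [e|_]; last by rewrite scaler0.
  by case/eqP: rq; apply: val_inj; rewrite /= inordK.
rewrite numul_sumr big1 // => r _; rewrite numul_sumr big1 // => s _.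
by rewrite numulZr uM ?leq_ord // eq_sym (negPf lk) scaler0.
Qed.

Lemma munit_map_hom : nualg_hom munit_map.
Proof.
split=> [a x y|x y].
  rewrite /munit_map scaler_sumr -big_split; apply: eq_bigr => k _ /=.
  rewrite scaler_sumr -big_split; apply: eq_bigr => p _ /=.
  rewrite scaler_sumr -big_split; apply: eq_bigr => q _ /=.
  by rewrite !msum_buildE !mxE scalerDl scalerA.
rewrite {2}/munit_map numul_suml; apply: eq_bigr => k _.
rewrite numul_suml; apply: eq_bigr => p _.
rewrite numul_suml.
transitivity (\sum_q \sum_s
    (msum_proj x k p q * msum_proj y k q s) *: u k p s).
  rewrite exchange_big; apply: eq_bigr => s _ /=.
  by rewrite -scaler_suml msum_buildE mxE.
apply: eq_bigr => q _; rewrite numulZl munit_mulr ?leq_ord // scaler_sumr.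
by apply: eq_bigr => s _; rewrite scalerA inord_val.
Qed.

Lemma munit_map_unit k p q : (p <= n k)%N -> (q <= n k)%N ->
  munit_map (msum_unit K n k p q) = u k p q.
Proof.
move=> pn qn; rewrite /munit_map (bigD1 k) //= [X in _ + X]big1 => [|l lk].
  rewrite addr0 (bigD1 (inord p)) //= [X in _ + X]big1 => [|r rp].
    rewrite addr0 (bigD1 (inord q)) //= [X in _ + X]big1 => [|s sq].
      by rewrite addr0 msum_buildE mxE !inordK // !eqxx scale1r.
    rewrite msum_buildE mxE; case: (eqVneq (s : nat) q) sq => [<-|_ _].
      by rewrite inord_val eqxx.
    by rewrite !andbF scale0r.
  rewrite big1 // => s _; rewrite msum_buildE mxE.
  case: (eqVneq (r : nat) p) rp => [<-|_ _]; first by rewrite inord_val eqxx.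
  by rewrite andbF scale0r.
rewrite big1 // => r _; rewrite big1 // => s _.
by rewrite msum_buildE mxE (negPf lk) scale0r.
Qed.

(** Multiplying the image of x by u_(0,p) on the left and by u_(q,0) on the right isolates one
    coefficient, as a multiple of the nonzero u_(0,0). *)
Lemma munit_map_inj : injective munit_map.
Proof.
apply: (nualg_hom_inj0 munit_map_hom) => x fx0; apply: msumP => k.
apply/matrixP => p q; rewrite msum_buildE mxE.
have : u k 0 p ** munit_map x ** u k q 0 = 0 by rewrite fx0 numul0r numul0l.
rewrite munit_mulr ?leq_ord // numul_suml (bigD1 q) //= big1 => [|s sq].
  rewrite addr0 numulZl uM ?leq_ord // !eqxx inord_val => /eqP.
  by rewrite scaler_eq0 => /orP[/eqP //|/eqP/u_neq0].
rewrite numulZl uM ?leq_ord // eqxx /=; case: eqP => [e|_]; last exact: scaler0.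
by case/eqP: sq; apply: val_inj.
Qed.

End MatrixUnits.

(** * Strands *)

(* A strand (t, a, b) stands for a partial isometry a with adjoint b and range
   idempotent b ** a = P t. *)
Section Strands.
Variables (K : fieldType) (A : nuAlgType K) (N : eqType) (P : N -> A).
Implicit Types (W : seq (N * A * A)) (x y : A).

Definition orthogonal_strands (s t : N * A * A) : bool :=
  (s.2 ** t.1.2 == 0) && (t.2 ** s.1.2 == 0).

Definition isometric_strands W : Prop :=
  pairwise orthogonal_strands W /\
  (forall s, s \in W -> s.2 ** s.1.2 = P s.1.1 /\ s.1.2 ** P s.1.1 = s.1.2).

Lemma isometric_strandsE W w i j :
  isometric_strands W -> (i < size W)%N -> (j < size W)%N ->
  (nth w W i).2 ** (nth w W j).1.2 = if i == j then P (nth w W i).1.1 else 0.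
Proof.
move=> [/(pairwiseP w) Wort WP] iW jW.
case: (ltngtP i j) => [ij|ji|<-]; last by apply: (WP _ _).1; rewrite mem_nth.
  by have /andP[/eqP] := Wort _ _ iW jW ij.
by have /andP[_ /eqP] := Wort _ _ jW iW ji.
Qed.

Inductive strand_span W : A -> Prop :=
| strand_span0 : strand_span W 0
| strand_span_cons c s t x : s \in W -> t \in W -> s.1.1 = t.1.1 ->
    strand_span W x -> strand_span W (c *: (s.1.2 ** t.2) + x).

Lemma strand_spanD W x y :
  strand_span W x -> strand_span W y -> strand_span W (x + y).
Proof.
move=> Wx Wy; elim: Wx => [|c s t z sW tW st _ IH]; first by rewrite add0r.
by rewrite -addrA; exact: strand_span_cons.
Qed.

Lemma strand_span_sum W (I : eqType) (r : seq I) (F : I -> A) :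
  (forall i, i \in r -> strand_span W (F i)) ->
  strand_span W (\sum_(i <- r) F i).
Proof.
move=> rF; rewrite big_seq; apply: (big_ind _ _ _ rF).
  exact: strand_span0.
exact: strand_spanD.
Qed.

Lemma strand_span_unit W s t :
  s \in W -> t \in W -> s.1.1 = t.1.1 -> strand_span W (s.1.2 ** t.2).
Proof.
move=> sW tW st; rewrite -[_ ** _]addr0 -[_ ** _]scale1r.
exact: strand_span_cons (strand_span0 W).
Qed.

Lemma strand_embedding W : isometric_strands W ->
  exists m (n : 'I_m -> nat) (f : matrix_sum K n -> A),
    [/\ nualg_hom f, injective f &
        forall x, strand_span W x -> exists z, f z = x].
Proof.
case: (posnP (size W)) => [W0 _|W_gt0 WO].
  have {W0} -> : W = [::] by exact: size0nil.
  exists 0, (fun=> 0)%N, (fun=> 0); split.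
  - by split=> [a x y|x y]; rewrite ?numul0l // scaler0 addr0.
  - by move=> x y _; apply: msumP; case.
  - by move=> x; case=> [|c s t z //]; exists 0.
have w : N * A * A by case: (W) W_gt0 => // s.
pose t i := (nth w W i).1.1; pose a i := (nth w W i).1.2.
pose b i := (nth w W i).2.
have inW i : (i < size W)%N -> nth w W i \in W by move=> ?; rewrite mem_nth.
pose ts := undup [seq t i | i <- iota 0 (size W) & P (t i) != 0].
pose L (k : 'I_(size ts)) := [seq i <- iota 0 (size W) | t i == tnth (in_tuple ts) k].
have L_gt0 k : (0 < size (L k))%N.
  have: tnth (in_tuple ts) k \in ts by exact: mem_tnth.
  rewrite mem_undup => /mapP[i]; rewrite mem_filter => /andP[_ iW] e.
  rewrite -has_predT; apply/hasP; exists i => //.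
  by rewrite mem_filter e eqxx.
have LP k p : (p <= (size (L k)).-1)%N ->
    [/\ (nth 0 (L k) p < size W)%N, t (nth 0 (L k) p) = tnth (in_tuple ts) k
      & P (tnth (in_tuple ts) k) <> 0].
  rewrite -ltnS prednK // => pk; have := mem_nth 0 pk.
  rewrite mem_filter mem_iota add0n => /andP[/eqP e /andP[_ lt]]; split=> //.
  have: tnth (in_tuple ts) k \in ts by exact: mem_tnth.
  by rewrite mem_undup => /mapP[i]; rewrite mem_filter => /andP[/eqP ? _] ->.
have baE i j : (i < size W)%N -> (j < size W)%N ->
    b i ** a j = if i == j then P (t i) else 0.
  by move=> iW jW; exact: isometric_strandsE.
have aP i : (i < size W)%N -> a i ** P (t i) = a i.
  by move=> iW; apply: (WO.2 _ _).2; exact: inW.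
pose u k p q := a (nth 0 (L k) p) ** b (nth 0 (L k) q).
have uM k l p q r s :
    (p <= (size (L k)).-1)%N -> (q <= (size (L k)).-1)%N ->
    (r <= (size (L l)).-1)%N -> (s <= (size (L l)).-1)%N ->
    u k p q ** u l r s = if (k == l) && (q == r) then u k p s else 0.
  move=> pk qk rl sl; have [pW pt _] := LP _ _ pk; have [qW qt _] := LP _ _ qk.
  have [rW rt _] := LP _ _ rl; have [sW st _] := LP _ _ sl.
  rewrite /u numulA -(numulA (a _)) baE //.
  have -> : (nth 0 (L k) q == nth 0 (L l) r) = (k == l) && (q == r).
    apply/eqP/andP => [e|[/eqP kl /eqP -> ]]; last by rewrite kl.
    have kl : k = l.
      apply/val_inj/eqP => /=.
      rewrite -(nth_uniq (t 0) (ltn_ord k) (ltn_ord l) (undup_uniq _)).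
      by move: qt rt; rewrite !(tnth_nth (t 0)) /= => <- <-; rewrite e.
    split; first by rewrite kl.
    move: rl rt e; rewrite -kl => rl rt /eqP e.
    rewrite (nth_uniq 0) ?filter_uniq ?iota_uniq // in e.
      by rewrite (leq_ltn_trans qk) // prednK.
    by rewrite (leq_ltn_trans rl) // prednK.
  case: andP => [[/eqP kl _]|_]; last by rewrite numul0r numul0l.
  by rewrite qt -pt aP // kl.
have u_neq0 k : u k 0 0 <> 0.
  have [iW it Pk] := LP k 0 (leq0n _); move=> u0; apply: Pk.
  have := congr1 (fun z => b (nth 0 (L k) 0) ** z ** a (nth 0 (L k) 0)) u0.
  rewrite /= numul0r numul0l /u numulA baE // eqxx it -[in LHS]it.
  have PP : P (t (nth 0 (L k) 0)) ** P (t (nth 0 (L k) 0)) = P (t (nth 0 (L k) 0)).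
    by have := baE _ _ iW iW; rewrite eqxx => {1}<-; rewrite -numulA aP // baE // eqxx.
  by rewrite -numulA baE // eqxx PP it.
exists (size ts), (fun k => (size (L k)).-1), (munit_map u).
split; [exact: (munit_map_hom uM)|exact: (munit_map_inj uM u_neq0)|].
have fP := munit_map_hom uM.
move=> x; elim=> [|c s s' z sW s'W ss' _ [y yz]].
  by exists 0; exact: (nualg_hom0 fP).
pose n k := (size (L k)).-1.
suff [v vE] : exists v : matrix_sum K n, munit_map u v = s.1.2 ** s'.2.
  by exists (c *: v + y); rewrite (nualg_homD fP) (nualg_homZ fP) vE yz.
have sP := (WO.2 _ sW).2; case: (eqVneq (P s.1.1) 0) => [P0|Pn0].
  by exists 0; rewrite (nualg_hom0 fP) -sP P0 numul0r numul0l.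
have tsP : s.1.1 \in ts.
  rewrite mem_undup; apply/mapP; exists (index s W); last by rewrite /t nth_index.
  by rewrite mem_filter mem_iota /t nth_index // Pn0 /= index_mem.
have kP : (index s.1.1 ts < size ts)%N by rewrite index_mem.
pose k := Ordinal kP.
have kE : tnth (in_tuple ts) k = s.1.1 by rewrite (tnth_nth s.1.1) /= nth_index.
have inL r : r \in W -> r.1.1 = s.1.1 -> index r W \in L k.
  by move=> rW rs; rewrite mem_filter mem_iota /t nth_index // kE rs eqxx index_mem.
have sL := inL _ sW erefl; have s'L := inL _ s'W (esym ss').
exists (msum_unit K n k (index (index s W) (L k)) (index (index s' W) (L k))).
have ltL r : r \in L k -> (index r (L k) <= (size (L k)).-1)%N.
  by move=> rL; rewrite -ltnS prednK // index_mem.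
rewrite munit_map_unit ?ltL // /u !nth_index // /a /b !nth_index //.
Qed.

End Strands.

Lemma pairwise_flatten_map (S T : eqType) (r : rel T) (F : S -> seq T) (s : seq S) :
  (forall x, x \in s -> pairwise r (F x)) ->
  pairwise (fun x y => allrel r (F x) (F y)) s ->
  pairwise r (flatten [seq F x | x <- s]).
Proof.
elim: s => [//|x s IH] pF /= /andP[xs ps].
rewrite pairwise_cat pF ?mem_head // IH ?andbT //; last first.
  by move=> y ys; apply: pF; rewrite inE ys orbT.
apply/allrelP => a b aF /flattenP[_ /mapP[y ys ->] bF].
by have /allrelP := allP xs _ ys; apply.
Qed.

Lemma exists_minimal (T : eqType) (R : T -> T -> Prop) (s : seq T) :
  (forall x, ~ R x x) -> (forall x y z, R x y -> R y z -> R x z) ->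
  s != [::] -> exists2 x, x \in s & forall y, y \in s -> ~ R y x.
Proof.
move=> Rirr Rtr; elim: s => [//|a [|b s] IH] _.
  by exists a => [|y]; rewrite ?inE // => /eqP ->.
have [//|m ms mmin] := IH.
have [Ram|nRam] := pselect (R a m); last first.
  exists m; first by rewrite inE ms orbT.
  by move=> y; rewrite inE => /predU1P[->|/mmin].
exists a; first exact: mem_head.
move=> y; rewrite inE => /predU1P[->|ys]; first exact: Rirr.
by move=> Rya; apply: (mmin y ys); exact: Rtr Ram.
Qed.

(** * Expanding nodes *)

Section Expansion.
Variables (K : fieldType) (A : nuAlgType K) (N : eqType) (P : N -> A).
Variable ch : N -> seq (N * A * A).
Variable expandable : N -> Prop.
Hypothesis PP : forall x, P x ** P x = P x.
Hypothesis ch_orthonormal : forall x, expandable x -> isometric_strands P (ch x).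
Hypothesis ch_sum : forall x, expandable x ->
  \sum_(c <- ch x) c.1.2 ** c.2 = P x.
Hypothesis ch_corner : forall x c, expandable x -> c \in ch x ->
  [/\ P x ** c.1.2 = c.1.2, P c.1.1 ** c.2 = c.2 & c.2 ** P x = c.2].

Definition child (x y : N) : Prop := exists2 c, c \in ch x & c.1.1 = y.

Hypothesis child_acyclic : forall x, ~ clos_trans N child x x.

Definition extend_strand (c s : N * A * A) : N * A * A :=
  (s.1.1, c.1.2 ** s.1.2, s.2 ** c.2).

Definition expansion (st : N -> seq (N * A * A)) x : seq (N * A * A) :=
  flatten [seq [seq extend_strand c s | s <- st c.1.1] | c <- ch x].

Definition resolves (x : N) (W : seq (N * A * A)) : Prop :=
  [/\ isometric_strands P W, \sum_(s <- W) s.1.2 ** s.2 = P x &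
    forall s, s \in W -> P x ** s.1.2 = s.1.2 /\ s.2 ** P x = s.2].

Lemma resolves_trivial x : resolves x [:: (x, P x, P x)].
Proof.
split; [split=> // s|by rewrite big_seq1 /= PP|move=> s].
  by rewrite inE => /eqP -> /=; rewrite PP.
by rewrite inE => /eqP -> /=; rewrite PP.
Qed.

Lemma resolves_expansion st x : expandable x ->
  (forall y, child x y -> resolves y (st y)) -> resolves x (expansion st x).
Proof.
move=> ex stP.
have [ch_ort ch_unit] := ch_orthonormal ex.
have stc c : c \in ch x -> resolves c.1.1 (st c.1.1).
  by move=> cx; apply: stP; exists c.
have inexp s : s \in expansion st x ->
    exists c t, [/\ c \in ch x, t \in st c.1.1 & s = extend_strand c t].
  by move=> /flattenP[_ /mapP[c cx ->] /mapP[t tc ->]]; exists c, t.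
split.
- split.
    apply: pairwise_flatten_map => [c cx|].
      have [[pw _] _ stc3] := stc _ cx; rewrite pairwise_map.
      apply: (sub_in_pairwise _ (allss _) pw) => s t ss ts /=.
      rewrite /orthogonal_strands /= => /andP[/eqP st0 /eqP ts0].
      have [cc _] := ch_unit _ cx.
      have [ss1 ss2] := stc3 _ ss; have [ts1 ts2] := stc3 _ ts.
      rewrite !numulA -(numulA s.2) cc ss2 st0 eqxx /=.
      by rewrite -(numulA t.2) cc ts2 ts0.
    apply: sub_pairwise ch_ort => c d /andP[/eqP cd /eqP dc].
    apply/allrelP => _ _ /mapP[s _ ->] /mapP[t _ ->].
    rewrite /orthogonal_strands /= !numulA -(numulA s.2) cd.
    by rewrite -(numulA t.2) dc !numul0r !numul0l eqxx.
  move=> s /inexp[c [t [cx tc ->]]] /=.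
  have [[_ unit_t] _ stc3] := stc _ cx.
  have [tt1 tt2] := unit_t _ tc; have [_ tP] := stc3 _ tc.
  have [cc _] := ch_unit _ cx.
  by rewrite numulA -(numulA t.2) cc tP tt1 -numulA tt2.
- rewrite big_flatten big_map -[RHS](ch_sum ex).
  apply: eq_big_seq => c cx; rewrite big_map /=.
  have [_ stsum _] := stc _ cx.
  transitivity (c.1.2 ** (\sum_(s <- st c.1.1) s.1.2 ** s.2) ** c.2).
    rewrite numul_sumr numul_suml; apply: eq_bigr => s _.
    by rewrite !numulA.
  by rewrite stsum (ch_unit _ cx).2.
- move=> s /inexp[c [t [cx tc ->]]] /=.
  have [cP1 _ cP2] := ch_corner ex cx.
  by rewrite numulA cP1 -numulA cP2.
Qed.

(** The point is that one [st] serves all of S, so that nodes with a common child use the same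
    resolution of it. The induction removes an x that is a child of no member of S; redefining [st]
    at x then leaves the expansions of the other members unchanged. *)
Lemma exists_expansion (S : seq N) : uniq S -> (forall x, x \in S -> expandable x) ->
  exists st : N -> seq (N * A * A),
    (forall x, resolves x (st x)) /\
    (forall x, x \in S -> st x = expansion st x).
Proof.
move En : (size S) => n; elim: n S En => [|n IH] S.
  move=> /size0nil -> _ _; exists (fun x => [:: (x, P x, P x)]).
  by split=> // x; exact: resolves_trivial.
move=> Sn uS Sex; have S0 : S != [::] by case: S Sn {uS Sex}.
have [x xS xmin] := exists_minimal child_acyclic (@t_trans _ _) S0.
have [||y|st [stP stE]] := IH (rem x S).
- by rewrite size_rem // Sn.
- exact: rem_uniq.
- by move=> /mem_rem; exact: Sex.
exists (fun y => if y == x then expansion st x else st y).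
have xS' y : y \in S -> ~ child y x.
  by move=> yS yx; apply: (xmin y yS); exact: t_step.
have eqE y : y \in S ->
    expansion (fun y => if y == x then expansion st x else st y) y =
    expansion st y.
  move=> yS; congr flatten; apply/eq_in_map => c cy.
  case: eqP => // cx; case: (xS' _ yS); by exists c.
split=> y.
  case: eqP => [->|_]; last exact: stP.
  by apply: resolves_expansion => [|z _]; [exact: Sex|exact: stP].
move=> yS; rewrite eqE //; case: eqP => [-> //|/eqP yx].
by apply: stE; rewrite mem_rem_uniq // inE yx.
Qed.

(** If c and d end at the same child, inserting the resolution of that child turns c d^* into the
    sum of the products (c s)(d s)^*, whose factors are strands of W. If the child itself lies in V,
    then c is likewise the sum of the products (c s) s^*. *)
Lemma finite_resolution (V : seq N) : uniq V ->
  (forall x y, x \in V -> y \in V -> x != y -> P x ** P y = 0) ->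
  exists W, [/\ isometric_strands P W,
    forall x, x \in V -> strand_span W (P x),
    forall x y c d, x \in V -> y \in V -> expandable x -> expandable y ->
      c \in ch x -> d \in ch y -> c.1.1 = d.1.1 -> strand_span W (c.1.2 ** d.2) &
    forall x c, x \in V -> expandable x -> c \in ch x -> c.1.1 \in V ->
      strand_span W c.1.2 /\ strand_span W c.2].
Proof.
move=> uV VO; pose S := [seq x <- V | `[< expandable x >]].
have [||st [stP stE]] := @exists_expansion S.
- exact: filter_uniq.
- by move=> x; rewrite mem_filter => /andP[/asboolP].
have {}stE x : x \in V -> expandable x -> st x = expansion st x.
  by move=> xV ex; apply: stE; rewrite mem_filter xV andbT; apply/asboolP.
pose W := flatten [seq st x | x <- V].
have inW x s : x \in V -> s \in st x -> s \in W.
  by move=> xV sx; apply/flattenP; exists (st x) => //; exact: map_f.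
have ext x c s : x \in V -> expandable x -> c \in ch x -> s \in st c.1.1 ->
    extend_strand c s \in W.
  move=> xV ex cx sc; apply: (inW x) => //; rewrite stE //.
  by apply/flattenP; eexists; [apply: map_f; exact: cx|exact: map_f].
exists W; split.
- split.
    apply: pairwise_flatten_map => [x _|]; first by case: (stP x) => -[].
    have := uV; rewrite uniq_pairwise.
    apply: (sub_in_pairwise _ (allss _)) => x y xV yV /= xy.
    apply/allrelP => s t sx ty; rewrite /orthogonal_strands.
    have [_ _ /(_ _ sx)[sx1 sx2]] := stP x.
    have [_ _ /(_ _ ty)[ty1 ty2]] := stP y.
    rewrite -sx1 -sx2 -ty1 -ty2 -!numulA !(numulA (P _) (P _)).
    by rewrite !VO // 1?eq_sym // !numul0l !numul0r eqxx.
  move=> s /flattenP[_ /mapP[x xV ->] sx].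
  by have [[_ stu] _ _] := stP x; exact: stu.
- move=> x xV; have [_ <- _] := stP x; apply: strand_span_sum => s sx.
  by apply: strand_span_unit => //; exact: inW sx.
- move=> x y c d xV yV ex ey cx dy cd.
  have -> : c.1.2 ** d.2 = \sum_(s <- st c.1.1)
      (extend_strand c s).1.2 ** (extend_strand d s).2.
    have [_ stsum _] := stP c.1.1.
    rewrite -[c.1.2](((ch_orthonormal ex).2 _ cx).2) -stsum.
    rewrite numul_sumr numul_suml; apply: eq_bigr => s _ /=.
    by rewrite !numulA.
  apply: strand_span_sum => s sc; apply: strand_span_unit => //.
    exact: (ext x).
  by apply: (ext y) => //; rewrite -cd.
- move=> x c xV ex cx cV; have [_ stsum stc] := stP c.1.1; split.
    rewrite -[c.1.2](((ch_orthonormal ex).2 _ cx).2) -stsum numul_sumr.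
    apply: strand_span_sum => s sc; rewrite numulA.
    apply: (@strand_span_unit _ _ _ _ (extend_strand c s)) => //.
      exact: (ext x).
    exact: inW sc.
  have [_ <- _] := ch_corner ex cx; rewrite -stsum numul_suml.
  apply: strand_span_sum => s sc; rewrite -numulA.
  apply: (@strand_span_unit _ _ _ _ s (extend_strand c s)) => //.
    exact: inW sc.
  exact: (ext x).
Qed.

End Expansion.

(** * Relations of L(E, w) *)

Section OutEdges.
Variable E : wgraph.
Hypothesis E_row_finite : row_finite E.

Lemma mem_out_seq (v : vertex E) e : (e \in out_seq v) = (src e == v).
Proof.
rewrite /out_seq in_fset_set ?mem_setE; last exact: E_row_finite.
by apply/asboolP/eqP.
Qed.

Lemma out_seq_uniq (v : vertex E) : uniq (out_seq v).
Proof. exact: fset_uniq. Qed.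

Lemma regularP (v : vertex E) : regular_vertex v <-> exists e, src e = v.
Proof.
split=> [reg|[e ev] sv]; last by have : set0 e by rewrite -[set0]sv.
by apply/not_existsP => no; apply: reg; apply/seteqP; split.
Qed.

Lemma leq_vweight (e : edge E) : (weight e <= vweight (src e))%N.
Proof.
by rewrite /vweight (big_rem e) ?mem_out_seq //= leq_maxl.
Qed.

Lemma vweight_attained (v : vertex E) : (0 < vweight v)%N ->
  exists2 e, src e = v & weight e = vweight v.
Proof.
rewrite /vweight; have : {subset out_seq v <= [pred e | src e == v]}.
  by move=> e; rewrite mem_out_seq.
elim: (out_seq v) => [|e s IH] sv; first by rewrite big_nil.
have ev : src e = v by exact/eqP/(sv e)/mem_head.
have {}IH := IH (fun f fs => sv f (mem_behead (s := e :: s) fs)).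
rewrite big_cons /maxn; case: ifP => [_|_ _]; [exact: IH|by exists e].
Qed.

End OutEdges.

Section Relations.
Variables (K : fieldType) (E : wgraph).
Local Notation L := (wLPA K E).

Definition lpaV (v : vertex E) : L := lpa_class (tvertex K v).
Definition lpaE (e : edge E) i : L := lpa_class (tedge K e i).
Definition lpaG (e : edge E) i : L := lpa_class (tghost K e i).

Lemma lpa_class0 : lpa_class TZero = 0 :> L.
Proof. by []. Qed.

Lemma lpa_classMul (x y : lpa_term K E) :
  lpa_class (TMul x y) = lpa_class x ** lpa_class y.
Proof. exact/esym/lpa_classM. Qed.

Lemma lpa_classAdd (x y : lpa_term K E) :
  lpa_class (TAdd x y) = lpa_class x + lpa_class y :> L.
Proof. exact/esym/lpa_classD. Qed.

Lemma lpa_classOpp (x : lpa_term K E) : lpa_class (TOpp x) = - lpa_class x :> L.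
Proof. exact/esym/lpa_classN. Qed.

Lemma lpa_classScale a (x : lpa_term K E) :
  lpa_class (TScale a x) = a *: lpa_class x :> L.
Proof. exact/esym/lpa_classZ. Qed.

Lemma lpa_class_sum I (r : seq I) (F : I -> lpa_term K E) :
  lpa_class (\big[@TAdd K E/TZero]_(i <- r) F i) = \sum_(i <- r) lpa_class (F i) :> L.
Proof. exact: (big_morph _ lpa_classAdd lpa_class0). Qed.

Lemma tedge_ge (e : edge E) i : (weight e <= i)%N -> tedge K e i = TZero.
Proof. by move=> ei; rewrite /tedge insubF // ltnNge ei. Qed.

Lemma tghost_ge (e : edge E) i : (weight e <= i)%N -> tghost K e i = TZero.
Proof. by move=> ei; rewrite /tghost insubF // ltnNge ei. Qed.

Lemma lpaE_ge (e : edge E) i : (weight e <= i)%N -> lpaE e i = 0.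
Proof. by move=> ei; rewrite /lpaE tedge_ge. Qed.

Lemma lpaG_ge (e : edge E) i : (weight e <= i)%N -> lpaG e i = 0.
Proof. by move=> ei; rewrite /lpaG tghost_ge. Qed.

Lemma lpaVV u v : lpaV u ** lpaV v = if u == v then lpaV u else 0.
Proof.
rewrite -lpa_classMul; have /lpa_classP -> := lc_vertex K u v.
by case: ifP.
Qed.

Lemma lpaV_idem v : lpaV v ** lpaV v = lpaV v.
Proof. by rewrite lpaVV eqxx. Qed.

Lemma lpaVE e i : lpaV (src e) ** lpaE e i = lpaE e i.
Proof.
case: (ltnP i (weight e)) => ei; last by rewrite lpaE_ge // numul0r.
by rewrite -lpa_classMul; apply/lpa_classP; exact: lc_src_edge.
Qed.

Lemma lpaEV e i : lpaE e i ** lpaV (tgt e) = lpaE e i.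
Proof.
case: (ltnP i (weight e)) => ei; last by rewrite lpaE_ge // numul0l.
by rewrite -lpa_classMul; apply/lpa_classP; exact: lc_edge_tgt.
Qed.

Lemma lpaVG e i : lpaV (tgt e) ** lpaG e i = lpaG e i.
Proof.
case: (ltnP i (weight e)) => ei; last by rewrite lpaG_ge // numul0r.
by rewrite -lpa_classMul; apply/lpa_classP; exact: lc_tgt_ghost.
Qed.

Lemma lpaGV e i : lpaG e i ** lpaV (src e) = lpaG e i.
Proof.
case: (ltnP i (weight e)) => ei; last by rewrite lpaG_ge // numul0l.
by rewrite -lpa_classMul; apply/lpa_classP; exact: lc_ghost_src.
Qed.

Hypothesis E_row_finite : row_finite E.

Lemma lpaEG v i j : (i < vweight v)%N -> (j < vweight v)%N ->
  \sum_(e <- out_seq v) lpaE e i ** lpaG e j = if i == j then lpaV v else 0.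
Proof.
move=> iv jv; have [e ev _] := vweight_attained E_row_finite (leq_ltn_trans (leq0n _) iv).
have vreg : regular_vertex v by apply/regularP; exists e.
have /lpa_classP := lc_edge_ghost K vreg iv jv; rewrite lpa_class_sum.
under eq_bigr do rewrite lpa_classMul.
by move=> ->; case: ifP.
Qed.

Lemma lpaGE e f : src e = src f ->
  \sum_(i < vweight (src e)) lpaG e i ** lpaE f i =
    if e == f then lpaV (tgt e) else 0.
Proof.
move=> ef; have vreg : regular_vertex (src e) by apply/regularP; exists e.
have /lpa_classP := lc_ghost_edge K vreg erefl (esym ef).
rewrite big_mkord lpa_class_sum.
under eq_bigr do rewrite lpa_classMul.
by move=> ->; case: ifP.
Qed.

Lemma lpaGE_diag e :
  \sum_(i <- iota 0 (weight e)) lpaG e i ** lpaE e i = lpaV (tgt e).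
Proof.
have := lpaGE (erefl (src e)); rewrite eqxx => <-.
rewrite -(big_mkord xpredT (fun i => lpaG e i ** lpaE e i)).
rewrite (big_cat_nat (leq0n _) (leq_vweight E_row_finite e)) /=.
rewrite [X in _ = _ + X]big_nat [X in _ = _ + X]big1 ?addr0 => [|i /andP[ei _]].
  by rewrite /index_iota subn0.
by rewrite lpaE_ge // numul0r.
Qed.

Lemma lpaGE_first e f : src e = src f -> unweighted_edge e \/ unweighted_edge f ->
  lpaG e 0 ** lpaE f 0 = if e == f then lpaV (tgt e) else 0.
Proof.
move=> ef u; rewrite -lpaGE //.
have v0 : (0 < vweight (src e))%N.
  exact: leq_trans (weight_gt0 e) (leq_vweight E_row_finite e).
rewrite (bigD1 (Ordinal v0)) //= big1 ?addr0 // => i i0.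
have {}i0 : (0 < i)%N by rewrite lt0n.
by case: u => u; [rewrite lpaG_ge ?u // numul0l|rewrite lpaE_ge ?u // numul0r].
Qed.

Hypothesis L1 : LPA1 E.

(** By (LPA1) the other edges at [src f] are unweighted and have only the component 0. As i and j
    are not both 0, each of them contributes 0 to the relation, and one term remains. *)
Lemma lpaEG_diag f i j : weighted_edge f -> (i < weight f)%N -> (j < weight f)%N ->
  (0 < i + j)%N -> lpaE f i ** lpaG f j = if i == j then lpaV (src f) else 0.
Proof.
move=> wf fi fj ij; have fv := leq_vweight E_row_finite f.
rewrite -lpaEG ?(leq_trans _ fv) // (bigD1_seq f) ?mem_out_seq ?out_seq_uniq //=.
rewrite big_seq_cond big1 ?addr0 // => e; rewrite mem_out_seq //.
move=> /andP[/eqP ev ef]; have /weightedPn ue : ~ weighted_edge e.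
  by move=> we; move/eqP: ef; apply; exact: L1.
move: ij; rewrite addn_gt0 => /orP[i0|j0].
  by rewrite lpaE_ge ?ue // numul0l.
by rewrite lpaG_ge ?ue // numul0r.
Qed.

Lemma lpaEG_sole f : (forall e, src e = src f -> e = f) ->
  lpaE f 0 ** lpaG f 0 = lpaV (src f).
Proof.
move=> sole; have v0 : (0 < vweight (src f))%N.
  exact: leq_trans (weight_gt0 f) (leq_vweight E_row_finite f).
have := lpaEG v0 v0; rewrite eqxx => <-.
rewrite (bigD1_seq f) ?mem_out_seq ?out_seq_uniq //=.
rewrite big_seq_cond big1 ?addr0 // => e; rewrite mem_out_seq //.
by move=> /andP[/eqP /sole ->]; rewrite eqxx.
Qed.

Lemma lpaEG0_sum v : regular_vertex v ->
  \sum_(e <- out_seq v) lpaE e 0 ** lpaG e 0 = lpaV v.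
Proof.
move=> /regularP[e <-]; have v0 : (0 < vweight (src e))%N.
  exact: leq_trans (weight_gt0 e) (leq_vweight E_row_finite e).
by rewrite (lpaEG v0 v0) eqxx.
Qed.

(** Expand [tgt e] on the right of the first component by [lpaGE_diag]: all terms but the first
    vanish by [lpaEG_diag]. So the first component is a partial isometry even though neither of its
    idempotents need be a vertex. *)
Lemma lpaEGE e : lpaE e 0 ** lpaG e 0 ** lpaE e 0 = lpaE e 0.
Proof.
rewrite -[RHS]lpaEV -lpaGE_diag numul_sumr.
have := weight_gt0 e; case Ew : (weight e) => [//|n] _ /=.
rewrite big_cons numulA big_seq big1 ?addr0 // => i.
rewrite mem_iota add1n => /andP[i0 ie].
have we : weighted_edge e by rewrite /weighted_edge Ew; exact: leq_ltn_trans ie.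
rewrite numulA lpaEG_diag ?add0n ?Ew //.
by rewrite eq_sym gtn_eqF // numul0l.
Qed.

Lemma lpaGEG e : lpaG e 0 ** lpaE e 0 ** lpaG e 0 = lpaG e 0.
Proof.
rewrite -[RHS]lpaVG -lpaGE_diag numul_suml.
have := weight_gt0 e; case Ew : (weight e) => [//|n] _ /=.
rewrite big_cons big_seq big1 ?addr0 // => i.
rewrite mem_iota add1n => /andP[i0 ie].
have we : weighted_edge e by rewrite /weighted_edge Ew; exact: leq_ltn_trans ie.
rewrite -numulA lpaEG_diag ?addn0 ?Ew //.
by rewrite gtn_eqF // numul0r.
Qed.

End Relations.

(** * Well-behaved acyclic graphs *)

Section WellBehavedAlgebra.
Variables (K : fieldType) (E : wgraph).
Hypothesis E_row_finite : row_finite E.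
Hypothesis Eac : acyclic E.
Hypotheses (L1 : LPA1 E) (L2 : LPA2 E) (L3 : LPA3 E) (W : W2 E).

Local Notation T := (tree (@weighted_targets E)).
Local Notation V := (lpaV K).
Local Notation X := (lpaE K).
Local Notation G := (lpaG K).
Local Notation node := (vertex E + edge E)%type.

(* [inr f] is the part of [src f] carried by the first component of a weighted
   edge [f]. *)
Definition node_idem (x : node) : wLPA K E :=
  match x with inl v => V v | inr f => X f 0 ** G f 0 end.

Local Notation strand := (node * wLPA K E * wLPA K E)%type.

(** The node carrying g_i g_i^*. This is all of [src g] for i > 0, and also for i = 0 when [src g]
    lies in T, where (LPA2) makes g the only edge. The remaining case is a proper node [inr g]. *)
Definition rev_source (g : edge E) (i : nat) : node :=
  if (i == 0)%N && ~~ `[< T (src g) >] then inr g else inl (src g).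

Definition rev_strand (g : edge E) i : strand := (rev_source g i, G g i, X g i).

(** A weighted edge is not followed to its target: its part of the source is kept as the terminal
    node [inr e]. *)
Definition out_strand (e : edge E) : strand :=
  if weight e == 1%N then (inl (tgt e), X e 0, G e 0)
  else (inr e, node_idem (inr e), node_idem (inr e)).

Definition children (x : node) : seq strand :=
  match x with
  | inl v =>
    if pselect (exists2 g, rev_edge g & tgt g = v) is left h then
      let g := s2val (cid2 h) in [seq rev_strand g i | i <- iota 0 (weight g)]
    else [seq out_strand e | e <- out_seq v]
  | inr _ => [::]
  end.

Definition expandable (x : node) : Prop :=
  if x is inl v then T v \/ regular_vertex v else False.

Lemma children_rev g : rev_edge g ->
  children (inl (tgt g)) = [seq rev_strand g i | i <- iota 0 (weight g)].
Proof.
move=> rg /=; case: pselect => [h|[]]; last by exists g.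
have gE : s2val (cid2 h) = g.
  by apply: rev_edge_inj => //; [exact: (s2valP (cid2 h))|exact: (s2valP' (cid2 h))].
by rewrite gE.
Qed.

Lemma children_out v : ~ T v -> children (inl v) = [seq out_strand e | e <- out_seq v].
Proof.
move=> Tv /=; case: pselect => // -[g rg gv]; have Tg := rev_tgt rg.
by case: Tv; rewrite -gv.
Qed.

Lemma expandable_cases (Q : node -> Prop) :
  (forall g, rev_edge g -> Q (inl (tgt g))) ->
  (forall v, ~ T v -> regular_vertex v -> Q (inl v)) ->
  forall x, expandable x -> Q x.
Proof.
move=> Qg Qv [v|//] /= ev; have [Tv|Tv] := pselect (T v).
  by have [g rg <-] := tree_rev Tv; exact: Qg.
by case: ev => // rv; exact: Qv.
Qed.

Lemma rev_strand_idem (g : edge E) i : rev_edge g -> (i < weight g)%N ->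
  X g i ** G g i = node_idem (rev_source g i).
Proof.
move=> rg ig; rewrite /rev_source; case: eqP => [->|/eqP i0] /=.
  case: asboolP => //= Tg; apply: lpaEG_sole => // e ev.
  exact: (L2 Tg).
rewrite lpaEG_diag ?eqxx //; last by rewrite addn_gt0 lt0n i0.
by rewrite /weighted_edge; apply: leq_ltn_trans ig; rewrite lt0n.
Qed.

Lemma node_idem_idem x : node_idem x ** node_idem x = node_idem x.
Proof.
case: x => [v|f] /=; first exact: lpaV_idem.
by rewrite numulA lpaEGE.
Qed.

Lemma rev_strand_unit (g : edge E) i : G g i ** node_idem (rev_source g i) = G g i.
Proof.
rewrite /rev_source; case: ifP => [/andP[/eqP -> _]|_] /=; last exact: lpaGV.
by rewrite numulA lpaGEG.
Qed.

Lemma unit_rev_strand (g : edge E) i : node_idem (rev_source g i) ** X g i = X g i.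
Proof.
rewrite /rev_source; case: ifP => [/andP[/eqP -> _]|_] /=; last exact: lpaVE.
by rewrite lpaEGE.
Qed.

Lemma rev_strand_orth (g : edge E) i j : (i < weight g)%N -> (j < weight g)%N -> i != j ->
  X g i ** G g j = 0.
Proof.
move=> ig jg ij; have ij0 : (0 < i + j)%N.
  by rewrite lt0n addn_eq0; apply: contra ij => /andP[/eqP -> /eqP ->].
rewrite lpaEG_diag ?(negPf ij) // /weighted_edge.
by move: ij0; rewrite addn_gt0 => /orP[] h; exact: leq_ltn_trans h _.
Qed.

Lemma out_strand_orth e f : src e = src f -> e != f ->
  (out_strand e).2 ** (out_strand f).1.2 = 0.
Proof.
move=> ef nef; rewrite /out_strand.
have GX : ~ weighted_edge e \/ ~ weighted_edge f -> G e 0 ** X f 0 = 0.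
  move=> u; rewrite lpaGE_first // ?(negPf nef) //.
  by case: u => /weightedPn u; [left|right].
case: eqP => [e1|e1]; case: eqP => [f1|f1] /=.
- by apply: GX; left; exact: unweighted_not_weighted.
- by rewrite numulA GX ?numul0l //; left; exact: unweighted_not_weighted.
- by rewrite -numulA GX ?numul0r //; right; exact: unweighted_not_weighted.
- have [we|we] := pselect (weighted_edge e).
    have [wf|/weightedPn//] := pselect (weighted_edge f).
    by case/eqP: nef; exact: L1.
  by case: e1; exact: weightedPn.
Qed.

Lemma children_isometric x : expandable x -> isometric_strands node_idem (children x).
Proof.
move: x; apply: expandable_cases => [g rg|v Tv rv].
  rewrite children_rev //; split.
    rewrite pairwise_map; have := iota_uniq 0 (weight g); rewrite uniq_pairwise.
    apply: (sub_in_pairwise _ (allss _)) => i j; rewrite !mem_iota => ig jg /= ij.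
    by rewrite /orthogonal_strands /= !rev_strand_orth ?eqxx // eq_sym.
  move=> s /mapP[i]; rewrite mem_iota => ig -> /=.
  by rewrite rev_strand_idem // rev_strand_unit.
rewrite children_out //; split.
  rewrite pairwise_map; have := out_seq_uniq v; rewrite uniq_pairwise.
  apply: (sub_in_pairwise _ (allss _)) => e f; rewrite !mem_out_seq //.
  move=> /eqP ev /eqP fv ef.
  by apply/andP; split; apply/eqP; apply: out_strand_orth; rewrite ?ev ?fv // eq_sym.
move=> s /mapP[e _ ->]; rewrite /out_strand; case: eqP => [e1|_] /=.
  by rewrite lpaGE_first // ?eqxx ?lpaEV //; left.
by rewrite !numulA lpaEGE.
Qed.

Lemma children_sum x : expandable x ->
  \sum_(c <- children x) c.1.2 ** c.2 = node_idem x.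
Proof.
move: x; apply: expandable_cases => [g rg|v Tv rv].
  by rewrite children_rev // big_map lpaGE_diag.
rewrite children_out // big_map /= -lpaEG0_sum //.
apply: eq_bigr => e _; rewrite /out_strand; case: eqP => [//|_] /=.
by rewrite numulA lpaEGE.
Qed.

Lemma children_corner x c : expandable x -> c \in children x ->
  [/\ node_idem x ** c.1.2 = c.1.2, node_idem c.1.1 ** c.2 = c.2 &
      c.2 ** node_idem x = c.2].
Proof.
move=> ex; move: x ex c; apply: expandable_cases => [g rg|v Tv rv] c.
  rewrite children_rev // => /mapP[i _ ->] /=.
  by rewrite lpaVG unit_rev_strand lpaEV.
rewrite children_out // => /mapP[e]; rewrite mem_out_seq // => /eqP <- ->.
rewrite /out_strand; case: eqP => [e1|_] /=.
  by rewrite lpaVE lpaVG lpaGV.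
split; first by rewrite numulA lpaVE.
  by rewrite numulA lpaEGE.
by rewrite -numulA lpaGV.
Qed.

Lemma child_flow x y : child children x y ->
  exists2 v, x = inl v & forall u, y = inl u -> flow_step v u.
Proof.
move=> [c]; case: x => [v|//] cx cy; exists v => // u yu.
have cu : c.1.1 = inl u by rewrite cy.
have [Tv|Tv] := pselect (T v).
  have [g rg gv] := tree_rev Tv; move: cx; rewrite -gv children_rev //.
  move=> /mapP[i _ cE]; move: cu; rewrite cE /= /rev_source.
  by case: ifP => // _ [<-]; right; exists g.
move: cx; rewrite children_out // => /mapP[e]; rewrite mem_out_seq // => /eqP ev cE.
move: cu; rewrite cE /out_strand; case: eqP => // e1 /= [<-]; left; split=> //.
by exists e.
Qed.

Lemma child_acyclic x : ~ clos_trans _ (child children) x x.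
Proof.
have sink f y : ~ clos_trans _ (child children) (inr f) y.
  by move=> fy; case: (clos_trans_t1n _ _ _ _ fy) => [z|z t] /child_flow[].
have flow v y : clos_trans _ (child children) (inl v) y ->
    forall u, y = inl u -> clos_trans _ (@flow_step E) v u.
  move=> vy; elim: {y vy}(clos_trans_tn1 _ _ _ _ vy) => [y vy|y z yz vy IH] u zu.
    by have [_ [<-] st] := child_flow vy; apply: t_step; exact: st.
  have [w yw st] := child_flow yz.
  by apply: t_trans (IH _ yw) _; apply: t_step; exact: st.
case: x => [v|f]; last exact: sink.
by move=> /flow /(_ _ erefl); exact: flow_acyclic.
Qed.

Lemma finite_span (Vs : seq (vertex E)) (Es : seq (edge E)) :
  exists S, [/\ isometric_strands node_idem S,
    forall v, v \in Vs -> strand_span S (V v) &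
    forall e i, e \in Es -> (i < weight e)%N ->
      strand_span S (X e i) /\ strand_span S (G e i)].
Proof.
pose U := undup (map inl (Vs ++ map (@src E) Es ++ map (@tgt E) Es)) : seq node.
have [||S [SO SV SE SX]] := @finite_resolution _ _ _ _ _ _ node_idem_idem
   children_isometric children_sum children_corner child_acyclic U.
- exact: undup_uniq.
- move=> x y; rewrite !mem_undup => /mapP[u _ ->] /mapP[v _ ->] uv /=.
  by rewrite lpaVV; case: ifP => // /eqP e; rewrite e eqxx in uv.
exists S; split=> // [v vV|e i eE ie].
  by apply: (SV (inl v)); rewrite mem_undup map_f // mem_cat vV.
have sU : inl (src e) \in U.
  by rewrite mem_undup map_f // !mem_cat (map_f (@src E)) ?orbT.
have tU : inl (tgt e) \in U.
  by rewrite mem_undup map_f // !mem_cat (map_f (@tgt E)) ?orbT.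
have se : regular_vertex (src e) by apply/regularP; exists e.
have [rev_e|rev_e] := pselect (rev_edge e); last first.
  have Te : ~ T (src e) by move=> Te; apply: rev_e; right.
  have ue : unweighted_edge e by apply: weightedPn => we; apply: rev_e; left.
  move: ie; rewrite ue ltnS leqn0 => /eqP ->.
  have ce : (inl (tgt e), X e 0, G e 0) \in children (inl (src e)).
    rewrite children_out //; apply/mapP; exists e; rewrite ?mem_out_seq //.
    by rewrite /out_strand ue.
  by apply: (SX (inl (src e)) _ sU _ ce) => //=; right.
have ce : rev_strand e i \in children (inl (tgt e)).
  by rewrite children_rev //; apply: map_f; rewrite mem_iota.
have Tt : expandable (inl (tgt e)) by left; exact: rev_tgt.
have [/andP[/eqP i0 /asboolPn Te]|iN] := boolP ((i == 0)%N && ~~ `[< T (src e) >]);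
  last first.
  have [] := SX _ _ tU Tt ce => //.
  by rewrite /rev_strand /rev_source (negPf iN).
have we : weighted_edge e by case: rev_e.
(* The first component of e joins two children that end in the same node [inr e]: the part e e^* of
   [src e] and the strand e^* of [tgt e]. Hence it lies in the span although [inr e] is not in U. *)
have ce' : (inr e, node_idem (inr e), node_idem (inr e)) \in children (inl (src e)).
  rewrite children_out //; apply/mapP; exists e; rewrite ?mem_out_seq //.
  by rewrite /out_strand gtn_eqF.
have es : expandable (inl (src e)) by right.
have ee : (rev_strand e i).1.1 = inr e by rewrite /= /rev_source i0 eqxx /=;
  case: asboolP.
split.
  have -> : X e i = node_idem (inr e) ** X e i by rewrite i0 /= lpaEGE.
  exact: (SE _ _ _ _ sU tU es Tt ce' ce (esym ee)).
have -> : G e i = G e i ** node_idem (inr e) by rewrite i0 /= numulA lpaGEG.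
exact: (SE _ _ _ _ tU sU Tt es ce ce' ee).
Qed.

Fixpoint term_vertices (x : lpa_term K E) : seq (vertex E) :=
  match x with
  | TGen (gen_vertex v) => [:: v]
  | TAdd x y | TMul x y => term_vertices x ++ term_vertices y
  | TOpp x | TScale _ x => term_vertices x
  | _ => [::]
  end.

Fixpoint term_edges (x : lpa_term K E) : seq (edge E) :=
  match x with
  | TGen (gen_edge e _) | TGen (gen_ghost e _) => [:: e]
  | TAdd x y | TMul x y => term_edges x ++ term_edges y
  | TOpp x | TScale _ x => term_edges x
  | _ => [::]
  end.

Lemma well_behaved_locally_matricial : locally_matricial (wLPA K E).
Proof.
apply: locally_matricial_of_embeddings => s.
(* The sum t only serves to collect the generators that occur in representatives of s. *)
pose t := foldr (fun x y => TAdd (lpa_repr x) y) TZero s.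
have [S [SO SV SE]] := finite_span (term_vertices t) (term_edges t).
have [m [n [f [fP finj fS]]]] := strand_embedding SO.
exists m, n, f; split=> // x xs.
have {SV}SV v : v \in term_vertices t -> exists y, f y = V v by move=> /SV/fS.
have {SE}SE e i : e \in term_edges t -> (i < weight e)%N ->
    (exists y, f y = X e i) /\ (exists y, f y = G e i).
  by move=> et ei; have [/fS ? /fS ?] := SE _ _ et ei.
have im y : {subset term_vertices y <= term_vertices t} ->
    {subset term_edges y <= term_edges t} -> exists z, f z = lpa_class y.
  elim: y => [[v|e i|e i]||y IH|y IHy z IHz|a y IH|y IHy z IHz] /= yV yE.
  - by apply: SV; apply: yV; rewrite inE.
  - have [|[z zE] _] := SE e i _ (ltn_ord i); first by apply: yE; rewrite inE.
    by exists z; rewrite zE /lpaE /tedge valK.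
  - have [|_ [z zE]] := SE e i _ (ltn_ord i); first by apply: yE; rewrite inE.
    by exists z; rewrite zE /lpaG /tghost valK.
  - by exists 0; rewrite (nualg_hom0 fP).
  - by have [z zE] := IH yV yE; exists (- z); rewrite (nualg_homN fP) zE lpa_classOpp.
  - have [||y' y'E] := IHy.
    + by move=> v vy; apply: yV; rewrite mem_cat vy.
    + by move=> v vy; apply: yE; rewrite mem_cat vy.
    have [||z' z'E] := IHz.
    + by move=> v vy; apply: yV; rewrite mem_cat vy orbT.
    + by move=> v vy; apply: yE; rewrite mem_cat vy orbT.
    by exists (y' + z'); rewrite (nualg_homD fP) y'E z'E lpa_classAdd.
  - have [z zE] := IH yV yE; exists (a *: z).
    by rewrite (nualg_homZ fP) zE lpa_classScale.
  - have [||y' y'E] := IHy.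
    + by move=> v vy; apply: yV; rewrite mem_cat vy.
    + by move=> v vy; apply: yE; rewrite mem_cat vy.
    have [||z' z'E] := IHz.
    + by move=> v vy; apply: yV; rewrite mem_cat vy orbT.
    + by move=> v vy; apply: yE; rewrite mem_cat vy orbT.
    by exists (y' ** z'); rewrite (nualg_homM fP) y'E z'E lpa_classMul.
rewrite -(lpa_reprK x); apply: im => {SV SE S SO fS}; rewrite /t {t f m n fP finj}.
  elim: s xs => [//|z s IH]; rewrite inE => /predU1P[->|/IH xs] v vx /=.
    by rewrite mem_cat vx.
  by rewrite mem_cat xs ?orbT.
elim: s xs => [//|z s IH]; rewrite inE => /predU1P[->|/IH xs] v vx /=.
  by rewrite mem_cat vx.
by rewrite mem_cat xs ?orbT.
Qed.

End WellBehavedAlgebra.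

(** * Branching systems *)

(* The bijection is built from f and g alone, so that any relation implied by
   both [b = f a] and [a = g b] holds between a and its image. *)
Lemma schroeder_bernstein (A B : Type) (f : A -> B) (g : B -> A) :
  injective f -> injective g -> exists (h : A -> B) (k : B -> A),
    [/\ cancel h k, cancel k h & forall a, h a = f a \/ g (h a) = a].
Proof.
move=> finj ginj.
pose C a := exists n a0, a = iter n (fun a => g (f a)) a0 /\ forall b, g b <> a0.
have nC a : ~ C a -> exists b, g b = a.
  move=> Ca; apply: contrapT => nb; apply: Ca; exists 0%N, a.
  by split=> // b gb; apply: nb; exists b.
have /choice[h hP] : forall a, exists b, (C a -> b = f a) /\ (~ C a -> g b = a).
  move=> a.
  have [Ca|Ca] := pselect (C a); first by exists (f a).
  by have [b gb] := nC _ Ca; exists b.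
have CS a : C a -> C (g (f a)).
  by move=> [n [a0 [-> a0P]]]; exists n.+1, a0.
have hinj : injective h.
  move=> a a'; have [Ca|Ca] := pselect (C a); have [Ca'|Ca'] := pselect (C a').
  - by rewrite (hP a).1 // (hP a').1 // => /finj.
  - rewrite (hP a).1 // => fa; case: (Ca'); rewrite -((hP a').2 Ca') -fa.
    exact: CS.
  - rewrite (hP a').1 // => fa; case: (Ca); rewrite -((hP a).2 Ca) fa.
    exact: CS.
  - by move=> haa'; rewrite -((hP a).2 Ca) -((hP a').2 Ca') haa'.
have hsurj b : exists a, h a = b.
  have [Cb|Cb] := pselect (C (g b)); last first.
    by exists (g b); apply: ginj; exact: (hP _).2.
  have [[|n] [a0 [gb a0P]]] := Cb; first by case: (a0P b).
  move: gb; rewrite iterS => /ginj ->; exists (iter n (fun a => g (f a)) a0).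
  by apply: (hP _).1; exists n, a0.
have [k kP] := choice hsurj; exists h, k; split=> // [a|a].
  by apply: hinj; rewrite kP.
have [Ca|Ca] := pselect (C a); first by left; exact: (hP a).1.
by right; exact: (hP a).2.
Qed.

Section Branching.
Variable E : wgraph.
Hypothesis E_row_finite : row_finite E.
Local Notation D := (edge E * nat)%type.

(* A basis of the component at every vertex is indexed by nat. The basis element
   b at [tgt e] is mapped by the i-th component of e to the basis element a at
   [src e] when [br (e, b) = (a, i)], and the other components of e kill it. *)
Definition branching (br : D -> nat * nat) (rb : vertex E -> nat -> nat -> D) : Prop :=
  [/\ forall d, ((br d).2 < weight d.1)%N,
      forall d, rb (src d.1) (br d).1 (br d).2 = d &
      forall v a i, (i < vweight v)%N ->
        src (rb v a i).1 = v /\ br (rb v a i) = (a, i)].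

Definition partial_branching (s : seq (D * (nat * nat))) : Prop :=
  [/\ forall x, x \in s -> (x.2.2 < weight x.1.1)%N,
      forall x y, x \in s -> y \in s -> x.1 = y.1 -> x.2 = y.2 &
      forall x y, x \in s -> y \in s -> src x.1.1 = src y.1.1 -> x.2 = y.2 ->
        x.1 = y.1].

(** Two injections extend s. New elements are sent by f to level 0, which every edge has, and by g
    to an edge of maximal weight, which has every level. At each point the bijection agrees with f
    or with the inverse of g, so it respects s, the sources and the weights. *)
Lemma extend_branching s : partial_branching s -> inhabited D ->
  exists br rb, branching br rb /\ forall x, x \in s -> br x.1 = x.2.
Proof.
move=> [s1 s2 s3] [d0].
pose C := {c : vertex E * nat * nat | (c.2 < vweight c.1.1)%N}.
have wD d : (0 < vweight (src (d : D).1))%N.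
  exact: leq_trans (weight_gt0 d.1) (leq_vweight E_row_finite d.1).
(* New basis indices start above all those occurring in s, so that f and g stay injective. *)
pose M := (\max_(x <- s) x.2.1).+1; pose M' := (\max_(x <- s) x.1.2).+1.
have ltM x : x \in s -> (x.2.1 < M)%N.
  by move=> xs; rewrite ltnS (big_rem x) //= leq_maxl.
have ltM' x : x \in s -> (x.1.2 < M')%N.
  by move=> xs; rewrite ltnS (big_rem x) //= leq_maxl.
have /choice[f fP] : forall d, exists c : C,
    (exists x, [/\ x \in s, x.1 = d & val c = (src d.1, x.2.1, x.2.2)]) \/
    ((forall x, x \in s -> x.1 <> d) /\
     val c = (src d.1, M + choice.pickle (index d.1 (out_seq (src d.1)), d.2), 0))%N.
  move=> d.
  have [[x [xs xd]]|no] := pselect (exists x, x \in s /\ x.1 = d).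
    have xP : (x.2.2 < vweight (src d.1))%N.
      by rewrite -xd; exact: leq_trans (s1 _ xs) (leq_vweight E_row_finite _).
    by exists (exist _ (src d.1, x.2.1, x.2.2) xP : C); left; exists x.
  pose a := (M + choice.pickle (index d.1 (out_seq (src d.1)), d.2))%N.
  exists (exist _ (src d.1, a, 0)%N (wD d) : C).
  by right; split=> // x xs xd; apply: no; exists x.
have /choice[g gP] : forall c : C, exists d : D,
    (exists x, [/\ x \in s, d = x.1, src x.1.1 = (val c).1.1
       & x.2 = ((val c).1.2, (val c).2)]) \/
    [/\ forall x, x \in s -> src x.1.1 = (val c).1.1 ->
          x.2 <> ((val c).1.2, (val c).2),
        d.2 = (M' + choice.pickle ((val c).1.2, (val c).2))%N,
        src d.1 = (val c).1.1 & weight d.1 = vweight (val c).1.1].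
  move=> c.
  have [[x [xs xc1 xc2]]|no] := pselect (exists x, [/\ x \in s,
      src x.1.1 = (val c).1.1 & x.2 = ((val c).1.2, (val c).2)]).
    by exists x.1; left; exists x.
  have [e ev ew] := vweight_attained E_row_finite (leq_ltn_trans (leq0n _) (valP c)).
  exists (e, M' + choice.pickle ((val c).1.2, (val c).2))%N; right.
  by split=> // x xs xc1 xc2; apply: no; exists x.
have finj : injective f.
  move=> d d' fdd'; have := congr1 val fdd'.
  have [[x [xs <- ->]]|[nx ->]] := fP d; have [[y [ys <- ->]]|[ny ->]] := fP d'.
  - move=> [xy1 xy2 xy3]; apply: s3 => //.
    by rewrite [x.2]surjective_pairing xy2 xy3 -surjective_pairing.
  - by move=> [_ xM _]; have := ltM _ xs; rewrite xM ltnNge leq_addr.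
  - by move=> [_ yM _]; have := ltM _ ys; rewrite -yM ltnNge leq_addr.
  - move=> [dd' /addnI /(pcan_inj choice.pickleK)[ii bb]].
    apply: injective_projections => //.
    have de : d.1 \in out_seq (src d.1) by rewrite mem_out_seq.
    have d'e : d'.1 \in out_seq (src d'.1) by rewrite mem_out_seq.
    by rewrite -(nth_index d.1 de) ii dd' nth_index.
have ginj : injective g.
  move=> c c' gcc'; have cE (c1 : C) : val c1 = ((val c1).1.1, (val c1).1.2, (val c1).2).
    by case: (val c1) => -[].
  apply: val_inj.
  have [[x [xs gx xc1 xc2]]|[nx gx xc1 xc2]] := gP c;
    have [[y [ys gy yc1 yc2]]|[ny gy yc1 yc2]] := gP c'.
  - have xy : x.1 = y.1 by rewrite -gx -gy.
    have := s2 _ _ xs ys xy; rewrite xc2 yc2 => -[e1 e2].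
    by rewrite cE [RHS]cE e1 e2 -xc1 -yc1 xy.
  - by have := ltM' _ xs; rewrite -gx gcc' gy ltnNge leq_addr.
  - by have := ltM' _ ys; rewrite -gy -gcc' gx ltnNge leq_addr.
  - move: gy; rewrite -gcc' gx => /addnI /(pcan_inj choice.pickleK)[e1 e2].
    by rewrite cE [RHS]cE e1 e2 -xc1 -yc1 gcc'.
have [h [k [hK kK hP]]] := schroeder_bernstein finj ginj.
have hsrc d : (val (h d)).1.1 = src d.1.
  have [->|] := hP d; first by have [[x [_ _ ->]]|[_ ->]] := fP d.
  by have [[x [_ -> <- _]]|[_ _ <- _]] := gP (h d) => ->.
exists (fun d => ((val (h d)).1.2, (val (h d)).2)).
exists (fun v a i => if insub (v, a, i) is Some c then k c else d0).
split; [split|].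
- move=> d /=; have [->|ghd] := hP d.
    have [[x [xs xd ->]]|[_ -> /=]] := fP d; last exact: weight_gt0.
    by rewrite -xd; exact: s1.
  rewrite -{2}ghd; have [[x [xs -> _ xc]]|[_ _ _ ->]] := gP (h d); last first.
    exact: (valP (h d)).
  by have := s1 _ xs; rewrite xc.
- move=> d /=; rewrite -hsrc.
  have -> : ((val (h d)).1.1, (val (h d)).1.2, (val (h d)).2) = val (h d).
    by case: (val _) => -[].
  by rewrite valK hK.
- move=> v a i iv; rewrite insubT /=; set c : C := Sub _ _.
  by rewrite -hsrc kK.
move=> x xs /=.
have fx : val (f x.1) = (src x.1.1, x.2.1, x.2.2).
  have [[y [ys yx ->]]|[/(_ x xs)//]] := fP x.1.
  by rewrite (s2 _ _ ys xs yx).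
suff -> : h x.1 = f x.1 by rewrite fx -surjective_pairing.
have [//|ghx] := hP x.1; apply: ginj; rewrite ghx.
have [[y [ys -> yc1 yc2]]|[no _ _ _]] := gP (f x.1).
  by apply: s3; rewrite ?yc1 ?yc2 ?fx //= -surjective_pairing.
by case: (no x xs); rewrite fx //= -surjective_pairing.
Qed.

End Branching.

(** * Representations *)

Section Representations.
Variables (K : fieldType) (E : wgraph) (M : lmodType K).
Variable op : lpa_gen E -> M -> M.

Fixpoint ev (x : lpa_term K E) (f : M) : M :=
  match x with
  | TGen g => op g f
  | TZero => 0
  | TOpp x => - ev x f
  | TAdd x y => ev x f + ev y f
  | TScale a x => a *: ev x f
  | TMul x y => ev x (ev y f)
  end.

Definition representation : Prop :=
  [/\ forall g, linear (op g),
      forall u v f, op (gen_vertex u) (op (gen_vertex v) f) =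
        if u == v then op (gen_vertex u) f else 0,
      forall (e : edge E) (i : 'I_(weight e)) f,
        [/\ op (gen_vertex (src e)) (op (gen_edge i) f) = op (gen_edge i) f,
            op (gen_edge i) (op (gen_vertex (tgt e)) f) = op (gen_edge i) f,
            op (gen_vertex (tgt e)) (op (gen_ghost i) f) = op (gen_ghost i) f &
            op (gen_ghost i) (op (gen_vertex (src e)) f) = op (gen_ghost i) f],
      forall v i j f, (i < vweight v)%N -> (j < vweight v)%N ->
        \sum_(e <- out_seq v) ev (tedge K e i) (ev (tghost K e j) f) =
          if i == j then op (gen_vertex v) f else 0 &
      forall e e' f, src e = src e' ->
        \sum_(0 <= i < vweight (src e)) ev (tghost K e i) (ev (tedge K e' i) f) =
          if e == e' then op (gen_vertex (tgt e)) f else 0].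

Hypothesis opP : representation.

Lemma ev_linear x : linear (ev x).
Proof.
case: opP => op_lin _ _ _ _.
elim: x => [g||x IH|x IHx y IHy|b x IH|x IHx y IHy] a f g' /=.
- exact: op_lin.
- by rewrite scaler0 addr0.
- by rewrite IH opprD scalerN.
- by rewrite IHx IHy scalerDr addrACA.
- by rewrite IH scalerDr !scalerA mulrC.
- by rewrite IHy IHx.
Qed.

Lemma ev0 x : ev x 0 = 0.
Proof. by rewrite -[in LHS](subrr 0) -scaleN1r addrC ev_linear scaleN1r addNr. Qed.

Lemma evD x f g : ev x (f + g) = ev x f + ev x g.
Proof. by rewrite -[f]scale1r ev_linear !scale1r. Qed.

Lemma evZ x a f : ev x (a *: f) = a *: ev x f.
Proof. by rewrite -[a *: f]addr0 ev_linear ev0 addr0. Qed.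

Lemma ev_sum I (r : seq I) (F : I -> lpa_term K E) f :
  ev (\big[@TAdd K E/TZero]_(i <- r) F i) f = \sum_(i <- r) ev (F i) f.
Proof. by rewrite (big_morph (fun x => ev x f) (id1 := 0) (op1 := +%R)). Qed.

Lemma ev_cong x y : lpa_cong x y -> forall f, ev x f = ev y f.
Proof.
case: opP => _ opV opE opEG opGE; elim=> {x y} //=.
- by move=> x y z _ IH1 _ IH2 f; rewrite IH1 IH2.
- by move=> x y _ IH f; rewrite IH.
- by move=> x x' y y' _ IH1 _ IH2 f; rewrite IH1 IH2.
- by move=> a x y _ IH f; rewrite IH.
- by move=> x x' y y' _ IH1 _ IH2 f; rewrite IH1 IH2.
- by move=> x y z f; rewrite addrA.
- by move=> x y f; rewrite addrC.
- by move=> x f; rewrite add0r.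
- by move=> x f; rewrite addNr.
- by move=> a b x f; rewrite scalerA.
- by move=> x f; rewrite scale1r.
- by move=> a x y f; rewrite scalerDr.
- by move=> a b x f; rewrite scalerDl.
- by move=> x y z f; rewrite evD.
- by move=> a x y f; rewrite evZ.
- by move=> u v f; rewrite opV; case: ifP.
- move=> e i ei f; rewrite /tedge; case: insubP => [j _ _|]; last by rewrite ei.
  by have [] := opE e j f.
- move=> e i ei f; rewrite /tedge; case: insubP => [j _ _|]; last by rewrite ei.
  by have [] := opE e j f.
- move=> e i ei f; rewrite /tghost; case: insubP => [j _ _|]; last by rewrite ei.
  by have [] := opE e j f.
- move=> e i ei f; rewrite /tghost; case: insubP => [j _ _|]; last by rewrite ei.
  by have [] := opE e j f.
- by move=> v i j _ iv jv f; rewrite ev_sum opEG //; case: ifP.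
- move=> v e e' _ <- ee' f; rewrite ev_sum (opGE _ _ _ (esym ee')).
  by case: ifP.
Qed.

(* x y x f0 = x y (eps f1) = eps (x (y f1)). *)
Lemma regular_obstruction (eps : M -> M) (N : zmodType) (phi : M -> N)
    (x : lpa_term K E) (f0 f1 : M) :
  (forall g f, op g (eps f) = eps (op g f)) -> linear eps ->
  ev x f0 = eps f1 -> (forall f, phi (eps (ev x f)) = 0) -> phi (ev x f0) <> 0 ->
  ~ von_neumann_regular (wLPA K E).
Proof.
move=> op_eps eps_lin xf0 phix phixf0 reg.
have eps0 : eps 0 = 0.
  by rewrite -[in LHS](subrr 0) -scaleN1r addrC eps_lin scaleN1r addNr.
have epsD f g : eps (f + g) = eps f + eps g.
  by rewrite -[f]scale1r eps_lin !scale1r.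
have epsZ a f : eps (a *: f) = a *: eps f.
  by rewrite -[a *: f]addr0 eps_lin eps0 addr0.
have ev_eps y f : ev y (eps f) = eps (ev y f).
  elim: y f => [g||y IH|y IHy z IHz|a y IH|y IHy z IHz] f /=.
  - exact: op_eps.
  - by rewrite eps0.
  - by rewrite IH -!scaleN1r epsZ.
  - by rewrite IHy IHz epsD.
  - by rewrite IH epsZ.
  - by rewrite IHz IHy.
have [y yP] := reg (lpa_class x).
have xyx : lpa_cong (TMul (TMul x (lpa_repr y)) x) x.
  by apply/lpa_classP; rewrite !lpa_classMul lpa_reprK.
by apply: phixf0; rewrite -(ev_cong xyx) /= xf0 !ev_eps phix.
Qed.

End Representations.

(** * Deformed branching representations *)

Section BranchingRepresentation.
Variables (K : fieldType) (E : wgraph).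
Hypothesis E_row_finite : row_finite E.
Local Notation D := (edge E * nat)%type.
Variables (br : D -> nat * nat) (rb : vertex E -> nat -> nat -> D).
Hypothesis brP : branching br rb.
Variables d0 d1 : D.
Hypothesis src_d01 : src d0.1 = src d1.1.
(** The deformation gives a new action to the component [(br d1).2] of the edge of d0 and to the
    ghost component [(br d0).2] of the edge of d1; both components must exist. *)
Hypothesis level_d1 : ((br d1).2 < weight d0.1)%N.
Hypothesis level_d0 : ((br d0).2 < weight d1.1)%N.

(** The pair (a, b) stands for a + b eps in K[eps], and [eps] below is multiplication by eps. *)
Definition dual : Type := (K^o * K^o)%type.
HB.instance Definition _ := GRing.Lmodule.on dual.

Definition eps (x : dual) : dual := (0, x.1).

Lemma epsD x y : eps (x + y) = eps x + eps y.
Proof. exact: (congr1 (fun z : K => (z, x.1 + y.1)) (esym (addr0 0))). Qed.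

Lemma epsZ (a : K) x : eps (a *: x) = a *: eps x.
Proof. exact: (congr1 (fun z : K => (z, a * x.1)) (esym (mulr0 a))). Qed.

Lemma eps0 : eps 0 = 0.
Proof. by []. Qed.

Lemma epsN x : eps (- x) = - eps x.
Proof. by rewrite -!scaleN1r epsZ. Qed.

Lemma eps_eps x : eps (eps x) = 0.
Proof. by []. Qed.

Lemma eps_sum I (r : seq I) (P : pred I) (F : I -> dual) :
  eps (\sum_(i <- r | P i) F i) = \sum_(i <- r | P i) eps (F i).
Proof. exact: (big_morph _ epsD eps0). Qed.

Definition basis_fun : Type := (vertex E * nat)%type -> dual.
HB.instance Definition _ := GRing.Lmodule.on basis_fun.
Implicit Types f g : basis_fun.

Definition edge_in (e : edge E) f (d : D) : dual :=
  if d.1 == e then f (tgt e, d.2) else 0.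

Definition level_in (i : nat) f (d : D) : dual :=
  if (br d).2 == i then f (src d.1, (br d).1) else 0.

(** The edges at v identify the sum of the spaces at their targets, with coordinates d, with w(v)
    copies of the space at v, with coordinates (a, i). The identification by [br] is composed with 1
    + eps N, where N adds the coordinate d0 to the coordinate d1; [act_ghost] uses the inverse 1 -
    eps N. For d0 = d1 this rescales one coordinate by 1 + eps. *)
Definition act_edge (e : edge E) (i : nat) f : basis_fun := fun n =>
  if n.1 == src e then
    let d := rb n.1 n.2 i in
    edge_in e f d + (if d == d1 then eps (edge_in e f d0) else 0)
  else 0.

Definition act_ghost (e : edge E) (i : nat) f : basis_fun := fun n =>
  if n.1 == tgt e then
    level_in i f (e, n.2) - (if (e, n.2) == d1 then eps (level_in i f d0) else 0)
  else 0.

Definition act (g : lpa_gen E) : basis_fun -> basis_fun :=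
  match g with
  | gen_vertex v => fun f n => if n.1 == v then f n else 0
  | gen_edge e i => act_edge e i
  | gen_ghost e i => act_ghost e i
  end.

Local Notation ev := (@ev K E basis_fun act).

Lemma addfE f g n : (f + g) n = f n + g n. Proof. by []. Qed.
Lemma scalefE (a : K) f n : (a *: f) n = a *: f n. Proof. by []. Qed.
Lemma sumfE I (r : seq I) (F : I -> basis_fun) n :
  (\sum_(i <- r) F i) n = \sum_(i <- r) F i n.
Proof. by rewrite (big_morph (fun f : basis_fun => f n) (id1 := 0) (op1 := +%R)). Qed.

Lemma edge_in_linear e a f g d :
  edge_in e (a *: f + g) d = a *: edge_in e f d + edge_in e g d.
Proof. by rewrite /edge_in; case: ifP => // _; rewrite scaler0 addr0. Qed.

Lemma level_in_linear i a f g d :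
  level_in i (a *: f + g) d = a *: level_in i f d + level_in i g d.
Proof. by rewrite /level_in; case: ifP => // _; rewrite scaler0 addr0. Qed.

Lemma ev_tedge e i f : (i < vweight (src e))%N -> ev (tedge K e i) f = act_edge e i f.
Proof.
case: brP => br_lt _ rbP iv; rewrite /tedge; case: insubP => [j _ <- //|] /=.
rewrite -leqNgt => ei; apply/funext => n; rewrite /act_edge; case: eqP => // nE.
have [rsrc rbr] := rbP n.1 n.2 i (eq_rect_r (fun v => (i < vweight v)%N) iv nE).
have lt d : br d = (n.2, i) -> d.1 <> e.
  by move=> dE de; have := br_lt d; rewrite dE de ltnNge ei.
rewrite {1}/edge_in; case: eqP => [/(lt _ rbr)//|_]; rewrite add0r.
case: eqP => // rd1; rewrite /edge_in; case: eqP => // de.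
by have := level_d1; rewrite -rd1 rbr de ltnNge ei.
Qed.

Lemma ev_tghost e i f : ev (tghost K e i) f = act_ghost e i f.
Proof.
case: brP => br_lt _ rbP; rewrite /tghost; case: insubP => [j _ <- //|] /=.
rewrite -leqNgt => ei; apply/funext => n; rewrite /act_ghost; case: eqP => // nE.
rewrite {1}/level_in; case: eqP => [bi|_].
  by have := br_lt (e, n.2); rewrite bi ltnNge ei.
case: eqP => [d1E|_]; last by rewrite subr0.
rewrite /level_in; case: eqP => [bi|_]; last by rewrite subr0.
by have := level_d0; rewrite -d1E bi ltnNge ei.
Qed.

(** Relations (3) and (4) express that edges and ghosts are the coordinates of mutually inverse
    maps; the corrections of order eps cancel because eps^2 = 0, also for d0 = d1. *)
Lemma act_representation : representation act.
Proof.
case: (brP) => br_lt brK rbP; split.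
- case=> [v|e i|e i] a f g; apply/funext => n /=; rewrite !(addfE, scalefE) /=.
  + by case: ifP => // _; rewrite scaler0 addr0.
  + rewrite /act_edge; case: ifP => _; last by rewrite scaler0 addr0.
    rewrite /= !edge_in_linear; case: ifP => _; last by rewrite !addr0.
    by rewrite epsD epsZ scalerDr addrACA.
  + rewrite /act_ghost; case: ifP => _; last by rewrite scaler0 addr0.
    rewrite /= !level_in_linear; case: ifP => _; last by rewrite !subr0.
    by rewrite epsD epsZ opprD scalerBr addrACA.
- move=> u v f; apply/funext => n /=; case: (eqVneq u v) => [<-|uv] /=.
    by case: (n.1 == u).
  by case: eqP => // ->; rewrite (negPf uv).
- move=> e i f; split; apply/funext => n /=.
  + by rewrite /act_edge; case: (n.1 == src e).
  + by rewrite /act_edge /edge_in /= eqxx.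
  + by rewrite /act_ghost; case: (n.1 == tgt e).
  + rewrite /act_ghost /level_in /=.
    case: (n.1 == tgt e) => //; rewrite eqxx; case: ((e, n.2) =P d1) => // d1E.
    by rewrite src_d01 -d1E eqxx.
- move=> v i j f iv jv; apply/funext => n; rewrite sumfE.
  transitivity (if n.1 == v then level_in j f (rb n.1 n.2 i) else 0); last first.
    case: eqP => [nv|/eqP/negPf nv]; last by case: ifP => //= _; rewrite nv.
    have [rs rbr] := rbP n.1 n.2 i (eq_rect_r (fun v => (i < vweight v)%N) iv nv).
    rewrite /level_in rbr rs /=; case: ifP => //= _.
    by rewrite nv eqxx -nv -surjective_pairing.
  have sumin d : src d.1 = v ->
      \sum_(e <- out_seq v) edge_in e (act_ghost e j f) d =
      level_in j f d - (if d == d1 then eps (level_in j f d0) else 0).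
    move=> dv; rewrite (bigD1_seq d.1) ?mem_out_seq ?dv ?out_seq_uniq //=.
    rewrite big1 => [|e ed]; last by rewrite /edge_in eq_sym (negPf ed).
    by rewrite addr0 /edge_in eqxx /act_ghost /= eqxx -surjective_pairing.
  case: eqP => [nv|nv]; last first.
    rewrite big_seq big1 // => e; rewrite mem_out_seq // => /eqP ev.
    by rewrite ev_tedge ?ev // /act_edge ev; case: eqP.
  have [rs rbr] := rbP n.1 n.2 i (eq_rect_r (fun v => (i < vweight v)%N) iv nv).
  set d := rb n.1 n.2 i in rs rbr *.
  transitivity (\sum_(e <- out_seq v) (edge_in e (act_ghost e j f) d +
      (if d == d1 then eps (edge_in e (act_ghost e j f) d0) else 0))).
    apply: eq_big_seq => e; rewrite mem_out_seq // => /eqP ev.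
    by rewrite ev_tedge ?ev // ev_tghost /act_edge ev nv eqxx -nv.
  rewrite big_split /= sumin ?rs //; case: eqP => [dd1|_]; last first.
    by rewrite big1 // subr0 addr0.
  rewrite -eps_sum sumin ?src_d01 -?dd1 ?rs //.
  rewrite epsD; case: ifP => _; rewrite ?subr0 ?oppr0 ?eps0 ?addr0 ?subrK //.
  by rewrite epsN eps_eps oppr0 addr0 subrK.
- move=> e e' f ee'; apply/funext => n; rewrite sumfE.
  under eq_big_nat => i /andP[_ iv].
    rewrite ev_tghost ev_tedge -?ee' //; over.
  case: (eqVneq n.1 (tgt e)) => [ne|/negPf ne]; last first.
    by rewrite big1 => [|i _]; [case: ifP => //= _|]; rewrite /= ?/act_ghost ne.
  transitivity (edge_in e' f (e, n.2)).
    have sumin d : src d.1 = src e ->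
      \sum_(0 <= i < vweight (src e)) level_in i (act_edge e' i f) d =
      edge_in e' f d + (if d == d1 then eps (edge_in e' f d0) else 0).
      move=> de; have lt : ((br d).2 < vweight (src e))%N.
        by apply: leq_trans (br_lt d) _; rewrite -de; exact: leq_vweight.
      rewrite big_mkord (bigD1 (Ordinal lt)) //= big1 => [|i iN].
        by rewrite addr0 /level_in eqxx /act_edge /= de ee' eqxx -ee' -de brK.
      rewrite /level_in; case: eqP => // bi; case/eqP: iN.
      by apply: val_inj; rewrite /= bi.
    rewrite /act_ghost ne eqxx sumrB sumin //.
    case: eqP => [ed1|_]; last by rewrite big1 // addr0 subr0.
    rewrite -eps_sum sumin ?src_d01 -?ed1 // epsD.
    by case: ifP => _; rewrite ?eps_eps ?eps0 addr0 addrK.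
  rewrite /edge_in /=; case: ifP => [/eqP <-|//] /=.
  by rewrite ne eqxx -ne -surjective_pairing.
Qed.

Definition eps_fun f : basis_fun := fun n => eps (f n).

Lemma eps_fun_linear : linear eps_fun.
Proof. by move=> a f g; apply/funext => n; rewrite /eps_fun /= epsD epsZ. Qed.

Lemma act_eps (h : lpa_gen E) f : act h (eps_fun f) = eps_fun (act h f).
Proof.
apply/funext => n; case: h => [v|e i|e i] /=; rewrite /eps_fun.
- by case: ifP.
- rewrite /act_edge; case: ifP => // _; rewrite /edge_in /=.
  by rewrite epsD; congr (_ + _); [case: ifP|case: ifP => // _; case: ifP].
- rewrite /act_ghost; case: ifP => // _; rewrite /level_in /=.
  by rewrite epsD epsN; congr (_ - _); [case: ifP|case: ifP => // _; case: ifP].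
Qed.

Lemma branching_obstruction (x : lpa_term K E) f0 f1 n :
  ev x f0 = eps_fun f1 -> (forall f, eps (ev x f n) = 0) -> ev x f0 n <> 0 ->
  ~ von_neumann_regular (wLPA K E).
Proof.
exact: (@regular_obstruction K E _ act act_representation eps_fun dual
  (fun f => f n) x f0 f1 act_eps eps_fun_linear).
Qed.

End BranchingRepresentation.

(** * Two edges with a common source in a deformed representation *)

Section LocalActions.
Variables (K : fieldType) (E : wgraph).
Hypothesis E_row_finite : row_finite E.
Local Notation D := (edge E * nat)%type.
Variables (br : D -> nat * nat) (rb : vertex E -> nat -> nat -> D).
Hypothesis brP : branching br rb.
Local Notation M := (basis_fun K E).

Definition dirac (n : vertex E * nat) : M := fun m => if m == n then (1, 0) else 0.

Lemma diracE n : dirac n n = (1, 0). Proof. by rewrite /dirac eqxx. Qed.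

Lemma eps_one : eps ((1, 0) : dual K) <> 0.
Proof. by case=> /eqP; rewrite oner_eq0. Qed.

Lemma branching_inj (d d' : D) : src d.1 = src d'.1 -> br d = br d' -> d = d'.
Proof. by case: brP => _ brK _ dd' bb'; rewrite -(brK d) -(brK d') dd' bb'. Qed.

Lemma rbE v a i d : (i < vweight v)%N ->
  (rb v a i == d) = (v == src d.1) && (br d == (a, i)).
Proof.
case: brP => _ brK rbP iv; have [rs rbr] := rbP v a i iv.
apply/eqP/andP => [<-|[/eqP vd /eqP bd]]; first by rewrite rs rbr !eqxx.
by apply: branching_inj; rewrite ?rs // rbr.
Qed.

(* x = h_i^* z g_i, where z acts as the indicator of chi: the undeformed x kills
   the first basis vector at [tgt g], and its deformation does not. *)
Lemma crossing_obstruction (g h : edge E) i i0 z (chi : nat -> bool) :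
  g != h -> src g = src h -> (i < weight g)%N -> (i < weight h)%N -> (i0 < weight g)%N ->
  br (g, 0%N) = (0, i)%N -> br (h, 0%N) = (1, i0)%N ->
  (forall f n, ev (act (K := K) br rb (g, 0%N) (h, 0%N)) z f n =
     if (n.1 == src g) && chi n.2 then f n else 0) ->
  chi 0%N -> (i == i0) && chi 1%N = false ->
  ~ von_neumann_regular (wLPA K E).
Proof.
move=> gh sgh ig ih i0g brg brh zE chi0 chi1.
have iv : (i < vweight (src g))%N.
  exact: leq_trans ig (leq_vweight E_row_finite g).
pose d0 : D := (g, 0%N); pose d1 : D := (h, 0%N).
have lev1 : ((br d1).2 < weight d0.1)%N by rewrite brh.
have lev0 : ((br d0).2 < weight d1.1)%N by rewrite brg.
pose x := TMul (tghost K h i) (TMul z (tedge K g i)).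
pose f0 := dirac (tgt g, 0%N); pose n := (tgt h, 0%N).
(* The correction sits at basis index 1, the index of d1, and occurs only for i = i0; then z removes
   it by [chi1]. *)
have gf0 m : act_edge rb d0 d1 g i f0 m =
    dirac (src g, 0%N) m + (if (i == i0) && (m == (src g, 1%N)) then eps (1, 0) else 0).
  rewrite /act_edge; case: (eqVneq m.1 (src g)) => [mg|mg]; last first.
    rewrite /dirac; case: eqP => [m0|_]; first by rewrite m0 eqxx in mg.
    case: andP => [[_ /eqP m0]|]; last by rewrite add0r.
    by rewrite m0 eqxx in mg.
  have mv : (i < vweight m.1)%N by rewrite mg.
  have edge0 d : edge_in g f0 d = if d == d0 then (1, 0) else 0.
    rewrite /edge_in /f0 /dirac -pair_eqE /= /pair_eq /= eqxx /=.
    by case: d => d a; rewrite -pair_eqE /=; case: (d == g).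
  rewrite /= !edge0 eqxx !rbE // /d0 /d1 /= brg brh mg -sgh eqxx /= -!pair_eqE /=.
  rewrite /dirac {1}[m]surjective_pairing -!pair_eqE /= mg eqxx /= eqxx andbT.
  by rewrite eq_sym; congr (_ + _); rewrite andbC eq_sym (eq_sym 1%N).
have zgf0 : ev (act (K := K) br rb d0 d1) z (act_edge rb d0 d1 g i f0) =
    dirac (src g, 0%N).
  apply/funext => m; rewrite zE gf0 /dirac.
  case: (eqVneq m (src g, 0%N)) => [->|m0] /=.
    by rewrite eqxx chi0 -pair_eqE /= andbF andbF addr0.
  case: ifP => // /andP[/eqP mg chim]; rewrite add0r; case: andP => // -[ii0 /eqP m1].
  by move: chi1; rewrite ii0 -[1%N]/((src g, 1%N).2) -m1 chim.
have evx f m : ev (act (K := K) br rb d0 d1) x f m =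
    act_ghost br d0 d1 h i (ev (act (K := K) br rb d0 d1) z (act_edge rb d0 d1 g i f)) m.
  by rewrite /= (ev_tghost brP lev0) (ev_tedge brP lev1).
apply: (@branching_obstruction K E E_row_finite br rb brP d0 d1 sgh lev1 lev0 x f0
    (- dirac n) n).
- apply/funext => m; rewrite evx zgf0 /act_ghost /eps_fun.
  have -> : (- dirac n) m = - dirac n m by [].
  rewrite epsN.
  have -> : level_in br i (dirac (src g, 0%N)) d0 = (1, 0).
    by rewrite /level_in brg /= eqxx diracE.
  have -> : level_in br i (dirac (src g, 0%N)) (h, m.2) = 0.
    rewrite /level_in /dirac; case: eqP => // bi; case: eqP => // -[_ b0].
    have : (h, m.2) = (g, 0%N).
      by apply: branching_inj => //=; rewrite brg [br _]surjective_pairing bi b0.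
    by move=> [hg _]; case/eqP: gh.
  rewrite add0r /dirac /d1 /n [m]surjective_pairing -!pair_eqE /= eqxx /=.
  case: (m.1 == tgt h) => /=; last by rewrite eps0 oppr0.
  by case: (m.2 == 0%N); rewrite ?eps0.
- move=> f; rewrite evx /act_ghost eqxx epsD epsN.
  have -> : level_in br i (ev (act (K := K) br rb d0 d1) z
      (act_edge rb d0 d1 g i f)) (h, n.2) = 0.
    rewrite /level_in brh /= zE /= -sgh eqxx /=.
    by case: (eqVneq i0 i) chi1 => [<-|//] /= ->.
  by case: ifP; rewrite ?eps_eps ?eps0 ?oppr0 addr0.
- rewrite evx zgf0 /act_ghost eqxx /= eqxx.
  have -> : level_in br i (dirac (src g, 0%N)) d0 = (1, 0).
    by rewrite /level_in brg /= eqxx diracE.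
  rewrite /level_in brh /= /dirac -pair_eqE /= andbF if_same add0r => /eqP.
  by rewrite oppr_eq0 => /eqP; exact: eps_one.
Qed.

End LocalActions.

(** * Regularity implies (LPA1) and (LPA2) *)

Section RegularConditions.
Variables (K : fieldType) (E : wgraph).
Hypothesis E_row_finite : row_finite E.
Hypothesis reg : von_neumann_regular (wLPA K E).
Local Notation D := (edge E * nat)%type.

(** Two weighted edges both have a second component, so the levels i = 1 and i0 = 0 can be chosen
    distinct, and the vertex itself serves as z. *)
Lemma regular_LPA1 : LPA1 E.
Proof.
move=> g h wg wh sgh; apply: contrapT => /eqP gh.
pose s : seq (D * (nat * nat)) := [:: ((g, 0), (0, 1)); ((h, 0), (1, 0))]%N.
have [|br [rb [brP brs]]] := @extend_branching E E_row_finite s _ (inhabits (g, 0%N)).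
  split=> x.
  - by rewrite !inE => /orP[] /eqP -> /=; rewrite ?weight_gt0.
  - move=> y; rewrite !inE => /orP[] /eqP -> /orP[] /eqP -> //= [gh'].
      by rewrite gh' eqxx in gh.
    by rewrite gh' eqxx in gh.
  - by move=> y; rewrite !inE => /orP[] /eqP -> /orP[] /eqP -> //= _ [].
apply: (@crossing_obstruction K E E_row_finite br rb brP g h 1%N 0%N
  (tvertex K (src g)) xpredT gh sgh wg wh (weight_gt0 g)) reg => //.
- by apply: (brs (_, _)); rewrite inE eqxx.
- by apply: (brs (_, _)); rewrite !inE eqxx orbT.
- by move=> f n; rewrite andbT.
Qed.

Lemma mem_split (T : eqType) (x : T) s : x \in s -> exists s1 s2, s = s1 ++ x :: s2.
Proof. by move=> /splitPr[s1 s2]; exists s1, s2. Qed.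

Lemma walk_src_inj u s v (e f : edge E) : acyclic E -> walk u s v ->
  e \in s -> f \in s -> src e = src f -> e = f.
Proof.
move=> Eac; elim: s u => [//|a s IH] u [au sv]; rewrite !inE.
have loop b : b \in s -> src b <> src a.
  move=> bs ba; have [s1 [s2 sE]] := mem_split bs.
  move: sv; rewrite sE => /walk_catP[w [aw /= [bw _]]].
  suff : a :: s1 = [::] by [].
  by apply: (acyclic_walk Eac (u := src a)); split=> //; rewrite -ba bw.
move=> /predU1P[->|es] /predU1P[->|fs] ef //.
- by case: (loop _ fs).
- by case: (loop _ es).
- exact: IH sv es fs ef.
Qed.

Lemma walk_src_end u s v (e : edge E) : acyclic E -> walk u s v -> e \in s ->
  src e <> v.
Proof.
move=> Eac uv es ev; have [s1 [s2 sE]] := mem_split es.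
move: uv; rewrite sE => /walk_catP[w [_ ew]].
suff : e :: s2 = [::] by [].
by apply: (acyclic_walk Eac (u := src e)); case: ew => _ ew; split=> //; rewrite ev.
Qed.

(* [conjugate z s] is q^* z q, where q is the path s with all indices 0. *)
Definition conjugate (z : lpa_term K E) (s : seq (edge E)) : lpa_term K E :=
  foldl (fun z e => TMul (tghost K e 0) (TMul z (tedge K e 0))) z s.

Lemma conjugate_rcons z s e : conjugate z (rcons s e) =
  TMul (tghost K e 0) (TMul (conjugate z s) (tedge K e 0)).
Proof. by rewrite /conjugate -cats1 foldl_cat. Qed.

(** Here g and h may have only first components, which forces i = i0 = 0, so z must separate the
    basis indices 0 and 1 at v. The second component of the weighted edge e does this at [tgt e]: of
    these two indices it sees only 0. Conjugating by the first components along s carries the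
    separation to v. *)
Lemma regular_LPA2 : acyclic E -> LPA2 E.
Proof.
move=> Eac v /treeP[e [s [we esv]]] g h gv hv; apply: contrapT => /eqP gh.
have esv' : walk (src e) (e :: s) v by split.
(* Only the basis index 0 along e gets the second component; along s both indices are preserved at
   level 0. *)
pose lvl (y : edge E) b : nat := (y == e) && (b == 0)%N.
pose t : seq (D * (nat * nat)) :=
  [:: ((g, 0), (0, 0)); ((h, 0), (1, 0))]%N ++
  [seq ((y, 0), (0, lvl y 0))%N | y <- e :: s] ++
  [seq ((y, 1), (1, lvl y 1))%N | y <- e :: s].
have tP x : x \in t ->
    (src x.1.1 = v /\ (x = ((g, 0), (0, 0)) \/ x = ((h, 0), (1, 0)))%N) \/
    (x.1.1 \in e :: s /\
      exists2 b, b \in [:: 0; 1]%N & x = ((x.1.1, b), (b, lvl x.1.1 b))).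
  rewrite !mem_cat => /orP[|/orP[/mapP|/mapP]].
  - by rewrite !inE => /orP[] /eqP ->; left; split=> //; [left|right].
  - by move=> [y ys ->]; right; split=> //; exists 0%N.
  - by move=> [y ys ->]; right; split=> //; exists 1%N.
have nv y : y \in e :: s -> src y <> v by exact: walk_src_end esv'.
have [|br [rb [brP brs]]] := @extend_branching E E_row_finite t _ (inhabits (g, 0%N)).
  split=> x.
  - move=> /tP[[_ [->|->]]|[_ [b _ ->]]] //=; rewrite ?weight_gt0 // /lvl.
    by case: eqP => [->|_]; [case: eqP => _ //|]; exact: weight_gt0.
  - move=> y /tP[[xv xE]|[xs [b _ xE]]] /tP[[yv yE]|[ys [c _ yE]]] xy.
    + by case: xE xy => ->; case: yE => -> //= [] gh'; rewrite gh' eqxx in gh.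
    + by case: (nv _ ys); rewrite -xy.
    + by case: (nv _ xs); rewrite xy.
    + by move: xy; rewrite xE yE /= => -[-> ->].
  - move=> y /tP[[xv xE]|[xs [b _ xE]]] /tP[[yv yE]|[ys [c _ yE]]] sxy xy.
    + by case: xE xy => ->; case: yE => ->.
    + by case: (nv _ ys); rewrite -sxy.
    + by case: (nv _ xs); rewrite sxy.
    + have e1 := walk_src_inj Eac esv' xs ys sxy.
      by move: xy; rewrite xE yE /= e1 => -[->].
have brg : br (g, 0%N) = (0, 0)%N by apply: (brs (_, _)); rewrite inE eqxx.
have brh : br (h, 0%N) = (1, 0)%N by apply: (brs (_, _)); rewrite !inE eqxx orbT.
have brs0 y : y \in e :: s -> br (y, 0%N) = (0, lvl y 0)%N.
  move=> ys; apply: (brs (_, _)); rewrite !mem_cat; apply/orP; right.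
  by apply/orP; left; apply/mapP; exists y.
have brs1 y : y \in e :: s -> br (y, 1%N) = (1, lvl y 1)%N.
  move=> ys; apply: (brs (_, _)); rewrite !mem_cat; apply/orP; right.
  by apply/orP; right; apply/mapP; exists y.
have es : e \notin s.
  apply/negP => /mem_split[s1 [s2 sE]]; move: esv; rewrite sE.
  move=> /walk_catP[w [ew /= [sw _]]].
  suff : e :: s1 = [::] by [].
  by apply: (acyclic_walk Eac (u := src e)); split=> //; rewrite sw.
have br0 y : y \in s -> br (y, 0%N) = (0, 0)%N /\ br (y, 1%N) = (1, 0)%N.
  move=> ys; rewrite brs0 ?brs1 ?inE ?ys ?orbT // /lvl.
  by case: eqP => [ye|//]; rewrite ye (negPf es) in ys.
have bre : br (e, 0%N) = (0, 1)%N /\ br (e, 1%N) = (1, 0)%N.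
  by rewrite brs0 ?brs1 ?mem_head // /lvl eqxx.
have sgh : src g = src h by rewrite gv hv.
have lev1 : ((br (h, 0%N)).2 < weight g)%N by rewrite brh weight_gt0.
have lev0 : ((br (g, 0%N)).2 < weight h)%N by rewrite brg weight_gt0.
pose d0 : D := (g, 0%N); pose d1 : D := (h, 0%N).
pose A := @act K E br rb d0 d1.
(* No edge of the walk starts at v, so none is g or h, and the deformation leaves their action
   unchanged. *)
have neg y : y \in e :: s -> (g == y = false) /\ (y == h = false).
  move=> ys; split; apply/eqP => gy; apply: (nv y ys); [by rewrite -gy|by rewrite gy].
(* y^* z y is diagonal when z is. *)
have step y i z chi : y \in e :: s -> (i < weight y)%N ->
    (forall f n, n.1 = src y -> ev A z f n = if chi n.2 then f n else 0) ->
    forall f n, n.1 = tgt y ->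
    ev A (TMul (tghost K y i) (TMul z (tedge K y i))) f n =
      if ((br (y, n.2)).2 == i) && chi (br (y, n.2)).1 then f n else 0.
  move=> ys iy zE f n ny; have [gy yh] := neg _ ys.
  have iv : (i < vweight (src y))%N.
    exact: leq_trans iy (leq_vweight E_row_finite y).
  rewrite /= (ev_tghost brP (d0 := d0) (d1 := d1) lev0).
  rewrite (ev_tedge brP (d0 := d0) (d1 := d1) lev1) //.
  rewrite /act_ghost ny eqxx /d0 /d1.
  rewrite -pair_eqE /= yh subr0 /level_in /=; case: eqP => //= bi.
  rewrite zE //=; case: ifP => // _; rewrite /act_edge /= eqxx /edge_in /= gy.
  have -> : rb (src y) (br (y, n.2)).1 i = (y, n.2).
    by case: brP => _ brK _; rewrite -bi -[RHS]brK.
  by rewrite /= eqxx eps0 if_same addr0 -ny -surjective_pairing.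
pose ze := TMul (tghost K e 1) (TMul (tvertex K (src e)) (tedge K e 1)).
have zP (r : seq (edge E)) u : walk (tgt e) r u -> {subset r <= s} ->
    exists chi : nat -> bool, [/\ chi 0%N, ~~ chi 1%N & forall f n, n.1 = u ->
      ev A (conjugate ze r) f n = if chi n.2 then f n else 0].
  elim/last_ind: r u => [|r y IH] u.
    move=> <- _; exists (fun b => (br (e, b)).2 == 1%N).
    rewrite bre.1 bre.2; split=> // f n ne.
    rewrite [conjugate _ _]/conjugate [foldl _ _ _]/=.
    rewrite (@step e 1%N _ xpredT) ?mem_head ?andbT // => f' n' /= ->.
    by rewrite eqxx.
  rewrite -{1}cats1 => /walk_catP[w [ew /= [yw yu]]] rs.
  have ys : y \in s by apply: rs; rewrite mem_rcons mem_head.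
  have [|chi [chi0 chi1 chiE]] := IH w ew.
    by move=> x xr; apply: rs; rewrite mem_rcons inE xr orbT.
  have [b0 b1] := br0 y ys.
  exists (fun b => ((br (y, b)).2 == 0%N) && chi (br (y, b)).1).
  rewrite b0 b1; split=> // f n nu.
  rewrite conjugate_rcons (@step y 0%N _ chi) ?inE ?ys ?orbT ?weight_gt0 //.
    by move=> f' n' ny; apply: chiE; rewrite ny yw.
  by rewrite nu yu.
have [chi [chi0 chi1 chiE]] := zP s v esv (fun x => id).
pose z := TMul (tvertex K v) (conjugate ze s).
apply: (@crossing_obstruction K E E_row_finite br rb brP g h 0%N 0%N z chi gh sgh
  (weight_gt0 g) (weight_gt0 h) (weight_gt0 g) brg brh) reg => //.
  by move=> f n; rewrite /= gv; case: eqP => //= nv'; exact: chiE.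
by rewrite eqxx (negPf chi1).
Qed.

End RegularConditions.

(** * Closed words *)

Section Words.
Variables (K : fieldType) (E : wgraph).
Hypothesis E_row_finite : row_finite E.
Local Notation D := (edge E * nat)%type.

(* (e, i, true) stands for e_i and (e, i, false) for its ghost. *)
Definition letter : Type := (edge E * nat * bool)%type.
HB.instance Definition _ := Choice.on letter.

Definition lsrc (l : letter) : vertex E := if l.2 then src l.1.1 else tgt l.1.1.
Definition ltgt (l : letter) : vertex E := if l.2 then tgt l.1.1 else src l.1.1.

(* A word all of whose consecutive letters satisfy [follows] has no factor
   e_i e_j^* or e_i^* f_i, so that it can be traced through distinct basis
   vectors of a branching system. *)
Definition follows (l m : letter) : bool :=
  [&& ltgt l == lsrc m, ~~ [&& l.2, ~~ m.2 & l.1.1 == m.1.1]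
    & ~~ [&& ~~ l.2, m.2 & l.1.2 == m.1.2]].

Definition letter_term (l : letter) : lpa_term K E :=
  if l.2 then tedge K l.1.1 l.1.2 else tghost K l.1.1 l.1.2.

Definition word_term (s : seq letter) (v : vertex E) : lpa_term K E :=
  foldr (fun l x => TMul (letter_term l) x) (tvertex K v) s.

(** Letter number k carries basis index k + 1, taken cyclically, to k. With the entry of [l0]
    rescaled by 1 + eps, x = v - p multiplies the vector at [node 0] by - eps, and the value of x f
    at [node 0] is - eps times that of f; these are the two conditions of the obstruction. *)
Lemma word_obstruction (l0 : letter) (w : seq letter) :
  l0.2 -> cycle follows (l0 :: w) -> all (fun l => l.1.2 < weight l.1.1)%N (l0 :: w) ->
  ~ von_neumann_regular (wLPA K E).
Proof.
move=> l0fwd wcyc wlt; rewrite /= in wcyc; pose N := (size w).+1.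
pose L k := nth l0 (l0 :: w) k.
pose nx k := if k.+1 == N then 0%N else k.+1.
have nxN k : (k < N)%N -> (nx k < N)%N.
  by move=> kN; rewrite /nx; case: eqP => // /eqP kN'; rewrite ltn_neqAle kN' kN.
have nx_inj k l : (k < N)%N -> (l < N)%N -> nx k = nx l -> k = l.
  rewrite /nx; case: eqP => [kN|_]; case: eqP => [lN|_] // _ _; last by case.
  by move=> _; apply: succn_inj; rewrite kN lN.
have Lfol k : (k < N)%N -> follows (L k) (L (nx k)).
  move=> kN; have := pathP l0 wcyc k; rewrite size_rcons => /(_ kN).
  have -> : nth l0 (l0 :: rcons w l0) k = L k by rewrite -rcons_cons nth_rcons /= -/N kN.
  suff -> : nth l0 (rcons w l0) k = L (nx k) by [].
  rewrite /L /nx nth_rcons.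
  case: (ltngtP k (size w)) kN => [kw _|kw|-> _]; last by rewrite /N eqxx.
    by rewrite eqSS ltn_eqF.
  by rewrite ltnS leqNgt kw.
have Llt k : (k < N)%N -> ((L k).1.2 < weight (L k).1.1)%N.
  by move=> kN; apply: (allP wlt); rewrite mem_nth.
pose node k := (lsrc (L k), k).
(* An edge letter has its source at [node k] and its target at the next node; a ghost letter is
   traversed the other way, which swaps the two indices. *)
pose ent k : D * (nat * nat) := let l := L k in
  if l.2 then ((l.1.1, nx k), (k, l.1.2)) else ((l.1.1, k), (nx k, l.1.2)).
(* A coincidence between an edge letter and a ghost letter makes them cyclically adjacent, where
   [follows] forbids it. *)
have ent_inj1 k l : (k < N)%N -> (l < N)%N -> (ent k).1 = (ent l).1 -> k = l.
  rewrite /ent => kN lN; have /and3P[_ fk _] := Lfol k kN.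
  have /and3P[_ fl _] := Lfol l lN.
  case: ifP => kb; case: ifP => lb //= [ekl].
  - exact: nx_inj.
  - by move=> e; move: fk; rewrite kb e lb ekl eqxx.
  - by move=> e; move: fl; rewrite lb -e kb -ekl eqxx.
  - by [].
have ent_inj2 k l : (k < N)%N -> (l < N)%N -> (ent k).2 = (ent l).2 -> k = l.
  rewrite /ent => kN lN; have /and3P[_ _ fk] := Lfol k kN.
  have /and3P[_ _ fl] := Lfol l lN.
  case: ifP => kb; case: ifP => lb //= [e i].
  - by [].
  - by move: fl; rewrite lb -e kb i eqxx.
  - by move: fk; rewrite kb e lb i eqxx.
  - exact: nx_inj.
pose s := [seq ent k | k <- iota 0 N].
have sP x : x \in s -> exists2 k, (k < N)%N & x = ent k.
  by move=> /mapP[k]; rewrite mem_iota => kN ->; exists k.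
have [|br [rb [brP brs]]] := @extend_branching E E_row_finite s _ (inhabits (ent 0).1).
  split=> x.
  - by move=> /sP[k kN ->]; have := Llt k kN; rewrite /ent; case: ifP.
  - by move=> y /sP[k kN ->] /sP[l lN ->] /(ent_inj1 _ _ kN lN) ->.
  - by move=> y /sP[k kN ->] /sP[l lN ->] _ /(ent_inj2 _ _ kN lN) ->.
have {}brs k : (k < N)%N -> br (ent k).1 = (ent k).2.
  by move=> kN; apply: brs; apply: map_f; rewrite mem_iota.
have [_ brK _] := brP.
pose d : D := (ent 0).1.
have lev : ((br d).2 < weight d.1)%N by case: brP => + _ _; apply.
pose A := @act K E br rb d d.
pose M := basis_fun K E.
have edgeE (e : edge E) b a i (f : M) : br (e, b) = (a, i) -> (i < weight e)%N ->
    ev A (tedge K e i) f (src e, a) =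
      f (tgt e, b) + (if (e, b) == d then eps (f (tgt e, b)) else 0).
  move=> eb ie; rewrite (ev_tedge brP (d0 := d) (d1 := d) lev); last first.
    exact: leq_trans ie (leq_vweight E_row_finite e).
  rewrite /act_edge /= eqxx.
  have -> : rb (src e) a i = (e, b) by have := brK (e, b); rewrite eb.
  by rewrite /edge_in /= eqxx; case: eqP => // <-; rewrite /= eqxx.
have edge_dirac (e : edge E) b a i : br (e, b) = (a, i) -> (i < weight e)%N ->
    ev A (tedge K e i) (dirac K (tgt e, b)) =
      dirac K (src e, a) + (if (e, b) == d then eps_fun (dirac K (src e, a)) else 0).
  move=> eb ie; have iv : (i < vweight (src e))%N.
    exact: leq_trans ie (leq_vweight E_row_finite e).
  rewrite (ev_tedge brP (d0 := d) (d1 := d) lev) //.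
  apply/funext => m; rewrite /act_edge addfE.
  have edge0 d' : edge_in e (dirac K (tgt e, b)) d' = if d' == (e, b) then (1, 0) else 0.
    rewrite /edge_in /dirac; case: d' => e' b'; rewrite -!pair_eqE /= eqxx.
    by case: (e' == e).
  case: (eqVneq m.1 (src e)) => [me|me]; last first.
    have mne : (m == (src e, a)) = false.
      by apply/eqP => mE; rewrite mE eqxx in me.
    rewrite {1}/dirac mne; case: ifP => _; last by rewrite addr0.
    by rewrite /eps_fun /dirac mne eps0 addr0.
  rewrite /= !edge0 (rbE brP) ?me // eqxx eb /=.
  have -> : ((a, i) == (m.2, i)) = (m == (src e, a)).
    by rewrite [m]surjective_pairing -!pair_eqE /= me !eqxx andbT eq_sym.
  rewrite /dirac; congr (_ + _); rewrite (rbE brP) ?me //.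
  case: (eqVneq (e, b) d) => [<-|eNd] /=; last by rewrite eps0 if_same.
  rewrite eqxx eb /=.
  have -> : ((a, i) == (m.2, i)) = (m == (src e, a)).
    by rewrite [m]surjective_pairing -!pair_eqE /= me !eqxx andbT eq_sym.
  by rewrite /eps_fun /dirac /=; case: ifP.
have ghostE (e : edge E) b a i (f : M) : br (e, b) = (a, i) -> (e, b) != d ->
    ev A (tghost K e i) f (tgt e, b) = f (src e, a).
  move=> eb ebd; rewrite (ev_tghost brP (d0 := d) (d1 := d) lev).
  by rewrite /act_ghost /= eqxx (negPf ebd) subr0 /level_in eb eqxx.
have ghost_dirac (e : edge E) b a i : br (e, b) = (a, i) -> (e, b) != d ->
    ev A (tghost K e i) (dirac K (src e, a)) = dirac K (tgt e, b).
  move=> eb ebd; rewrite (ev_tghost brP (d0 := d) (d1 := d) lev).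
  have level0 d' : level_in br i (dirac K (src e, a)) d' =
      if d' == (e, b) then (1, 0) else 0.
    rewrite /level_in /dirac; case: (d' =P (e, b)) => [->|ne]; first by rewrite eb !eqxx.
    case: eqP => // bi; case: eqP => // -[sd ad]; case: ne.
    by apply: (branching_inj brP) => //; rewrite eb [br d']surjective_pairing ad bi.
  apply/funext => m; rewrite /act_ghost !level0 (eq_sym d) (negPf ebd) eps0 if_same subr0.
  rewrite /dirac [m]surjective_pairing -!pair_eqE /= eqxx /=.
  by case: (m.1 == tgt e).
have Lnx k : (k < N)%N -> ltgt (L k) = lsrc (L (nx k)).
  by move=> kN; have /and3P[/eqP] := Lfol k kN.
have d0E k : (0 < k)%N -> (k < N)%N -> (ent k).1 != d.
  by move=> k0 kN; apply/eqP => /(ent_inj1 _ _ kN (ltn0Sn _)) kE; rewrite kE in k0.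
have stepE k f : (0 < k)%N -> (k < N)%N ->
    ev A (letter_term (L k)) f (node k) = f (node (nx k)).
  move=> k0 kN; have := d0E k k0 kN; have := brs k kN; have := Llt k kN.
  rewrite /node -Lnx // /ent /lsrc /ltgt /letter_term.
  case: ifP => _ /= klt bk kd; last exact: ghostE.
  by rewrite (edgeE _ _ _ _ _ bk) // (negPf kd) addr0.
have step_dirac k : (0 < k)%N -> (k < N)%N ->
    ev A (letter_term (L k)) (dirac K (node (nx k))) = dirac K (node k).
  move=> k0 kN; have := d0E k k0 kN; have := brs k kN; have := Llt k kN.
  rewrite /node -Lnx // /ent /lsrc /ltgt /letter_term.
  case: ifP => _ /= klt bk kd; last exact: ghost_dirac.
  by rewrite (edge_dirac _ _ _ _ bk) // (negPf kd) addr0.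
have ent0 : ent 0 = ((l0.1.1, nx 0), (0, l0.1.2))%N by rewrite /ent /L /= l0fwd.
have br0 : br (l0.1.1, nx 0) = (0, l0.1.2)%N by have := brs 0 (ltn0Sn _); rewrite ent0.
have l0E : letter_term l0 = tedge K l0.1.1 l0.1.2 by rewrite /letter_term l0fwd.
have node0 : node 0 = (src l0.1.1, 0%N) by rewrite /node /lsrc /L /= l0fwd.
have node1 : node (nx 0) = (tgt l0.1.1, nx 0).
  by rewrite /node -Lnx // /ltgt /L /= l0fwd.
have step0E f : ev A (letter_term l0) f (node 0) =
    f (node (nx 0)) + eps (f (node (nx 0))).
  rewrite l0E node0 node1 (edgeE _ _ _ _ _ br0); last exact: (Llt 0).
  by rewrite /d ent0 eqxx.
have step0_dirac : ev A (letter_term l0) (dirac K (node (nx 0))) =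
    dirac K (node 0) + eps_fun (dirac K (node 0)).
  rewrite l0E node0 node1 (edge_dirac _ _ _ _ br0); last exact: (Llt 0).
  by rewrite /d ent0 eqxx.
pose v := lsrc l0.
(* The suffixes avoid letter 0, so they act undeformed; the empty suffix k = N is back at
   [node 0]. *)
have suffix j : (j < N)%N -> let k := (N - j)%N in
    (forall f, ev A (word_term (drop k (l0 :: w)) v) f
         (node (if k == N then 0%N else k)) =
       f (node 0)) /\
    ev A (word_term (drop k (l0 :: w)) v) (dirac K (node 0)) =
      dirac K (node (if k == N then 0%N else k)).
  elim: j => [_|j IH jN] /=.
    rewrite subn0 eqxx drop_oversize //=; split=> [f|]; first by rewrite eqxx.
    apply/funext => m; case: ifP => // /negP mv; rewrite /dirac.
    by case: eqP => // mE; case: mv; rewrite mE.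
  have [IH1 IH2] := IH (ltnW jN).
  set k := (N - j.+1)%N; have k0 : (0 < k)%N by rewrite subn_gt0.
  have kS : (N - j)%N = k.+1 by rewrite /k subnSK // ltnW.
  have kN : (k < N)%N by rewrite /k ltn_subrL.
  have dropk : drop k (l0 :: w) = L k :: drop k.+1 (l0 :: w) by exact: drop_nth.
  rewrite kS in IH1 IH2.
  rewrite [drop _ _]dropk /= ltn_eqF //; split=> [f|].
    by rewrite stepE // /nx IH1.
  by rewrite IH2 -/(nx k) step_dirac.
have [wE wdirac] := suffix (size w) (ltnSn _).
rewrite subSnn in wE wdirac.
have nx0 : (if (1 == N)%N then 0%N else 1%N) = nx 0 by [].
rewrite nx0 /= drop0 in wE wdirac.
pose x := TAdd (tvertex K v) (TOpp (word_term (l0 :: w) v)).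
have xE f : ev A x f =
    ev A (tvertex K v) f - ev A (letter_term l0) (ev A (word_term w v) f) by [].
have vdirac : ev A (tvertex K v) (dirac K (node 0)) = dirac K (node 0).
  apply/funext => m /=; case: ifP => // /negP mv; rewrite /dirac.
  by case: eqP => // mE; case: mv; rewrite mE.
have xdirac : ev A x (dirac K (node 0)) = eps_fun (- dirac K (node 0)).
  rewrite xE vdirac wdirac step0_dirac.
  rewrite opprD addrA subrr add0r; apply/funext => m.
  by rewrite /eps_fun; exact/esym/epsN.
apply: (@branching_obstruction K E E_row_finite br rb brP d d erefl lev lev x
  (dirac K (node 0)) (- dirac K (node 0)) (node 0) xdirac).
  move=> f; rewrite -/A xE.
  have -> : forall f1 f2 : M, (f1 - f2) (node 0) = f1 (node 0) - f2 (node 0) by [].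
  rewrite step0E wE [ev A (tvertex _ _) _ _]/= eqxx opprD addrA subrr add0r.
  by rewrite epsN eps_eps oppr0.
rewrite -/A xdirac /eps_fun -[(- _) _]/(- dirac K (node 0) (node 0)) diracE epsN => /eqP.
by rewrite oppr_eq0 => /eqP; exact: eps_one.
Qed.

End Words.

(** * Closed words made of walks and reversed walks, acyclicity, (LPA3) and (W2) *)

Lemma cycle_flatten (S T : Type) (r : rel T) (l : rel S) (h : S -> T) (t : S -> seq T)
    (s : seq S) :
  (forall x, path r (h x) (t x)) ->
  (forall x y, l x y -> r (last (h x) (t x)) (h y)) ->
  cycle l s -> cycle r (flatten [seq h x :: t x | x <- s]).
Proof.
move=> ht lr; case: s => [//|x s] /=.
have flat y u z : path l y (rcons u z) ->
    path r (last (h y) (t y)) (rcons (flatten [seq h x :: t x | x <- u]) (h z)).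
  elim: u y => [|a u IH] y /=; first by rewrite !andbT => /lr.
  by move=> /andP[/lr -> /IH]; rewrite rcons_cat cat_path ht.
by move=> /flat xs; rewrite rcons_cat cat_path ht.
Qed.

Section ClosedWalks.
Variable E : wgraph.
Implicit Types (e f : edge E) (s : seq (edge E)).

Local Notation letter := (letter E).

Definition ghost_word (i : nat) e s : seq letter :=
  rev ((e, i, false) :: [seq (f, 0%N, false) | f <- s]).

Local Notation compose := (fun e f => tgt e == src f).

Lemma forward_path i e s : path compose e s ->
  path (@follows E) (e, i, true) [seq (f, 0%N, true) | f <- s].
Proof.
elim: s e i => [//|f s IH] e i /= /andP[ef fs]; rewrite IH // andbT.
by rewrite /follows /= ef.
Qed.

Lemma ghost_path i e s : path compose e s ->
  path (fun l m => follows m l) (e, i, false) [seq (f, 0%N, false) | f <- s].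
Proof.
elim: s e i => [//|f s IH] e i /= /andP[ef fs]; rewrite IH // andbT.
by rewrite /follows /= /lsrc /ltgt /= eq_sym ef.
Qed.

Lemma last_forward i e s : let l := last (e, i, true) [seq (f, 0%N, true) | f <- s] in
  l.1.1 = last e s /\ l.2.
Proof. by elim: s e i => [|f s IH] e i //=; exact: IH. Qed.

Lemma last_ghost i e s : let l := last (e, i, false) [seq (f, 0%N, false) | f <- s] in
  l.1.1 = last e s /\ ~~ l.2.
Proof. by elim: s e i => [|f s IH] e i //=; exact: IH. Qed.

(* ((i, e, s), (j, f, t)) encodes the word p q^*, where p is the walk e s with
   first index i, q is the walk f t with first index j, and all the other
   indices are 0. *)
Definition bend : Type :=
  ((nat * edge E * seq (edge E)) * (nat * edge E * seq (edge E)))%type.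

Definition bend_head (b : bend) : letter := (b.1.1.2, b.1.1.1, true).
Definition bend_tail (b : bend) : seq letter :=
  [seq (f, 0%N, true) | f <- b.1.2] ++ ghost_word b.2.1.1 b.2.1.2 b.2.2.

Definition is_bend (b : bend) : Prop :=
  [/\ (b.1.1.1 < weight b.1.1.2)%N, (b.2.1.1 < weight b.2.1.2)%N,
      path compose b.1.1.2 b.1.2, path compose b.2.1.2 b.2.2 &
      tgt (last b.1.1.2 b.1.2) = tgt (last b.2.1.2 b.2.2) /\
      last b.1.1.2 b.1.2 <> last b.2.1.2 b.2.2].

(** Distinct indices prevent the cancellation e_i^* f_i where one bend meets the next. *)
Definition bend_link (b c : bend) : bool :=
  (src b.2.1.2 == src c.1.1.2) && (b.2.1.1 != c.1.1.1).

Lemma bend_path b : is_bend b -> path (@follows E) (bend_head b) (bend_tail b).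
Proof.
case: b => -[[i e] s] [[j f] t] [/= _ _ es ft [tst nst]].
rewrite cat_path forward_path //= /ghost_word /=.
rewrite lastI rev_rcons /= rev_path ghost_path // andbT.
have [l1 l2] := last_forward i e s; have [m1 m2] := last_ghost j f t.
rewrite /follows /ltgt /lsrc l2 (negPf m2) l1 m1 tst eqxx /=.
by rewrite andbT; apply/eqP.
Qed.

Lemma bend_last b : last (bend_head b) (bend_tail b) = (b.2.1.2, b.2.1.1, false).
Proof. by rewrite last_cat /ghost_word rev_cons last_rcons. Qed.

Lemma bend_follows b c : bend_link b c ->
  follows (last (bend_head b) (bend_tail b)) (bend_head c).
Proof. by rewrite bend_last => /andP[sbc ij]; rewrite /follows /ltgt /lsrc /= sbc. Qed.

Lemma bend_weight b : is_bend b ->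
  all (fun l => l.1.2 < weight l.1.1)%N (bend_head b :: bend_tail b).
Proof.
case: b => -[[i e] s] [[j f] t] [/= ie jf _ _ _].
rewrite ie all_cat /ghost_word all_rev /= jf !all_map /=.
by apply/andP; split; apply/allP => g _; exact: weight_gt0.
Qed.

Variable K : fieldType.
Hypothesis E_row_finite : row_finite E.
Hypothesis reg : von_neumann_regular (wLPA K E).

Lemma regular_no_bends (b : bend) (s : seq bend) :
  (forall c, c \in b :: s -> is_bend c) ->
  ~~ cycle bend_link (b :: s).
Proof.
move=> bs; apply/negP => cyc.
(* Outside [is_bend] the value is that of b, since [cycle_flatten] requires the path condition for
   every element of the type. *)
pose h c := if `[< is_bend c >] then bend_head c else bend_head b.
pose t c := if `[< is_bend c >] then bend_tail c else bend_tail b.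
have bb : is_bend b by apply: bs; rewrite mem_head.
have hb : h b = bend_head b by rewrite /h asboolT.
have cyc' : cycle (@follows E) (flatten [seq h c :: t c | c <- b :: s]).
  apply: (@cycle_flatten _ _ _ (fun c d =>
      [&& bend_link c d, `[< is_bend c >] & `[< is_bend d >]])).
  - by move=> c; rewrite /h /t; case: asboolP => [cb|_]; exact: bend_path.
  - by move=> c d /and3P[cd /asboolP cb /asboolP db];
      rewrite /h /t !asboolT //; exact: bend_follows.
  - have : all (fun c => `[< is_bend c >]) (b :: s).
      by apply/allP => c /bs; exact: asboolT.
    move=> ab; apply: (sub_in_cycle (P := fun c => `[< is_bend c >])) cyc => //.
    by move=> c d cb db cd; apply/and3P.
apply: (@word_obstruction K E E_row_finite (h b)
  (t b ++ flatten [seq h c :: t c | c <- s])) reg => //.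
  by rewrite hb.
apply/allP => l; rewrite -[_ :: _]/(flatten [seq h c :: t c | c <- b :: s]).
move=> /flattenP[_ /mapP[c cs ->]]; have cb := bs c cs.
by rewrite /h /t !asboolT //; exact: (allP (bend_weight cb)).
Qed.

Lemma regular_acyclic : acyclic E.
Proof.
move=> p [pcl _].
apply: (@word_obstruction K E E_row_finite (first_edge p, 0%N, true)
  [seq (f, 0%N, true) | f <- next_edges p]) reg => //.
  rewrite /= rcons_path forward_path ?npathP //=.
  have [l1 l2] := last_forward 0 (first_edge p) (next_edges p).
  by rewrite /follows /ltgt /lsrc l2 l1 /= !andbT; apply/eqP; exact: pcl.
by rewrite /= weight_gt0 all_map; apply/allP => e _; exact: weight_gt0.
Qed.

(** Walks from e and f to a common vertex are shortened until their last letters differ; e and f not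
    being in line ensures that this happens before either is used up. With p, q the resulting walks,
    p q^* with first indices 0 followed by q p^* with first indices 1 is a closed word without
    cancellation. Index 1 exists because both edges are weighted. *)
Lemma regular_LPA3 : LPA3 E.
Proof.
move=> e f we wf nef; apply/seteqP; split=> // v [/reachesP[s es] /reachesP[t ft]].
have [s' [t' [v' [es' ft' st']]]] : exists s' t' v',
    [/\ walk (src e) (e :: s') v', walk (src f) (f :: t') v' & last e s' <> last f t'].
  elim/last_ind: s v t es ft => [|s a IH] v t.
    case/lastP: t => [|t b] /= ev.
      move=> fv; exists [::], [::], v; split=> // ef.
      by apply: nef; constructor 1.
    move: (ev); rewrite -{1}cats1 => ev' /walk_catP[w [fw /= [bw bv]]].
    have [eb|eb] := pselect (e = b); last first.
      exists [::], (rcons t b), v; split=> //; last by rewrite last_rcons.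
      by split=> //; rewrite -cats1; apply: walk_cat fw _.
    by case: nef; constructor 3; apply/reachesP; exists t; rewrite eb bw.
  rewrite -{1}cats1 => /walk_catP[w [ew /= [aw av]]].
  have ea : walk (tgt e) (rcons s a) v by rewrite -cats1; apply: walk_cat ew _.
  case/lastP: t => [|t b] /= fv.
    have [fa|fa] := pselect (f = a); last first.
      by exists (rcons s a), [::], v; split=> //; rewrite last_rcons => /esym.
    by case: nef; constructor 2; apply/reachesP; exists s; rewrite fa aw.
  move: (fv); rewrite -{1}cats1 => /walk_catP[w' [fw' /= [bw' bv]]].
  have [ab|ab] := pselect (a = b); last first.
    by exists (rcons s a), (rcons t b), v; rewrite !last_rcons.
  by apply: (IH w t ew); rewrite -aw ab bw'.
have /walk_path[_ es1 es2] := es'; have /walk_path[_ ft1 ft2] := ft'.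
pose b1 : bend := ((0%N, e, s'), (0%N, f, t')).
pose b2 : bend := ((1%N, f, t'), (1%N, e, s')).
suff : ~~ cycle bend_link [:: b1; b2] by rewrite /= /bend_link /= !eqxx.
apply: regular_no_bends => c; rewrite !inE => /orP[] /eqP ->.
  by split=> //=; rewrite ?weight_gt0 // es2 ft2.
by split=> //=; rewrite es2 ft2; split=> // /esym.
Qed.

(** The closed word is p_1 q_1^* ... p_n q_n^*, where every p_i starts with index 1, available since
    its first edge is weighted, and every q_i with index 0. The indices therefore differ at each
    junction. *)
Lemma regular_W2 : W2 E.
Proof.
move=> [m [p [q [tpq s0 sS pqP]]]].
pose b (i : nat) : bend :=
  ((1%N, first_edge (p (inord i)), next_edges (p (inord i))),
   (0%N, first_edge (q (inord i)), next_edges (q (inord i)))).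
have bP i : is_bend (b i).
  have [wp uq ne] := pqP (inord i).
  by split=> //=; rewrite ?weight_gt0 ?npathP //; split=> //; exact: tpq.
suff : cycle bend_link (b 0 :: [seq b i | i <- iota 1 m]).
  by apply/negP; apply: regular_no_bends => c; rewrite inE => /predU1P[->|/mapP[i _ ->]].
rewrite /= rcons_path; apply/andP; split.
  rewrite path_map.
  have chain k n : (k + n <= m)%N -> path (relpre b bend_link) k (iota k.+1 n).
    elim: n k => [//|n IH] k; rewrite addnS => kn /=.
    rewrite IH ?addSn // andbT /bend_link /= andbT.
    have km : (k < m)%N by apply: leq_trans kn; rewrite ltnS leq_addr.
    apply/eqP/esym/(sS (inord k) (inord k.+1)).
    by rewrite !inordK // ltnS // ltnW.
  exact: chain.
have lastE k n : last k (iota k.+1 n) = (k + n)%N.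
  by elim: n k => [|n IH] k; rewrite ?addn0 //= IH addSnnS.
rewrite last_map lastE add0n.
rewrite /bend_link /= andbT; apply/eqP.
have -> : inord m = ord_max :> 'I_m.+1 by apply: val_inj; rewrite /= inordK.
have -> : inord 0 = ord0 :> 'I_m.+1 by apply: val_inj; rewrite /= inordK.
exact/esym.
Qed.

Lemma regular_well_behaved : acyclic E /\ well_behaved E.
Proof.
split; [exact: regular_acyclic|split].
- exact: (regular_LPA1 E_row_finite reg).
- exact: (regular_LPA2 E_row_finite reg regular_acyclic).
- exact: regular_LPA3.
- by move=> v _ [p [pc _]]; exact: regular_acyclic pc.
- exact: regular_W2.
Qed.

End ClosedWalks.

Theorem theorem6p3p2 (K : fieldType) (E : wgraph)
    (E_nonempty : inhabited (vertex E))
    (E_row_finite : row_finite E)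
    (E_connected : graph_connected E) :
  (von_neumann_regular (wLPA K E) <-> acyclic E /\ well_behaved E) /\
  (acyclic E /\ well_behaved E <-> locally_matricial (wLPA K E)).
Proof.
have i_ii : von_neumann_regular (wLPA K E) -> acyclic E /\ well_behaved E.
  exact: regular_well_behaved.
have ii_iii : acyclic E /\ well_behaved E -> locally_matricial (wLPA K E).
  by move=> [Eac [L1 L2 L3 _ W]]; exact: well_behaved_locally_matricial.
have iii_i := @locally_matricial_regular K (wLPA K E).
by split; split; [exact: i_ii|move=> /ii_iii/iii_i|exact: ii_iii|move=> /iii_i/i_ii].
Qed.
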